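(* Let $f$ be a real-valued continuous function on $\mathbb R$. Then $f\in H^{\frac32}$ if and only if $f$ extends to a quasiconformal deformation $\tilde f$ on the upper half-plane $\mathbb U$ such that $\tilde f(z)=o(z^2)$ as $z\to\infty$ and $$\iint_{\mathbb U}|\bar\partial\tilde f(z)|^2y^{-2}dxdy<\infty,\qquad z=x+iy.$$
   Context: $H^{\frac32}$: locally absolutely continuous functions $f$ on $\mathbb R$ with $f'\in H^{\frac12}$, where $H^{\frac12}$ consists of locally integrable $\varphi$ with $\frac1{4\pi^2}\int_{\mathbb R}\int_{\mathbb R}\frac{|\varphi(s)-\varphi(t)|^2}{|s-t|^2}ds\,dt<\infty$. A quasiconformal deformation on a domain $\Omega$ is a complex-valued function $F$ on $\Omega$ having a generalized (distributional) derivative $\bar\partial F$ with $\bar\partial F\in L^\infty(\Omega)$; an extension of $f$ means a continuous function on $\mathbb U\cup\mathbb R$ equal to $f$ on $\mathbb R$. *)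

(* Defs.v *)
From HB Require Import structures.
From mathcomp Require Import all_boot all_order all_algebra.
From mathcomp Require Import all_classical all_reals all_analysis.
Set Implicit Arguments. Unset Strict Implicit. Unset Printing Implicit Defensive.
Import Order.TTheory GRing.Theory Num.Theory.
Import numFieldNormedType.Exports.
Local Open Scope classical_set_scope.
Local Open Scope ring_scope.

(* We work over an arbitrary realType R; a complex number z = x + iy is the
   pair (x, y) : R * R, and a complex-valued function is a pair (u, v) of
   real-valued functions (real and imaginary parts). *)

Section Defs.
Variable R : realType.

Notation mu1 := (@lebesgue_measure R).
Definition mu2 := (mu1 \x mu1)%E.

Definition UHP : set (R * R) := [set p | 0 < p.2].
Definition cUHP : set (R * R) := [set p | 0 <= p.2].

Definition abs_cont_on (f : R -> R) (a b : R) :=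
  forall eps : R, 0 < eps -> exists2 delta : R, 0 < delta &
    forall (n : nat) (c d : nat -> R),
      (forall i, (i < n)%N -> a <= c i /\ c i <= d i /\ d i <= b) ->
      (forall i, (i.+1 < n)%N -> d i <= c i.+1) ->
      \sum_(i < n) (d i - c i) < delta ->
      \sum_(i < n) `|f (d i) - f (c i)| < eps.

Definition loc_abs_cont (f : R -> R) := forall a b : R, a <= b -> abs_cont_on f a b.

Definition H12 (phi : R -> R) :=
  locally_integrable setT phi /\
  ((1 / (4 * pi ^+ 2))%:E *
    \int[mu1]_s \int[mu1]_t ((phi s - phi t) ^+ 2 / (s - t) ^+ 2)%:E < +oo)%E.

(* H^{3/2}: f' is the (everywhere defined, a.e. meaningful) derivative *)
Definition H32 (f : R -> R) := loc_abs_cont f /\ H12 (derive1 f).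

Fixpoint iter_deriv (l : seq (R * R)) (phi : R * R -> R) : R * R -> R :=
  match l with
  | [::] => phi
  | v :: l' => fun p => 'D_v (iter_deriv l' phi) p
  end.

Definition test_fun_UHP (phi : R * R -> R) :=
  (forall l, continuous (iter_deriv l phi)) /\
  (forall l (v p : R * R), derivable (iter_deriv l phi) p v) /\
  exists a b c d : R, 0 < c /\
    forall p : R * R, ~ (a <= p.1 <= b /\ c <= p.2 <= d) -> phi p = 0.

Definition dx (phi : R * R -> R) p := 'D_((1, 0) : R * R) phi p.
Definition dy (phi : R * R -> R) p := 'D_((0, 1) : R * R) phi p.

(* (g1 + i g2) is the distributional derivative dbar of (u + i v) on U:
   <dbar F, phi> = - <F, dbar phi>, with dbar phi = (phi_x + i phi_y)/2;
   by C-linearity it suffices to test real test functions phi. *)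
Definition is_dbar_UHP (u v g1 g2 : R * R -> R) :=
  forall phi, test_fun_UHP phi ->
    (\int[mu2]_(p in UHP) (g1 p * phi p)%:E =
       - \int[mu2]_(p in UHP) ((u p * dx phi p - v p * dy phi p) / 2)%:E)%E /\
    (\int[mu2]_(p in UHP) (g2 p * phi p)%:E =
       - \int[mu2]_(p in UHP) ((v p * dx phi p + u p * dy phi p) / 2)%:E)%E.

Definition Linfty_UHP (g1 g2 : R * R -> R) :=
  measurable_fun UHP g1 /\ measurable_fun UHP g2 /\
  exists M : R, mu2 (UHP `&` [set p | M < Num.sqrt (g1 p ^+ 2 + g2 p ^+ 2)]) = 0%E.

Definition qc_deformation_UHP (u v g1 g2 : R * R -> R) :=
  is_dbar_UHP u v g1 g2 /\ Linfty_UHP g1 g2.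

End Defs.

(* Main.v *)
Require Import Defs.
From HB Require Import structures.
From mathcomp Require Import all_boot all_order all_algebra.
From mathcomp Require Import all_classical all_reals all_analysis.
From mathcomp Require Import measurable_realfun.
From mathcomp Require Import ring lra.
Import Order.TTheory GRing.Theory Num.Theory.
Import numFieldNormedType.Exports.
Set Implicit Arguments. Unset Strict Implicit. Unset Printing Implicit Defensive.
Local Open Scope classical_set_scope.
Local Open Scope ring_scope.

(** If [f] is in [H32], let [G' = f] and extend [f] to [y > 0] by
    [u = (G(x+y) - G(x-y)) / 2y], [v = (G(x+y) + G(x-y) - 2G(x)) / y].  The dbar
    derivative of [u + iv] is a combination of values of [f] and [G] that vanishes
    for affine [f], hence is at most [(2/y) \int_{x-y}^{x+y} |f' - c|] for every [c];
    the choices [c = f'(x)] and [c = f'(t)] averaged over [t] bound the energy and the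
    sup norm.

    Conversely, testing dbar [F] against a regularized Cauchy kernel and using the
    growth of [F] to discard the terms at infinity writes [f(x)] as an affine function
    minus a constant times the integral of [Re(g K_x)], where
    [K_x(z) = 1/(z-x) - (1-x)/z - x/(z-1)].  Differentiating under the integral gives a density
    [w] with [w(s) - w(t) = c \int Re (g ((z-s)^-2 - (z-t)^-2))], and a Schur test bounds
    its energy by that of [g / y]. *)

(** * Measurability *)

(** The obstacle in the converse is a borderline divergence. The energy makes [g / y] square
    integrable, but [y / |z - s|^2] just fails to be, both near [s] and at infinity, so
    [g / (z - s)^2] need not be integrable for a given [s]. Differences of two such kernels decay
    faster at infinity, while the singularity at the pole is harmless only on average over [s];
    hence a Schur test, a density that is defined for almost every [s], and Fubini's theorem as the
    form in which one differentiates under the integral. Interpolating at [0] and [1] amounts to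
    subtracting the mean of the differentiated kernel over [[0, 1]]. By partial fractions
    [K_x(z) = x (x - 1) / (z (z - 1) (z - x))]: decay of order [|z|^-3], against [o(z^2)], a cut-off
    gradient of order [1/N] and an area of order [N^2], is just enough at infinity. That [f] is real
    enters as [v = 0] on the axis, which kills the boundary layer of the cut-off. In the direct part
    the imaginary part is normalised so that the identity map extends to the identity; this is the
    cancellation on affine functions. The growth condition comes from one point at which the inner
    energy integral is finite. *)

Section Toolbox.
Variable R : realType.

Lemma measurable_inv : measurable_fun [set: R] (@GRing.inv R).
Proof.
have -> : [set: R] = [set x | x != 0] `|` [set 0].
  by apply/seteqP; split=> // x _ /=; case: (eqVneq x 0); [right|left].
have oD : open [set x : R | x != 0].
  rewrite (_ : mkset _ = ~` [set 0]); last first.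
    by apply/seteqP; split=> x /= /eqP.
  exact/closed_openC/accessible_closed_set1/hausdorff_accessible/Rhausdorff.
apply/measurable_funU => //.
- by apply: open_measurable.
- split; last exact: measurable_fun_set1.
  apply: open_continuous_measurable_fun => // x; rewrite inE /= => x0.
  exact: inv_continuous.
Qed.

Lemma measurable_funV d (T : measurableType d) (D : set T) (f : T -> R) :
  measurable_fun D f -> measurable_fun D (fun x => (f x)^-1).
Proof. by move=> mf; exact: (measurableT_comp measurable_inv). Qed.

Lemma measurable_fun_sqrt d (T : measurableType d) (D : set T) (f : T -> R) :
  measurable_fun D f -> measurable_fun D (fun x => Num.sqrt (f x)).
Proof.
move=> mf; apply: (measurableT_comp _ mf).
by apply: continuous_measurable_fun; exact: sqrt_continuous.
Qed.

Section CS.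
Context d (T : measurableType d) (mu : {measure set T -> \bar R}).

(** Hölder's inequality with exponents 2 for the square roots of [a] and [b]. The squared form with
    [c ^+ 2 <= a * b] allows infinite integrals and lets an integrand be split unevenly without
    naming the factors. *)
Lemma cauchy_schwarz (a b c : T -> R) :
  measurable_fun setT a -> measurable_fun setT b -> measurable_fun setT c ->
  (forall x, 0 <= a x) -> (forall x, 0 <= b x) -> (forall x, 0 <= c x) ->
  (forall x, c x ^+ 2 <= a x * b x) ->
  ((\int[mu]_x (c x)%:E) * (\int[mu]_x (c x)%:E) <=
   (\int[mu]_x (a x)%:E) * (\int[mu]_x (b x)%:E))%E.
Proof.
move=> ma mb mc a0 b0 c0 cab.
have ge0i (h : T -> R) : (forall x, 0 <= h x) -> (0 <= \int[mu]_x (h x)%:E)%E.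
  by move=> h0; apply: integral_ge0 => x _; rewrite lee_fin.
pose f := fun x => Num.sqrt (a x); pose g := fun x => Num.sqrt (b x).
have mf : measurable_fun setT f by exact: measurable_fun_sqrt.
have mg : measurable_fun setT g by exact: measurable_fun_sqrt.
have H := @hoelder _ _ R mu f g 2 2 mf mg.
have {}H := H ltac:(by []) ltac:(by []) ltac:(lra).
have L1 : (\int[mu]_x (c x)%:E <= 'N[mu]_1[EFin \o (f \* g)%R])%E.
  rewrite Lnorm1; apply: ge0_le_integral => //.
  - by move=> x _; rewrite lee_fin.
  - exact/measurable_EFinP.
  - apply: (@measurableT_comp _ _ _ _ _ _ (@abse R)) => //.
    by apply/measurable_EFinP; exact: measurable_funM.
  - move=> x _ /=; rewrite lee_fin /f /g -sqrtrM// ger0_norm ?sqrtr_ge0//.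
    by rewrite -(ger0_norm (c0 x)) -sqrtr_sqr ler_wsqrtr.
have N2 (h : T -> R) : (forall x, 0 <= h x) ->
    ('N[mu]_2%:E[EFin \o (fun x => Num.sqrt (h x))] *
     'N[mu]_2%:E[EFin \o (fun x => Num.sqrt (h x))] = \int[mu]_x (h x)%:E)%E.
  move=> h0; have sq (X : \bar R) : (0 <= X)%E -> (X * X = X `^ 2)%E.
    case: X => [r| |//]; last by rewrite poweRyr.
    by rewrite lee_fin => r0; rewrite poweR_EFin powR_mulrn// expr2 EFinM.
  rewrite sq ?Lnorm_ge0// poweR_Lnorm//.
  apply: eq_integral => x _ /=.
  by rewrite ger0_norm ?sqrtr_ge0// powR_mulrn ?sqrtr_ge0// sqr_sqrtr.
apply: (@le_trans _ _ (('N[mu]_2%:E[EFin \o f] * 'N[mu]_2%:E[EFin \o g]) *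
   ('N[mu]_2%:E[EFin \o f] * 'N[mu]_2%:E[EFin \o g]))%E).
  by apply: lee_pmul; rewrite ?ge0i//; exact: le_trans H.
by rewrite muleACA !N2.
Qed.

End CS.

(** Measurability in [R * R] refers to the product sigma-algebra, so open sets have to be written as
    countable unions of squares with rational centre and radius. *)
Lemma open_measurable2 (U : set (R * R)) : open U -> measurable U.
Proof.
move=> oU.
pose B (q : rat * rat * rat) : set (R * R) :=
  (ball (ratr q.1.1 : R) (ratr q.2)) `*` (ball (ratr q.1.2 : R) (ratr q.2)).
have -> : U = \bigcup_(q in [set q | B q `<=` U]) B q.
  apply/seteqP; split=> [p Up|p [q /= qU]]; last exact: qU.
  have [e /= e0 eU] := (nbhs_ballP _ _).1 (open_nbhs_nbhs (conj oU Up)).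
  have e2 : 0 < e / 2 by rewrite divr_gt0.
  have [q qe] := rat_in_itvoo e2.
  move: qe; rewrite in_itv/= => /andP[q0 qe].
  have [a aI] : exists a : rat, ratr a \in `]p.1 - ratr q, p.1 + ratr q[.
    by apply/rat_in_itvoo; lra.
  have [b bI] : exists a : rat, ratr a \in `]p.2 - ratr q, p.2 + ratr q[.
    by apply/rat_in_itvoo; lra.
  move: aI bI; rewrite !in_itv/= => /andP[a1 a2] /andP[b1 b2].
  exists ((a, b), q).
    move=> [x y] [/= Bx By]; apply: eU; split => /=.
    + move: Bx; rewrite /ball/= => Bxx.
      have := ler_distD (ratr a) p.1 x; have : `|p.1 - ratr a| < ratr q by rewrite ltr_norml; apply/andP; split; lra.
      lra.
    + move: By; rewrite /ball/= => Bxx.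
      have := ler_distD (ratr b) p.2 y; have : `|p.2 - ratr b| < ratr q by rewrite ltr_norml; apply/andP; split; lra.
      lra.
  by split; rewrite /ball /= ltr_norml; apply/andP; split; lra.
rewrite bigcup_mkcond; apply: countable_bigcupT_measurable => [|q]; first exact: countableP.
by case: ifP => // _; apply: measurableX; exact: measurable_ball.
Qed.

Lemma open_continuous_measurable_fun2 (D : set (R * R)) (f : R * R -> R) :
  open D -> {in D, continuous f} -> measurable_fun D f.
Proof.
move=> oD cf; apply: (measurability _ (RGenOInfty.measurableE R)) => //.
move=> _ [_ [x ->] <-]; rewrite preimage_itvoy.
rewrite (_ : D `&` _ = D `&` f @^-1` [set y | x < y])//.
apply: open_measurable2; rewrite openE => p [Dp fp].
rewrite /interior; apply: filterI; first exact: open_nbhs_nbhs.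
have := cf p; rewrite inE => /(_ Dp); apply.
by apply: open_nbhs_nbhs; split=> //; exact: open_gt.
Qed.

Lemma continuous_measurable_fun2 (f : R * R -> R) :
  continuous f -> measurable_fun setT f.
Proof. by move=> cf; apply: open_continuous_measurable_fun2 => //; exact: openT. Qed.

End Toolbox.

(** * Smooth cut-off functions *)

Section FlatFun.
Variable R : realType.

Lemma near_ltr (a b : R) : a < b -> \forall x \near a, x < b.
Proof. by move=> ab; apply: open_nbhs_nbhs; split=> //; exact: open_lt. Qed.

Lemma near_gtr (a b : R) : b < a -> \forall x \near a, b < x.
Proof. by move=> ab; apply: open_nbhs_nbhs; split=> //; exact: open_gt. Qed.

(* The functions [P(1/t) e^(-1/t)], extended by [0], are stable under differentiation. *)
Definition flat (P : {poly R}) (t : R) : R :=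
  if 0 < t then P.[t^-1] * expR (- t^-1) else 0.

Lemma flat_le0 P t : t <= 0 -> flat P t = 0.
Proof. by rewrite /flat ltNge => ->. Qed.

(** Vanishing to second order at [0] is all that differentiability there requires. The Taylor bound
    [e^s >= s^(n+2) / (n+2)!] beats the polynomial, which is at most [A * s^n] because
    [s = 1/t >= 1]. *)
Lemma flat_bound (P : {poly R}) :
  exists2 K, 0 <= K & forall t, t <= 1 -> `|flat P t| <= K * t ^+ 2.
Proof.
pose n := size P; pose A : R := \sum_(i < n) `|P`_i|.
have A0 : 0 <= A by apply: sumr_ge0.
exists (A * n.+2`!%:R); first by rewrite mulr_ge0.
move=> t t1; rewrite /flat; case: ifPn => [t0|_]; last first.
  by rewrite normr0; apply: mulr_ge0; [apply: mulr_ge0|exact: sqr_ge0].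
set s := t^-1; have s1 : 1 <= s by rewrite /s invf_ge1.
have s0 : 0 < s by rewrite invr_gt0.
have HP : `|P.[s]| <= A * s ^+ n.
  rewrite horner_coef (le_trans (ler_norm_sum _ _ _))// mulr_suml ler_sum// => i _.
  rewrite normrM ler_wpM2l// normrX (ger0_norm (ltW s0)).
  by rewrite ler_weXn2l//; exact: ltnW (ltn_ord i).
have He : expR (- s) <= n.+2`!%:R * t ^+ n.+2.
  rewrite expRN -[leRHS]invrK lef_pV2 ?posrE ?expR_gt0//; last first.
    by rewrite invr_gt0 mulr_gt0// ?exprn_gt0// ltr0n fact_gt0.
  have /(le_trans _) := expR_ge1Dxn n.+1 (ltW s0); apply.
  rewrite invfM -exprVn -/s mulrC; lra.
rewrite normrM (ger0_norm (expR_ge0 _)).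
apply: (le_trans (ler_pM _ _ HP He)) => //; rewrite ?expR_ge0//.
rewrite -mulrA [leLHS](_ : _ = A * (n.+2`!%:R * (s ^+ n * t ^+ n.+2))); last by ring.
rewrite -addn2 exprD (mulrA (s ^+ n)) -exprMn mulVf ?gt_eqF// expr1n mul1r.
by rewrite mulrA.
Qed.

Lemma is_derive_recip (t : R) : t != 0 -> is_derive t 1 (@GRing.inv R) (- t ^- 2).
Proof.
move=> t0; have := @is_deriveV R id t 1 1 t0 (is_derive_id _ _).
by rewrite [_ *: _]mulr1.
Qed.

(** In the variable [s = 1/t] the operator [d/dt] is [- s^2 d/ds], which sends [P(s) e^(-s)] to
    [s^2 (P - P') e^(-s)]. At [0] the difference quotient is squeezed by [flat_bound]. *)
Lemma flat_is_derive (P : {poly R}) (t : R) :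
  is_derive t 1 (flat P) (flat ('X^2 * (P - P^`())) t).
Proof.
have [t0|t0|->] := ltgtP t 0.
- rewrite [X in is_derive _ _ _ X](_ : _ = 0); last by rewrite /flat ltNge ltW.
  apply: (@near_eq_is_derive _ _ _ (cst 0)).
    near=> x; rewrite /flat /= ltNge ltW//=.
    by near: x; exact: near_ltr.
- rewrite {2}/flat t0.
  pose F : R -> R := fun t => P.[t^-1] * expR (- t^-1).
  apply: (@near_eq_is_derive _ _ _ F).
    near=> x; rewrite /flat ifT//.
    by near: x; exact: near_gtr.
  have tn : t != 0 by rewrite gt_eqF.
  have dV := is_derive_recip tn.
  have dP : is_derive t 1 (horner P \o @GRing.inv R) (P^`().[t^-1] * (- t ^- 2)).
    exact: is_derive1_comp.
  have dE : is_derive t 1 (expR \o (fun x : R => - x^-1)) (expR (- t^-1) * (t ^- 2)).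
    apply: is_derive1_comp; rewrite -[t^-2]opprK; exact: is_deriveN.
  have := is_deriveM dP dE.
  rewrite [X in is_derive _ _ X _](_ : _ = F)//.
  move=> H; apply: (is_derive_eq H).
  rewrite hornerM hornerXn hornerD hornerN exprVn.
  change (P.[t^-1] * (expR (- t^-1) / t ^+ 2) +
    expR (- t^-1) * (P^`().[t^-1] * - t ^- 2) =
    t ^- 2 * (P.[t^-1] - P^`().[t^-1]) * expR (- t^-1)).
  ring.
- rewrite {2}/flat ltxx.
  have [K K0 HK] := flat_bound P.
  have cv : (fun h : R => h^-1 *: (flat P (h *: 1 + 0) - flat P 0)) @ 0^' --> (0 : R).
    have Hn : \forall h \near (0 : R)^', - (K * `|h|) <= h^-1 *: (flat P (h *: 1 + 0) - flat P 0) <= K * `|h|.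
      near=> h; rewrite -ler_norml addr0 [h *: 1]mulr1 (flat_le0 P (lexx 0)) subr0 normrM.
      have h0 : h != 0 by near: h; exact: nbhs_dnbhs_neq.
      have h1 : h <= 1.
        by apply: ltW; near: h; apply: nbhs_dnbhs; exact: near_ltr.
      rewrite normrV ?unitfE// ler_pdivrMl ?normr_gt0//.
      apply: le_trans (HK _ h1) _; rewrite -[h ^+ 2]real_normK ?num_real// expr2.
      by rewrite mulrCA.
    have c0 : (fun h : R => K * `|h|) @ 0^' --> (0 : R).
      suff : (fun h : R => K * `|h|) @ 0^' --> K * `|(0 : R)| by rewrite normr0 mulr0.
      by apply: cvgMr; apply: cvg_norm; exact: cvg_within.
    apply: (squeeze_cvgr Hn) => //.
    suff : (fun h : R => - (K * `|h|)) @ 0^' --> - (0 : R) by rewrite oppr0.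
    exact: cvgN.
  apply: DeriveDef; first by apply/cvg_ex; exists 0.
  by apply/cvg_lim => //.
Unshelve. all: by end_near. Qed.

Lemma flat1_gt0 t : 0 < t -> 0 < flat 1 t.
Proof. by move=> t0; rewrite /flat t0 hornerC mul1r expR_gt0. Qed.

Lemma flat1_ge0 t : 0 <= flat 1 t.
Proof. by rewrite /flat; case: ifP => // _; rewrite hornerC mul1r expR_ge0. Qed.

(** [test_fun_UHP] asks for all iterated directional derivatives at once. A syntactic class closed
    under differentiation settles this by induction; [flat] is a generator for every polynomial
    because differentiation changes the polynomial. *)
Inductive smooth2 : (R * R -> R) -> Prop :=
| smooth2_cst c : smooth2 (fun=> c)
| smooth2_fst : smooth2 fst
| smooth2_snd : smooth2 snd
| smooth2_flat P f : smooth2 f -> smooth2 (fun p => flat P (f p))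
| smooth2_add f g : smooth2 f -> smooth2 g -> smooth2 (fun p => f p + g p)
| smooth2_mul f g : smooth2 f -> smooth2 g -> smooth2 (fun p => f p * g p)
| smooth2_inv f : smooth2 f -> (forall p, f p != 0) -> smooth2 (fun p => (f p)^-1).

Lemma differentiable_fst (p : R * R) : differentiable (fst : R * R -> R) p.
Proof. by apply: linear_differentiable => q; exact: cvg_fst. Qed.

Lemma differentiable_snd (p : R * R) : differentiable (snd : R * R -> R) p.
Proof. by apply: linear_differentiable => q; exact: cvg_snd. Qed.

Lemma is_derive_fst (p v : R * R) : is_derive p v (fst : R * R -> R) v.1.
Proof.
apply: DeriveDef; first exact/diff_derivable/differentiable_fst.
rewrite deriveE; last exact/differentiable_fst.
by rewrite diff_lin//= => q; exact: cvg_fst.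
Qed.

Lemma is_derive_snd (p v : R * R) : is_derive p v (snd : R * R -> R) v.2.
Proof.
apply: DeriveDef; first exact/diff_derivable/differentiable_snd.
rewrite deriveE; last exact/differentiable_snd.
by rewrite diff_lin//= => q; exact: cvg_snd.
Qed.

Lemma smooth2_differentiable f : smooth2 f -> forall p, differentiable f p.
Proof.
elim => {f} [c|||P f sf IH|f g sf IHf sg IHg|f g sf IHf sg IHg|f sf IH f0] p.
- exact: differentiable_cst.
- exact: differentiable_fst.
- exact: differentiable_snd.
- apply: (@differentiable_comp _ _ _ _ f (flat P)); first exact: IH.
  by apply/derivable1_diffP; have [] := flat_is_derive P (f p).
- exact: differentiableD.
- exact: differentiableM.
- exact: differentiableV.
Qed.

Lemma smooth2_derive f : smooth2 f ->
  forall v, exists2 g, smooth2 g & forall p, is_derive p v f (g p).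
Proof.
elim => {f} [c|||P f sf IH|f g sf IHf sg IHg|f g sf IHf sg IHg|f sf IH f0] v.
- by exists (fun=> 0); [exact: smooth2_cst|move=> p; exact: is_derive_cst].
- by exists (fun=> v.1); [exact: smooth2_cst|move=> p; exact: is_derive_fst].
- by exists (fun=> v.2); [exact: smooth2_cst|move=> p; exact: is_derive_snd].
- have [g sg Hg] := IH v.
  exists (fun p => g p * flat ('X^2 * (P - P^`())) (f p)).
    by apply: smooth2_mul => //; exact: smooth2_flat.
  move=> p; have dfl : differentiable (flat P) (f p).
    by apply/derivable1_diffP; have [] := flat_is_derive P (f p).
  have df := smooth2_differentiable sf p.
  apply: DeriveDef.
    apply/diff_derivable; exact: (@differentiable_comp _ _ _ _ f (flat P)).
  rewrite deriveE; last exact: (@differentiable_comp _ _ _ _ f (flat P)).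
  rewrite (@diff_comp _ _ _ _ f (flat P))//=.
  have -> : 'd f p v = g p by rewrite -deriveE//; have [_ ->] := Hg p.
  have [dd Ed] := flat_is_derive P (f p).
  by rewrite deriv1E// derive1E Ed.
- have [f' sf' Hf] := IHf v; have [g' sg' Hg] := IHg v.
  exists (fun p => f' p + g' p); first exact: smooth2_add.
  by move=> p; exact: is_deriveD.
- have [f' sf' Hf] := IHf v; have [g' sg' Hg] := IHg v.
  exists (fun p => f p * g' p + g p * f' p).
    by apply: smooth2_add; exact: smooth2_mul.
  by move=> p; exact: is_deriveM.
- have [f' sf' Hf] := IH v.
  exists (fun p => (-1) * ((f p)^-1 * (f p)^-1) * f' p).
    by do !apply: smooth2_mul => //; exact: smooth2_cst || exact: smooth2_inv.
  move=> p; have [df Ef] := Hf p; apply: DeriveDef; first exact: derivableV.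
  rewrite deriveV// Ef.
  change (- (f p ^- 2) * f' p = -1 * ((f p)^-1 / f p) * f' p).
  by rewrite expr2 invfM; ring.
Qed.

Lemma smooth2_iter f l : smooth2 f -> smooth2 (iter_deriv l f).
Proof.
move=> sf; elim: l => //= v l IH.
have [g sg Hg] := smooth2_derive IH v.
rewrite (_ : (fun p => _) = g)//; apply/funext => p.
by have [_ ->] := Hg p.
Qed.

Lemma smooth2_test f (a b c d : R) : smooth2 f -> 0 < c ->
  (forall p, ~ (a <= p.1 <= b /\ c <= p.2 <= d) -> f p = 0) ->
  test_fun_UHP f.
Proof.
move=> sf c0 H; split=> [l p|].
  exact/differentiable_continuous/smooth2_differentiable/smooth2_iter.
split=> [l v p|]; last by exists a, b, c, d.
exact/diff_derivable/smooth2_differentiable/smooth2_iter.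
Qed.

(** The classical smooth transition from [0] (for [t <= 0]) to [1] (for [t >= 1]); the denominator
    never vanishes because one of [t], [1 - t] is positive. *)
Definition sstep (t : R) := flat 1 t / (flat 1 t + flat 1 (1 - t)).

Lemma sstep_den t : 0 < flat 1 t + flat 1 (1 - t).
Proof.
have [t0|t0] := leP t 0.
  by rewrite ltr_wpDl ?flat1_ge0// flat1_gt0//; lra.
by rewrite ltr_wpDr ?flat1_ge0// flat1_gt0.
Qed.

Lemma smooth2_sstep f : smooth2 f -> smooth2 (fun p => sstep (f p)).
Proof.
move=> sf; apply: smooth2_mul; first exact: smooth2_flat.
apply: smooth2_inv; last by move=> p; rewrite gt_eqF ?sstep_den.
apply: smooth2_add; apply: smooth2_flat => //.
rewrite (_ : (fun p => _) = (fun p => 1 + (-1) * f p)); last first.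
  by apply/funext => p; rewrite mulN1r.
by apply: smooth2_add; [exact: smooth2_cst|apply: smooth2_mul => //; exact: smooth2_cst].
Qed.

Lemma sstep0 t : t <= 0 -> sstep t = 0.
Proof. by move=> t0; rewrite /sstep flat_le0// mul0r. Qed.

Lemma sstep1 t : 1 <= t -> sstep t = 1.
Proof.
move=> t1; rewrite /sstep (@flat_le0 _ (1 - t)) ?addr0; last lra.
by rewrite divff// gt_eqF// flat1_gt0//; lra.
Qed.

Lemma sstep_ge0 t : 0 <= sstep t.
Proof. by rewrite /sstep divr_ge0 ?flat1_ge0// ltW// sstep_den. Qed.

Lemma sstep_le1 t : sstep t <= 1.
Proof. by rewrite /sstep ler_pdivrMr ?sstep_den// mul1r lerDl flat1_ge0. Qed.

Definition sstep' (t : R) : R := 'D_(1 : R) sstep t.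

Lemma sstep_is_derive (t : R) : is_derive t 1 sstep (sstep' t).
Proof.
apply: derivableP; apply: derivableM.
  by have [] := flat_is_derive 1 t.
apply: derivableV; first by rewrite gt_eqF ?sstep_den.
apply: derivableD; first by have [] := flat_is_derive 1 t.
have d1 : is_derive t 1 (fun t : R => 1 - t) (0 - 1) by exact: is_deriveB.
by have [] := @is_derive1_comp _ (flat 1) (fun t => 1 - t) t _ _ (flat_is_derive 1 (1 - t)) d1.
Qed.

(** [sstep'] is the restriction to a horizontal line of a directional derivative of a [smooth2]
    function of the plane, so continuity is inherited from there. *)
Lemma sstep'_continuous : continuous sstep'.
Proof.
have H := smooth2_iter [:: (1, 0)] (smooth2_sstep smooth2_fst).
have E t : sstep' t = iter_deriv [:: (1, 0)] (fun p : R * R => sstep p.1) (t, 0).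
  rewrite /= /sstep' /derive /=.
  by congr (lim (_ @ _)); apply/funext => h; rewrite /= !mulr1.
move=> t; rewrite (_ : sstep' = (iter_deriv [:: (1, 0)] (fun p : R * R => sstep p.1)) \o (fun t => (t, 0))); last first.
  by apply/funext => x; rewrite E.
apply: continuous_comp; last exact/differentiable_continuous/smooth2_differentiable.
exact: (cvg_pair cvg_id (cvg_cst 0)).
Qed.

Lemma sstep'_eq0 t : (t < 0) || (1 < t) -> sstep' t = 0.
Proof.
move=> H; suff : is_derive t 1 sstep 0 by move=> [].
have [c Hc] : exists c, \forall x \near t, cst c x = sstep x.
  case/orP: H => H.
    exists 0; near=> x; rewrite /= sstep0//; apply: ltW; near: x; exact: near_ltr.
  exists 1; near=> x; rewrite /= sstep1//; apply: ltW; near: x; exact: near_gtr.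
by apply: near_eq_is_derive Hc _; exact: is_derive_cst.
Unshelve. all: by end_near. Qed.

Lemma sstep'_bounded : exists2 K, 0 <= K & forall t, `|sstep' t| <= K.
Proof.
have cs : {within `[0, 1], continuous (fun t => `|sstep' t|)}.
  apply: continuous_subspaceT => t; apply: continuous_comp; first exact: sstep'_continuous.
  exact: norm_continuous.
have [c _ Hc] := EVT_max ler01 cs.
exists `|sstep' c|; [exact: normr_ge0|move=> t].
have [t01|] := boolP (t \in `[0, 1]); first exact: Hc.
rewrite in_itv /= negb_and -!ltNge => H.
by rewrite sstep'_eq0// normr0.
Qed.

End FlatFun.

(** * Variation of absolutely continuous functions *)

Section Chains.
Variable R : realType.
Implicit Types (f : R -> R) (L M : seq (R * R)).
Notation TV := total_variation.

(** Lists take the place of the indexed families of [abs_cont_on]: refining each member of a family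
    then is plain concatenation. *)
Fixpoint chain (x : R) L (y : R) : Prop :=
  if L is p :: L' then [/\ x <= p.1, p.1 <= p.2 & chain p.2 L' y] else x <= y.

Definition clen L : R := \sum_(p <- L) (p.2 - p.1).
Definition cvar f L : R := \sum_(p <- L) `|f p.2 - f p.1|.

Lemma chain_le x L y : chain x L y -> x <= y.
Proof.
elim: L x => //= p L IH x [xp pp /IH py].
exact: le_trans xp (le_trans pp py).
Qed.

Lemma chain_lel x x' L y : x' <= x -> chain x L y -> chain x' L y.
Proof.
case: L => [|p L] /= xx; first exact: le_trans.
by move=> [xp pp cL]; split=> //; exact: le_trans xp.
Qed.

Lemma chain_cat x L y M z : chain x L y -> chain y M z -> chain x (L ++ M) z.
Proof.
elim: L x => /= [|p L IH] x; first exact: chain_lel.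
by move=> [xp pp cL] cM; split=> //; exact: IH.
Qed.

Lemma chain_nth x L y z : chain x L y -> forall i, (i < size L)%N ->
  [/\ x <= (nth z L i).1, (nth z L i).1 <= (nth z L i).2,
      (nth z L i).2 <= y &
      (i.+1 < size L)%N -> (nth z L i).2 <= (nth z L i.+1).1].
Proof.
elim: L x => //= p L IH x [xp pp cL] [_|i]/=.
  split=> //; first exact: chain_le cL.
  by rewrite ltnS => s0; have [] := IH _ cL _ s0.
rewrite ltnS => iL; have [h1 h2 h3 h4] := IH _ cL _ iL; split=> //.
exact: le_trans xp (le_trans pp h1).
Qed.

Lemma chain_iota (X c d : nat -> R) n :
  (forall k, (k < n)%N -> [/\ X k <= c k, c k <= d k & d k <= X k.+1]) ->
  chain (X 0) [seq (c k, d k) | k <- iota 0 n] (X n).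
Proof.
elim: n => [|n IH] H; first exact: lexx.
rewrite -addn1 iotaD map_cat add0n addn1.
apply: (@chain_cat _ _ (X n)); first by apply: IH => k kn; apply: H; rewrite ltnS ltnW.
by have [] := H n (ltnSn n).
Qed.

Lemma partition_chain f x y s : itv_partition x y s ->
  exists L, [/\ chain x L y, clen L = y - x & cvar f L = variation x y f s].
Proof.
move=> ps; rewrite variation_zip//.
exists [seq (p.2, p.1) | p <- zip s (x :: s)].
rewrite /clen /cvar !big_map/=; split=> //.
  elim: s x ps => [x /itv_partition_nil ->|h t IH x] /=; first exact: lexx.
  move=> ps.
  split=> //; last exact/IH/itv_partition_cons/ps.
  by case: ps => /= /andP[/ltW].
elim: s x ps => [x /itv_partition_nil ->|h t IH x] /=; first by rewrite big_nil subrr.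
by move=> ps; rewrite big_cons/= (IH _ (itv_partition_cons ps)); lra.
Qed.

Lemma tv_chain f x y r : (r%:E < TV x y f)%E ->
  exists L, [/\ chain x L y, clen L = y - x & r < cvar f L].
Proof.
move=> /ereal_sup_gt[_ [_ [s ps <-] <-]]; rewrite lte_fin => rs.
have [L [cL lL vL]] := partition_chain f ps.
by exists L; rewrite vL.
Qed.

(** Distributes a strict lower bound over two possibly infinite variations, so that each can be
    approached by a partition of its own interval. *)
Lemma lte_adde_split (r : R) (A B : \bar R) : (0 <= A)%E -> (0 <= B)%E ->
  (r%:E < A + B)%E -> exists r1 r2, [/\ (r1%:E < A)%E, (r2%:E < B)%E & r = r1 + r2].
Proof.
case: A => [a| |] //; case: B => [b| |] //; rewrite ?lee_fin.
- move=> a0 b0; rewrite -EFinD lte_fin => rab.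
  exists (r - b + (a + b - r) / 2), (b - (a + b - r) / 2).
  by rewrite !lte_fin; split; lra.
- move=> a0 _ _; exists (a - 1), (r - a + 1); rewrite lte_fin ltry; split=> //; lra.
- move=> _ b0 _; exists (r - b + 1), (b - 1); rewrite lte_fin ltry; split=> //; lra.
- by move=> _ _ _; exists 0, r; rewrite !ltry add0r.
Qed.

Lemma tvs_ge0 f x M y : chain x M y -> (0 <= \sum_(p <- M) TV p.1 p.2 f)%E.
Proof.
elim: M x => [|q M IH z]; first by rewrite big_nil.
by move=> [zq qq cM]; rewrite big_cons adde_ge0 ?total_variation_ge0//; exact: IH cM.
Qed.

Lemma tvs_chain f x M y r : chain x M y ->
  (r%:E < \sum_(p <- M) TV p.1 p.2 f)%E ->
  exists L, [/\ chain x L y, clen L = clen M & r < cvar f L].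
Proof.
elim: M x r => [x r xy|p M IH x r [xp pp cM]].
  by rewrite big_nil lte_fin => r0; exists [::]; rewrite /clen /cvar !big_nil.
rewrite big_cons => /lte_adde_split[||r1 [r2 [h1 h2 ->]]].
- exact: total_variation_ge0.
- exact: tvs_ge0 cM.
have [L1 [cL1 lL1 vL1]] := tv_chain h1.
have [L2 [cL2 lL2 vL2]] := IH _ _ cM h2.
exists (L1 ++ L2); split; first exact: chain_lel xp (chain_cat cL1 cL2).
  by rewrite /clen big_cat/= big_cons; congr (_ + _); [exact: lL1|exact: lL2].
by rewrite /cvar big_cat/= ltrD.
Qed.

(* Absolute continuity in terms of chains: finite lists of non-overlapping intervals in [a, b]. *)
Definition acl f a b := forall e, 0 < e -> exists2 d, 0 < d &
  forall L, chain a L b -> clen L < d -> cvar f L < e.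

Lemma abs_cont_acl f a b : abs_cont_on f a b -> acl f a b.
Proof.
move=> ac e e0; have [d d0 H] := ac e e0; exists d => // L cL lL.
pose z : R * R := (0, 0).
have -> : cvar f L = \sum_(i < size L) `|f (nth z L i).2 - f (nth z L i).1|.
  by rewrite /cvar (big_nth z) big_mkord.
apply: (H _ (fun i => (nth z L i).1) (fun i => (nth z L i).2)).
- by move=> i iL; have [] := chain_nth z cL iL.
- by move=> i iL; have [_ _ _] := chain_nth z cL (ltnW iL); exact.
- by move: lL; rewrite /clen (big_nth z) big_mkord.
Qed.

(** Inserting partition points inside the intervals leaves the total length unchanged, so smallness
    of the increments over all chains already bounds the sum of the variations. *)
Lemma acl_tv f a b : acl f a b -> forall e, 0 < e -> exists2 d, 0 < d &
  forall L, chain a L b -> clen L < d -> (\sum_(p <- L) TV p.1 p.2 f <= e%:E)%E.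
Proof.
move=> ac e e0; have [d d0 H] := ac e e0; exists d => // M cM lM.
rewrite leNgt; apply/negP => /(tvs_chain cM)[L [cL lL vL]].
by have := H _ cL; rewrite lL => /(_ lM); rewrite ltNge ltW.
Qed.

(** Finitely many steps of length at most [d / 2] cover [[a, x]], and each of them has variation at
    most [1]. *)
Lemma acl_tv_fin f a b : acl f a b -> forall x, a <= x <= b -> TV a x f \is a fin_num.
Proof.
move=> ac; have [d d0 H] := acl_tv ac ltr01.
have H2 n x : a <= x <= b -> x - a <= n%:R * (d / 2) -> (TV a x f <= n%:R%:E)%E.
  elim: n x => [|n IH] x /andP[ax xb].
    rewrite mul0r => xa; have -> : x = a by lra.
    by rewrite total_variationxx.
  move=> xn; pose y := Num.max a (x - d / 2).
  have ay : a <= y by rewrite /y le_max lexx.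
  have yx : y <= x by rewrite /y ge_max ax/=; lra.
  rewrite (total_variationD f ay yx) -natr1 EFinD leeD//.
    apply: IH; first by rewrite ay (le_trans yx).
    rewrite lerBlDr /y ge_max lerDr mulr_ge0//=; last by lra.
    by move: xn; rewrite -natr1; lra.
  have := H [:: (y, x)]; rewrite /clen !big_seq1/=; apply; first by [].
  have : x - d / 2 <= y by rewrite /y le_max lexx orbT.
  lra.
move=> x /andP[ax xb].
rewrite ge0_fin_numE ?total_variation_ge0//.
have [n Hn] : exists n : nat, x - a <= n%:R * (d / 2).
  exists (Num.bound ((x - a) / (d / 2))).
  rewrite -ler_pdivrMr ?divr_gt0// ltW//.
  by apply: archi_boundP; rewrite divr_ge0 ?subr_ge0// divr_ge0// ltW.
by apply: le_lt_trans (H2 n x _ Hn) _; rewrite ?ax ?ltry.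
Qed.

Lemma cvar_le f g L : (forall p, p \in L -> `|f p.2 - f p.1| <= g p.2 - g p.1) ->
  cvar f L <= \sum_(p <- L) (g p.2 - g p.1).
Proof. by move=> H; rewrite /cvar big_seq [leRHS]big_seq; exact: ler_sum. Qed.

Lemma chain_in x L y : chain x L y -> forall p, p \in L -> [/\ x <= p.1, p.1 <= p.2 & p.2 <= y].
Proof.
elim: L x => //= q L IH x [xq qq cL] p; rewrite inE => /predU1P[->|pL].
  by split=> //; exact: chain_le cL.
by have [h1 h2 h3] := IH _ cL _ pL; split=> //; exact: le_trans xq (le_trans qq h1).
Qed.

(** Retraction onto [[a, b]]. Composing with it turns a monotone function on [[a, b]] into one on
    the whole line, as a Stieltjes measure requires. *)
Definition clamp (a b x : R) := Num.min b (Num.max a x).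

Lemma clampE a b x : a <= x <= b -> clamp a b x = x.
Proof. by move=> /andP[ax xb]; rewrite /clamp (max_idPr ax) (min_idPr xb). Qed.

Lemma clamp_in a b x : a <= b -> a <= clamp a b x <= b.
Proof. by move=> ab; rewrite /clamp le_min ab le_max lexx/= ge_min lexx. Qed.

Lemma clamp_homo a b : {homo clamp a b : x y / x <= y}.
Proof. by move=> x y xy; rewrite /clamp; apply: le_min2 => //; exact: le_max2. Qed.

Lemma clamp_lip a b x y : a <= b -> x <= y -> clamp a b y - clamp a b x <= y - x.
Proof.
by move=> ab xy; rewrite /clamp /Num.min /Num.max; repeat case: ifPn; rewrite -?leNgt => *; lra.
Qed.

Lemma mono_acl_continuous f a b : a <= b -> {homo f : x y / x <= y} ->
  acl f a b -> (forall x, f x = f (clamp a b x)) -> continuous f.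
Proof.
move=> ab fh ac fc x; apply/cvgrPdist_lt => e e0.
have [d d0 H] := ac e e0.
have H2 y z : y <= z -> z - y < d -> f z - f y < e.
  move=> yz zyd; have /andP[ay yb] := clamp_in y ab; have /andP[az zb] := clamp_in z ab.
  have := H [:: (clamp a b y, clamp a b z)].
  rewrite /clen /cvar !big_seq1/= -!fc => H'.
  apply: le_lt_trans (ler_norm _) _; apply: H'.
    by split=> //; exact: clamp_homo.
  by apply: le_lt_trans zyd; exact: clamp_lip.
near=> y; have [xy|yx] := leP x y.
  rewrite ler0_norm ?opprB ?subr_le0 ?fh//; apply: H2 => //.
  suff : `|x - y| < d by rewrite ler0_norm ?opprB ?subr_le0.
  by near: y; exact: cvgr_dist_lt.
rewrite ger0_norm ?subr_ge0 ?fh ?ltW//; apply: H2; rewrite ?ltW//.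
suff : `|x - y| < d by rewrite ger0_norm ?subr_ge0 ?ltW.
by near: y; exact: cvgr_dist_lt.
Unshelve. all: by end_near. Qed.

(** Jordan decomposition: [G] is the variation function and [H] is [G - f] on [[a, b]]. Both are
    absolutely continuous because their increments are at most one and two times those of the
    variation. *)
Lemma acl_decomp f a b : a <= b -> acl f a b ->
  exists G H : R -> R,
  [/\ {homo G : x y / x <= y} /\ acl G a b,
      {homo H : x y / x <= y} /\ acl H a b,
      (forall x, G x = G (clamp a b x)) /\ (forall x, H x = H (clamp a b x)) &
      forall x, a <= x <= b -> f x = G x - H x].
Proof.
move=> ab ac; have fin := acl_tv_fin ac.
pose T x := fine (TV a (clamp a b x) f).
have Tsub x y : x <= y ->
    (T y - T x)%:E = TV (clamp a b x) (clamp a b y) f.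
  move=> xy; have /andP[ax xb] := clamp_in x ab; have /andP[ay yb] := clamp_in y ab.
  have fx := fin _ (clamp_in x ab); have fy := fin _ (clamp_in y ab).
  rewrite /T EFinB !fineK// (@total_variationD _ a (clamp a b y) (clamp a b x))//; last exact: clamp_homo.
  by rewrite addeAC subee// add0e.
have Tf x y : x <= y -> `|f (clamp a b y) - f (clamp a b x)| <= T y - T x.
  by move=> xy; rewrite -lee_fin Tsub//; exact/total_variation_ge/clamp_homo.
have Tch L : chain a L b -> (\sum_(p <- L) (T p.2 - T p.1))%:E = (\sum_(p <- L) TV p.1 p.2 f)%E.
  move=> cL; rewrite -sumEFin big_seq [RHS]big_seq; apply: eq_bigr => p pL.
  have [h1 h2 h3] := chain_in cL pL.
  by rewrite Tsub// !clampE// ?h1 ?h3 ?(le_trans h1) ?(le_trans h2).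
have Tac e : 0 < e -> exists2 d, 0 < d &
    forall L, chain a L b -> clen L < d -> \sum_(p <- L) (T p.2 - T p.1) < e.
  move=> e0; have e2 : 0 < e / 2 by rewrite divr_gt0.
  have [d d0 H] := acl_tv ac e2; exists d => // L cL lL.
  have := H _ cL lL; rewrite -Tch// lee_fin => /le_lt_trans; apply; lra.
have cc x : clamp a b (clamp a b x) = clamp a b x by apply: clampE; exact: clamp_in.
exists T, (fun x => T x - f (clamp a b x)); split.
- split=> [x y xy|e e0]; first by have := Tf x y xy; move/(le_trans (normr_ge0 _)); lra.
  have [d d0 H] := Tac e e0; exists d => // L cL lL.
  apply: le_lt_trans (H L cL lL); apply: cvar_le => p pL.
  have [h1 h2 h3] := chain_in cL pL.
  by rewrite ger0_norm//; apply: le_trans (Tf _ _ h2).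
- split=> [x y xy|e e0]; first by have := Tf x y xy; rewrite ler_norml => /andP[]; lra.
  have e2 : 0 < e / 2 by rewrite divr_gt0.
  have [d d0 H] := Tac _ e2; exists d => // L cL lL.
  apply: (@le_lt_trans _ _ (\sum_(p <- L) (2 * T p.2 - 2 * T p.1))).
    apply: (@cvar_le _ (fun x => 2 * T x)) => p pL.
    have [h1 h2 h3] := chain_in cL pL; have := Tf _ _ h2.
    rewrite !ler_norml => /andP[]; lra.
  rewrite (eq_bigr (fun p => 2 * (T p.2 - T p.1))); last by move=> p _; ring.
  rewrite -mulr_sumr; have := H L cL lL; lra.
- by split=> x; rewrite /T cc.
- by move=> x axb; rewrite clampE//; ring.
Qed.

End Chains.

(** * Absolutely continuous functions are primitives of their derivatives *)

Section MonotoneAC.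
Variable R : realType.
Notation mu := (@lebesgue_measure R).

Lemma lsm_itv (G : cumulative R R) (x y : R) : x <= y ->
  lebesgue_stieltjes_measure G `]x, y]%classic = (G y - G x)%:E.
Proof.
move=> xy; rewrite /lebesgue_stieltjes_measure /measure_extension measurable_mu_extE/=; last exact: is_ocitv.
by rewrite wlength_itv_bnd.
Qed.

Section unif.
Variables (a b : R) (ab : a < b) (U : set R) (oU : open U).

(* [uU n] is the union of the cells of the uniform partition of ]a, b] into [n.+1] cells that lie in [U]. *)
Definition upt n k : R := a + k%:R * ((b - a) / n.+1%:R).
Definition uitv n k : set R := `]upt n k, upt n k.+1]%classic.
Definition uin n k : bool := `[< uitv n k `<=` U >].
Definition uend n k : R := if uin n k then upt n k.+1 else upt n k.
Definition uset n k : set R := `]upt n k, uend n k]%classic.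

Lemma upt_le n k : upt n k <= upt n k.+1.
Proof.
rewrite /upt lerD2l ler_wpM2r ?divr_ge0 ?subr_ge0 ?(ltW ab)//.
by rewrite ler_nat.
Qed.

Lemma upt0 n : upt n 0 = a. Proof. by rewrite /upt mul0r addr0. Qed.
Lemma uptn n : upt n n.+1 = b.
Proof. by rewrite /upt mulrCA divff ?mulr1 ?pnatr_eq0//; ring. Qed.

Lemma upt_mono n k l : (k <= l)%N -> upt n k <= upt n l.
Proof.
move=> kl; rewrite /upt lerD2l ler_wpM2r ?divr_ge0 ?subr_ge0 ?(ltW ab)//.
by rewrite ler_nat.
Qed.

Lemma uend_ge n k : upt n k <= uend n k.
Proof. by rewrite /uend; case: ifP => // _; exact: upt_le. Qed.

Lemma uend_le n k : uend n k <= upt n k.+1.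
Proof. by rewrite /uend; case: ifP => // _; exact: upt_le. Qed.

Definition uL n := [seq (upt n k, uend n k) | k <- iota 0 n.+1].

Lemma uL_chain n : chain a (uL n) b.
Proof.
rewrite -[X in chain X](upt0 n) -[X in chain _ _ X](uptn n).
apply: chain_iota => k _; split; [exact: lexx|exact: uend_ge|exact: uend_le].
Qed.

Lemma uset_sub n k : uset n k `<=` U.
Proof.
rewrite /uset /uend; case: ifPn => [/asboolP//|_] x.
by rewrite /= in_itv/= => /andP[/lt_le_trans/[apply]]; rewrite ltxx.
Qed.

Definition uU n : set R := \big[setU/set0]_(k < n.+1) uset n k.

Lemma muset n k : measurable (uset n k). Proof. exact: measurable_itv. Qed.

Lemma uset_triv n : trivIset setT (uset n).
Proof.
apply: ltn_trivIset => k l lk; apply/seteqP; split=> // x [].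
rewrite /uset /= !in_itv/= => /andP[h1 h2] /andP[h3 h4].
have := le_trans h2 (le_trans (uend_le n l) (upt_mono n lk)).
by rewrite leNgt h3.
Qed.

Lemma measure_uU n : mu (uU n) = (clen (uL n))%:E.
Proof.
rewrite /uU measure_bigsetU//=; last 2 first.
- by move=> i; exact: muset.
- exact: uset_triv.
rewrite /clen /uL big_map -sumEFin /index_iota.
rewrite -[in RHS](subn0 n.+1) -/(index_iota 0 n.+1) big_mkord.
apply: eq_bigr => k _ /=.
rewrite /uset lebesgue_measure_itv/= lte_fin.
case: ifPn => //; rewrite -leNgt => h.
by have -> : uend n k = upt n k; [apply/le_anti; rewrite h uend_ge|rewrite subrr].
Qed.

Lemma uU_sub n : uU n `<=` U.
Proof. by rewrite /uU -bigcup_mkord => x [k _]; exact: uset_sub. Qed.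

(** The cells shrink to points, so a point of the open set eventually lies in a cell contained in
    it. Only eventual membership is available: the partitions for successive [n] are not nested. *)
Lemma uU_mono : U `&` `]a, b] `<=` \bigcup_m \bigcap_(n in [set n | (m <= n)%N]) uU n.
Proof.
move=> x [Ux]; rewrite /= in_itv/= => /andP[ax xb].
have [e /= e0 He] := (nbhs_ballP x U).1 (open_nbhs_nbhs (conj oU Ux)).
have [m Hm] : exists m : nat, (b - a) / m.+1%:R < e.
  exists (Num.bound ((b - a) / e)).
  rewrite ltr_pdivrMr// mulrC -ltr_pdivrMr//.
  apply: (@lt_trans _ _ (Num.bound ((b - a) / e))%:R); last by rewrite ltr_nat.
  by apply: archi_boundP; apply: divr_ge0; [rewrite subr_ge0|]; exact: ltW.
exists m => // n /= mn.
have Hn : (b - a) / n.+1%:R < e.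
  apply: le_lt_trans Hm; rewrite ler_wpM2l ?subr_ge0 ?(ltW ab)//.
  by rewrite lef_pV2 ?posrE// ler_nat.
have [k kn xk] : exists2 k, (k < n.+1)%N & upt n k < x <= upt n k.+1.
  have ex : exists k, x <= upt n k.+1 by exists n; rewrite uptn.
  case: (ex_minnP ex) => k xk kmin; exists k.
    by rewrite ltnS; apply: kmin; rewrite uptn.
  rewrite xk andbT; case: k xk kmin => [|k] xk kmin; first by rewrite upt0.
  by rewrite ltNge; apply/negP => /kmin; rewrite ltnn.
rewrite /uU -bigcup_mkord; exists k => //.
have kU : uin n k.
  apply/asboolP => y; rewrite /uitv /= in_itv/= => /andP[y1 y2].
  apply: He; rewrite /ball /=; case/andP: xk => x1 x2.
  apply: le_lt_trans Hn.
  have : upt n k.+1 - upt n k = (b - a) / n.+1%:R by rewrite /upt -natr1; ring.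
  move: (upt n k) (upt n k.+1) (_ / n.+1%:R) x1 x2 y1 y2 => r s q x1 x2 y1 y2 E.
  by rewrite ler_norml; apply/andP; split; lra.
by rewrite /uset /uend kU /= in_itv.
Qed.

End unif.

(** Outer regularity puts the null set in an open [U] of measure below [d]. The cells inside [U]
    form a chain of length below [d], so their Stieltjes measure is at most [e], and continuity from
    below transfers this to the part of [U] in []a, b]]. *)
Lemma mono_acl_dominates (G : cumulative R R) a b : a < b -> acl G a b ->
  forall A, measurable A -> mu A = 0%E ->
  lebesgue_stieltjes_measure G (A `&` `]a, b]) = 0%E.
Proof.
move=> ab ac A mA A0.
pose nu : {measure set (measurableTypeR R) -> \bar R} := lebesgue_stieltjes_measure G.
change (nu (A `&` `]a, b]) = 0%E).
apply/eqP; rewrite -measure_le0; apply/lee_addgt0Pr => e e0; rewrite add0e.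
have [d d0 H] := ac e e0.
have A0' : (mu A < +oo)%E by rewrite A0.
have [U [oU AU UA]] := lebesgue_regularity_outer mA A0' d0.
have mU : measurable U by exact: open_measurable.
have muU : (mu U < d%:E)%E.
  have -> : mu U = mu (U `\` A).
    rewrite -[in LHS](setDKU AU) measureU0//; exact: measurableD.
  exact: UA.
(* Tail intersections turn the non-monotone sequence [uU] into an increasing one. *)
pose V m := \bigcap_(n in [set n | (m <= n)%N]) uU a b U n.
have muU' n : measurable (uU a b U n).
  by apply: bigsetU_measurable => k _; exact: muset.
have mV m : measurable (V m) by apply: bigcap_measurable => //; exists m => /=.
have nuV n : (nu (uU a b U n) <= e%:E)%E.
  have -> : nu (uU a b U n) = (\sum_(p <- uL a b U n) (G p.2 - G p.1))%:E.
    rewrite /uU measure_bigsetU//=; last 2 first.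
    - by move=> i; exact: muset.
    - exact: uset_triv.
    rewrite /uL big_map -sumEFin -[in RHS](subn0 n.+1) -/(index_iota 0 n.+1) big_mkord.
    apply: eq_bigr => k _ /=; rewrite /uset lsm_itv//; exact: uend_ge.
  rewrite lee_fin ltW//; apply: le_lt_trans (H _ (uL_chain ab U n) _).
    by rewrite /cvar; apply: ler_sum => p _; exact: ler_norm.
  by rewrite -lte_fin -measure_uU//; apply: le_lt_trans muU; apply: le_measure;
    [rewrite inE; exact: muU'|by rewrite inE|exact: uU_sub].
apply: (@le_trans _ _ (nu (\bigcup_m V m))).
  apply: le_measure; rewrite ?inE.
  - by apply: measurableI => //; exact: measurable_itv.
  - exact: bigcupT_measurable.
  - by move=> x [Ax abx]; apply: (uU_mono ab oU); split=> //; exact: AU.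
have ndV : nondecreasing_seq V.
  move=> m n mn; rewrite subsetEset => x Vx k /= nk; apply: Vx; exact: leq_trans nk.
have cv := @nondecreasing_cvg_mu _ _ _ nu V mV (bigcupT_measurable V mV) ndV.
rewrite -(cvg_lim _ cv)//; apply: lime_le; first by apply/cvg_ex; eexists; exact: cv.
apply: nearW => m /=; apply: le_trans (nuV m); apply: le_measure.
- by rewrite inE; exact: mV.
- by rewrite inE; exact: muU'.
- by move=> x Vx; apply: Vx => /=.
Qed.

(** The density is the Radon-Nikodym derivative of the Stieltjes measure of [G] on []a, b]], which
    [mono_acl_dominates] makes absolutely continuous. *)
Lemma mono_acl_density (G : R -> R) a b : a < b -> {homo G : x y / x <= y} ->
  acl G a b -> (forall x, G x = G (clamp a b x)) ->
  exists2 rho : R -> R, mu.-integrable setT (EFin \o rho) &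
  forall x, a <= x <= b -> G x - G a = \int[mu]_(t in `]a, x]) rho t.
Proof.
move=> ab Gh ac Gc.
have cG : continuous G by exact: mono_acl_continuous (ltW ab) Gh ac Gc.
pose GM := isCumulative.Build R _ R G Gh (right_continuousW cG).
pose GG : cumulative R R := HB.pack G GM.
have mab : measurable (`]a, b]%classic : set (measurableTypeR R)) by exact: measurable_itv.
have fin : (lebesgue_stieltjes_measure GG `]a, b]%classic < +oo)%E.
  by rewrite lsm_itv ?ltW// ltry.
pose nu : {finite_measure set (measurableTypeR R) -> \bar R} := mfrestr mab fin.
have dom : nu `<< mu.
  apply/null_content_dominatesP => A mA A0.
  exact: (@mono_acl_dominates GG a b ab ac A mA A0).
have [rho [rho0 rhof rhoi rhoE]] := radon_nikodym_sigma_finite dom.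
exists (fine \o rho).
  by apply: eq_integrable rhoi => // x _ /=; rewrite fineK.
move=> x /andP[ax xb].
rewrite /Rintegral; under eq_integral do rewrite /= fineK//.
rewrite -rhoE /nu /= /mfrestr /mrestr; last exact: measurable_itv.
rewrite (_ : _ `&` _ = `]a, x]%classic); last first.
  apply/seteqP; split=> y /=; rewrite !in_itv/=; first by case=> /andP[-> ->].
  by move=> /andP[-> yx]; rewrite yx (le_trans yx).
by rewrite lsm_itv.
Qed.

Lemma acl_density (f : R -> R) a b : a < b -> acl f a b ->
  exists2 rho : R -> R, mu.-integrable setT (EFin \o rho) &
  forall x, a <= x <= b -> f x - f a = \int[mu]_(t in `]a, x]) rho t.
Proof.
move=> ab ac.
have [G [H [[Gh aG] [Hh aH] [Gc Hc] fGH]]] := acl_decomp (ltW ab) ac.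
have [r1 i1 E1] := mono_acl_density ab Gh aG Gc.
have [r2 i2 E2] := mono_acl_density ab Hh aH Hc.
exists (fun x => r1 x - r2 x).
  have := integrableB measurableT i1 i2.
  by apply: eq_integrable => // x _ /=.
move=> x axb; rewrite RintegralB//; last 2 first.
- by apply: integrableS i1 => //; exact: measurable_itv.
- by apply: integrableS i2 => //; exact: measurable_itv.
rewrite -E1// -E2// !fGH// ?lexx ?ltW//; ring.
Qed.

Lemma locally_integrable_itv (g : R -> R) a b : locally_integrable setT g ->
  mu.-integrable `[a, b] (EFin \o g).
Proof.
move=> [mg _ H]; apply/integrableP; split.
  by apply/measurable_EFinP; exact: measurable_funS mg.
by have := H `[a, b]%classic (@subsetT _ _) (@segment_compact _ a b).
Qed.

Lemma derive1_near_shift (F g : R -> R) (c x : R) : derivable F x 1 ->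
  (\forall y \near x, F y + c = g y) -> F^`()%classic x = g^`()%classic x.
Proof.
move=> dF H; rewrite !derive1E -[LHS]addr0 -(derive_cst c x 1) -deriveD//.
exact: near_eq_derive.
Qed.

(** The density of [f] comes from the Radon-Nikodym theorem; Lebesgue differentiation of its
    primitive identifies it almost everywhere with the everywhere defined derivative used in
    [H32]. *)
Theorem loc_abs_cont_FTC (f : R -> R) : loc_abs_cont f ->
  locally_integrable setT f^`()%classic ->
  forall a b, a <= b -> f b - f a = \int[mu]_(t in `[a, b]) f^`()%classic t.
Proof.
move=> lac li a b; rewrite le_eqVlt => /predU1P[<-|ab].
  by rewrite set_itv1 Rintegral_set1 subrr.
have [rho irho E] := acl_density ab (abs_cont_acl (lac a b (ltW ab))).
rewrite E ?lexx ?(ltW ab)//.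
have iS (A : set R) : measurable A -> mu.-integrable A (EFin \o rho).
  by move=> mA; apply: integrableS irho.
have mab : measurable (`]a, b[%classic : set (measurableTypeR R)) by exact: measurable_itv.
rewrite -(Rintegral_itv_bndo_bndc (iS _ mab)).
have key : ae_eq mu (`]a, b[%classic : set R) (EFin \o rho) (EFin \o f^`()%classic).
  have lr : locally_integrable setT rho by exact: open_integrable_locally openT irho.
  have := @FTC1 R rho (BRight a) (fun y => iS _ (measurable_itv _)) lr.
  apply: filterS; first exact: (ae_filter_ringOfSetsType mu).
  move=> x H; rewrite /= in_itv/= => /andP[ax xb].
  have [] := H ltac:(by rewrite lte_fin).
  set F := (fun y : R => _) => dF EF; rewrite -EF; congr (_%:E).
  apply: (derive1_near_shift (c := f a) dF); near=> y.
  have axb : a <= y <= b.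
    apply/andP; split; apply: ltW; near: y; [exact: near_gtr|exact: near_ltr].
  by rewrite /F -E// subrK.
have li' (A : set R) : measurable A -> A `<=` `[a, b] ->
    mu.-integrable A (EFin \o f^`()%classic).
  move=> mA sA; apply: integrableS (locally_integrable_itv a b li) => //.
rewrite -Rintegral_itv_obnd_cbnd; last by apply: li' => //; exact: subset_itv_oc_cc.
rewrite -Rintegral_itv_bndo_bndc; last by apply: li' => //; exact: subset_itv_oo_cc.
rewrite /Rintegral; congr fine; apply: ae_eq_integral => //.
- exact: measurable_int (iS _ mab).
- apply/measurable_EFinP; case: li => mf _ _; exact: measurable_funS mf.
Unshelve. all: by end_near. Qed.

End MonotoneAC.

(** * Integral bounds on the line *)

Section meas.
Context (R : realType) d (T : measurableType d) (D : set T).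
Implicit Types f g : T -> R.
Lemma mfD f g : measurable_fun D f -> measurable_fun D g -> measurable_fun D (fun x => f x + g x).
Proof. exact: measurable_funD. Qed.
Lemma mfB f g : measurable_fun D f -> measurable_fun D g -> measurable_fun D (fun x => f x - g x).
Proof. exact: measurable_funB. Qed.
Lemma mfM f g : measurable_fun D f -> measurable_fun D g -> measurable_fun D (fun x => f x * g x).
Proof. exact: measurable_funM. Qed.
Lemma mfN f : measurable_fun D f -> measurable_fun D (fun x => - f x).
Proof. exact: measurable_funN. Qed.
Lemma mfX f n : measurable_fun D f -> measurable_fun D (fun x => f x ^+ n).
Proof. exact: measurable_funX. Qed.
Lemma mfV f : measurable_fun D f -> measurable_fun D (fun x => (f x)^-1).
Proof. exact: measurable_funV. Qed.
Lemma mfabs f : measurable_fun D f -> measurable_fun D (fun x => `|f x|).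
Proof. by move=> mf; exact: measurableT_comp. Qed.
Lemma mfif (b : T -> bool) f g : measurable_fun setT b -> measurable_fun setT f -> measurable_fun setT g ->
  measurable_fun setT (fun x => if b x then f x else g x).
Proof. by move=> mb mf mg; exact: (measurable_fun_ifT mb mf mg). Qed.
Lemma mflt f g : measurable_fun D f -> measurable_fun D g -> measurable_fun D (fun x => f x < g x).
Proof. exact: measurable_fun_ltr. Qed.
End meas.

Ltac meas := lazymatch goal with
  | |- measurable_fun _ (fun x => @GRing.add _ (@?f x) (@GRing.opp _ (@?g x))) =>
      apply: (@mfB _ _ _ _ f g); meas
  | |- measurable_fun _ (fun x => @GRing.add _ (@?f x) (@?g x)) =>
      apply: (@mfD _ _ _ _ f g); meas
  | |- measurable_fun _ (fun x => @GRing.mul _ (@?f x) (@?g x)) =>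
      apply: (@mfM _ _ _ _ f g); meas
  | |- measurable_fun _ (fun x => @GRing.inv _ (@?f x)) => apply: (@mfV _ _ _ _ f); meas
  | |- measurable_fun _ (fun x => @GRing.opp _ (@?f x)) => apply: (@mfN _ _ _ _ f); meas
  | |- measurable_fun _ (fun x => @GRing.exp _ (@?f x) ?n) => apply: (@mfX _ _ _ _ f n); meas
  | |- measurable_fun _ (fun x => @Num.norm _ _ (@?f x)) => apply: (@mfabs _ _ _ _ f); meas
  | |- measurable_fun _ (fun x => Order.lt (@?f x) (@?g x)) => apply: (@mflt _ _ _ _ f g); meas
  | |- measurable_fun _ (fun x => eq_op (@?f x) (@?g x)) =>
      apply: (@measurable_fun_eqr _ _ _ _ f g); meas
  | |- measurable_fun _ (fun x => Num.sqrt (@?f x)) => apply: (@measurable_fun_sqrt _ _ _ _ f); meas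
  | |- measurable_fun _ fst => exact: measurable_fst
  | |- measurable_fun _ snd => exact: measurable_snd
  | |- measurable_fun _ (fun x => fst x) => exact: measurable_fst
  | |- measurable_fun _ (fun x => snd x) => exact: measurable_snd
  | |- measurable_fun _ (fun x => x) => exact: measurable_id
  | |- measurable_fun _ (fun x => fst (fst x)) =>
      exact: (measurableT_comp measurable_fst measurable_fst)
  | |- measurable_fun _ (fun x => snd (fst x)) =>
      exact: (measurableT_comp measurable_snd measurable_fst)
  | |- measurable_fun _ (fun x => fst (snd x)) =>
      exact: (measurableT_comp measurable_fst measurable_snd)
  | |- measurable_fun _ (fun x => snd (snd x)) =>
      exact: (measurableT_comp measurable_snd measurable_snd)
  | |- measurable_fun _ (fun x => fst (@?f x)) =>
      apply: (measurableT_comp measurable_fst (_ : measurable_fun _ f)); meas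
  | |- measurable_fun _ (fun x => snd (@?f x)) =>
      apply: (measurableT_comp measurable_snd (_ : measurable_fun _ f)); meas
  | |- _ => first [assumption | exact: measurable_cst | exact: measurable_id
      | apply: mfif; meas | apply: measurable_fun_sqrt; meas | idtac]
  end.

Section IntBound.
Variable R : realType.
Notation mu := (@lebesgue_measure R).

(** Improper integral by monotone convergence along compact intervals exhausting [D]; only the total
    oscillation of the antiderivative enters, so no limit at the ends of [D] has to be computed. *)
Lemma ge0_integral_antiderivative (D : set R) (a b : nat -> R) (f F : R -> R) (M : R) :
  open D -> D = \bigcup_n `[a n, b n]%classic ->
  (forall n, a n < b n) -> {homo a : m n / (m <= n)%N >-> n <= m} ->
  {homo b : m n / (m <= n)%N >-> m <= n} ->
  (forall x, D x -> 0 <= f x) -> (forall x, D x -> {for x, continuous f}) ->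
  (forall x, D x -> is_derive x 1 F (f x)) ->
  (forall x y, D x -> D y -> F y - F x <= M) ->
  (\int[mu]_(x in D) (f x)%:E <= M%:E)%E.
Proof.
move=> oD DE ab ha hb f0 cf dF FM.
have sD n : `[a n, b n]%classic `<=` D by rewrite DE => x xn; exists n.
have mD : measurable D by exact: open_measurable.
have mf : measurable_fun D (EFin \o f).
  apply/measurable_EFinP; apply: open_continuous_measurable_fun => // x.
  by rewrite inE => /cf.
have nd : nondecreasing_seq (fun n => `[a n, b n]%classic : set (measurableTypeR R)).
  move=> m n mn; rewrite subsetEset => x /=; rewrite !in_itv/= => /andP[h1 h2].
  by rewrite (le_trans (ha _ _ mn) h1) (le_trans h2 (hb _ _ mn)).
have cv := @ge0_nondecreasing_set_cvg_integral _ (measurableTypeR R) R (fun n => `[a n, b n]%classic) (EFin \o f) mu nd.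
have mI n : measurable (`[a n, b n]%classic : set (measurableTypeR R)) by exact: measurable_itv.
have mfI n : measurable_fun (`[a n, b n]%classic : set (measurableTypeR R)) (EFin \o f).
  by apply: measurable_funS mf => //.
have {}cv := cv mI mfI _.
have {}cv := cv ltac:(by move=> n x /sD/f0; rewrite lee_fin).
rewrite DE -(cvg_lim _ cv)//=.
apply: lime_le; first by apply/cvg_ex; eexists; exact: cv.
apply: nearW => n.
have an : D (a n) by apply: (sD n); rewrite /= in_itv/= lexx ltW.
have bn : D (b n) by apply: (sD n); rewrite /= in_itv/= lexx ltW.
have cF x : D x -> F @ x --> F x.
  move=> Dx; apply: differentiable_continuous; apply/derivable1_diffP.
  by have [] := dF x Dx.
rewrite /= (@continuous_FTC2 _ f F)//; first by rewrite -EFinB lee_fin FM.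
- apply: continuous_in_subspaceT => x; rewrite inE => /sD; exact: cf.
- split.
  + move=> x xab; have [] // := dF x _; apply: (sD n); exact: subset_itv_oo_cc.
  + exact/cvg_at_right_filter/cF.
  + exact/cvg_at_left_filter/cF.
- move=> x xab; have [|dd <-] := dF x _; last by rewrite derive1E.
  by apply: (sD n); exact: subset_itv_oo_cc.
Qed.

Lemma itvT_bigcup : [set: R] = \bigcup_n `[- n.+1%:R, n.+1%:R]%classic.
Proof.
apply/seteqP; split=> // x _; exists (Num.bound `|x|) => //.
rewrite /= in_itv/= -ler_norml; apply: le_trans (_ : (Num.bound `|x|)%:R <= _).
  by rewrite ltW// archi_boundP.
by rewrite ler_nat.
Qed.

Lemma poisson_le (t y : R) : 0 < y ->
  (\int[mu]_x (y / ((x - t) ^+ 2 + y ^+ 2))%:E <= pi%:E)%E.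
Proof.
move=> y0.
have den x : 0 < (x - t) ^+ 2 + y ^+ 2 by rewrite ltr_wpDl ?sqr_ge0 ?exprn_gt0.
pose F x := atan ((x - t) / y).
have lin (x : R) : is_derive x 1 (fun x : R => (x - t) / y) (1 / y).
  have d1 : is_derive x 1 (fun x : R => x - t) (1 - 0) by exact: is_deriveB.
  have := is_deriveM d1 (is_derive_cst (y^-1) x 1).
  by move=> H; apply: (is_derive_eq H); rewrite scaler0 add0r subr0 /GRing.scale /= mulr1 div1r.
apply: (@ge0_integral_antiderivative setT (fun n => - n.+1%:R) (fun n => n.+1%:R) _ F).
- exact: openT.
- exact: itvT_bigcup.
- by move=> n; rewrite gtrN.
- by move=> m n mn; rewrite lerN2 ler_nat.
- by move=> m n mn; rewrite ler_nat.
- by move=> x _; rewrite divr_ge0// ltW.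
- move=> x _; apply: cvgM; first exact: cvg_cst.
  apply: cvgV; first by rewrite gt_eqF.
  apply: cvgD; last exact: cvg_cst.
  apply: (@continuous_comp _ _ _ (fun z : R => z - t) (fun u => u ^+ 2)).
    by apply: cvgB; [exact: cvg_id|exact: cvg_cst].
  exact: exprn_continuous.
- move=> x _; have := @is_derive1_comp _ atan (fun x => (x - t) / y) x _ _ (is_derive1_atan _) (lin x).
  move=> H; apply: (is_derive_eq H); have yn : y != 0 by rewrite gt_eqF.
  have dx := den x; have dx' : 0 < y ^+ 2 + (x - t) ^+ 2 by rewrite addrC.
  by field; rewrite yn ?gt_eqF.
- move=> x z _ _; rewrite /F; have := atan_ltpi2 ((z - t) / y).
  have := atan_gtNpi2 ((x - t) / y); lra.
Qed.

Lemma is_derive_sqrt_atan (d x : R) : 0 < d -> 0 < x ->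
  is_derive x 1 (fun x : R => 2 / Num.sqrt d * atan (Num.sqrt x / Num.sqrt d))
   ((Num.sqrt x * (x + d))^-1).
Proof.
move=> d0 x0.
have sd : 0 < Num.sqrt d by rewrite sqrtr_gt0.
have sx : 0 < Num.sqrt x by rewrite sqrtr_gt0.
have d1 := is_derive1_sqrt x0.
have d2 := is_deriveM d1 (is_derive_cst ((Num.sqrt d)^-1) x 1).
have d3 := @is_derive1_comp _ atan (fun x : R => Num.sqrt x * (Num.sqrt d)^-1) x _ _ (is_derive1_atan _) d2.
have d4 := is_deriveM (is_derive_cst (2 / Num.sqrt d) x 1) d3.
apply: (is_derive_eq d4).
change (2 / Num.sqrt d * ((1 + (Num.sqrt x / Num.sqrt d) ^+ 2)^-1 *
  (Num.sqrt x * 0 + (Num.sqrt d)^-1 * (2 * Num.sqrt x)^-1)) +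
  atan (Num.sqrt x / Num.sqrt d) * 0 = (Num.sqrt x * (x + d))^-1).
have Exd : x + d = Num.sqrt x ^+ 2 + Num.sqrt d ^+ 2 by rewrite !sqr_sqrtr// ltW.
rewrite Exd; move: (Num.sqrt x) (Num.sqrt d) sd sx => S D D0 S0.
have SD : 0 < S ^+ 2 + D ^+ 2 by rewrite addr_gt0 ?exprn_gt0.
by field; rewrite ?gt_eqF//= ?addr_gt0// ?mulr_gt0// ?exprn_gt0.
Qed.

(** The substitution [x = d * r^2] explains the antiderivative; the value [pi / sqrt d] has the
    homogeneity [d^(-1/2)] on which the choice of weights in the Schur test rests. *)
Lemma schur_weight_le (d : R) : 0 < d ->
  (\int[mu]_(x in `]0%R, +oo[) ((Num.sqrt x * (x + d))^-1)%:E <= (pi / Num.sqrt d)%:E)%E.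
Proof.
move=> d0.
have sd : 0 < Num.sqrt d by rewrite sqrtr_gt0.
(* The exhausting intervals [[1/(n+2), n+1]] stay away from [0], where the integrand blows up. *)
apply: (@ge0_integral_antiderivative _ (fun n => n.+2%:R^-1) (fun n => n.+1%:R) _
  (fun x : R => 2 / Num.sqrt d * atan (Num.sqrt x / Num.sqrt d))).
- exact: interval_open.
- apply/seteqP; split=> [x|x [n _]] /=; rewrite !in_itv/= ?andbT; last first.
    by move=> /andP[xn _]; apply: lt_le_trans xn; rewrite invr_gt0.
  move=> x0; exists (maxn (Num.bound x^-1) (Num.bound x)) => //=.
  rewrite in_itv/=; apply/andP; split.
    rewrite -[leRHS]invrK lef_pV2 ?posrE ?invr_gt0//.
    apply: le_trans (ltW (archi_boundP _)) _; first by rewrite invr_ge0 ltW.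
    by rewrite ler_nat (leq_trans (leq_maxl _ (Num.bound x)))// -addn2 leq_addr.
  apply: le_trans (ltW (archi_boundP (ltW x0))) _.
  by rewrite ler_nat (leq_trans (leq_maxr (Num.bound x^-1) _))// leqnSn.
- move=> n; apply: (@lt_le_trans _ _ 1); last by rewrite ler1n.
  by rewrite invf_lt1// ltr1n.
- by move=> m n mn; rewrite lef_pV2 ?posrE// ler_nat !ltnS.
- by move=> m n mn; rewrite ler_nat ltnS.
- move=> x; rewrite /= in_itv/= andbT => x0.
  by rewrite invr_ge0 mulr_ge0 ?sqrtr_ge0// addr_ge0// ltW.
- move=> x; rewrite /= in_itv/= andbT => x0; apply: cvgV.
    by rewrite mulf_neq0 ?gt_eqF ?sqrtr_gt0// addr_gt0.
  by apply: cvgM; [exact: sqrt_continuous|apply: cvgD; [exact: cvg_id|exact: cvg_cst]].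
- by move=> x; rewrite /= in_itv/= andbT => x0; exact: is_derive_sqrt_atan.
- move=> x y _ _; rewrite -mulrBr mulrAC ler_pM2r ?invr_gt0// mulrC.
  have := atan_ltpi2 (Num.sqrt y / Num.sqrt d).
  have : 0 <= atan (Num.sqrt x / Num.sqrt d).
    by rewrite -atan0; apply: le_atan; rewrite divr_ge0 ?sqrtr_ge0.
  lra.
Qed.

Lemma lebesgue_measure_shift (t : R) (A : set R) : measurable A ->
  pushforward mu (fun x : R => (x + t : measurableTypeR R)) A = mu A.
Proof.
have ms : measurable_fun setT (fun x : measurableTypeR R => (x + t : measurableTypeR R)).
  by apply: (@mfD R _ (measurableTypeR R) setT id (cst t)).
move=> mA; apply/esym/lebesgue_measure_unique => //= _ [[a b]] _ <-.
rewrite /pushforward /= (_ : _ @^-1` _ = `]a - t, b - t]%classic); last first.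
  by apply/seteqP; split=> x /=; rewrite !in_itv/= ltrBlDr lerBrDr.
rewrite !lebesgue_measure_itv/= !lte_fin ltrD2r; case: ifP => // _.
by rewrite -!EFinB; congr (_%:E); ring.
Qed.

Lemma ge0_integral_shift (t : R) (f : R -> \bar R) : measurable_fun setT f ->
  (forall x, 0 <= f x)%E -> (\int[mu]_x f (x + t)%R = \int[mu]_x f x)%E.
Proof.
move=> mf f0.
have ms : measurable_fun setT (fun x : measurableTypeR R => (x + t : measurableTypeR R)).
  by apply: (@mfD R _ (measurableTypeR R) setT id (cst t)).
have := @ge0_integral_pushforward _ _ (measurableTypeR R) (measurableTypeR R) R _ ms mu setT f measurableT mf (fun x _ => f0 x).
rewrite preimage_setT => <-.
by apply: eq_measure_integral => A mA _; exact: lebesgue_measure_shift.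
Qed.

Lemma ge0_integral_opp (f : R -> \bar R) : measurable_fun setT f ->
  (forall x, 0 <= f x)%E -> (\int[mu]_x f (- x)%R = \int[mu]_x f x)%E.
Proof.
move=> mf f0.
have ms : measurable_fun setT (fun x : measurableTypeR R => (- x : measurableTypeR R)).
  by apply: (@mfN R _ (measurableTypeR R) setT id).
have := @ge0_integral_pushforward _ _ (measurableTypeR R) (measurableTypeR R) R _ ms mu setT f measurableT mf (fun x _ => f0 x).
rewrite preimage_setT => <-.
by apply: eq_measure_integral => A mA _; exact: lebesgue_measureN.
Qed.

(** The kernel [d^(-1/2) / (d + y)], set to [0] for [d <= 0] so that integrals over the whole line
    can be used. *)
Definition schurw (y d : R) : R := if 0 < d then (Num.sqrt d * (d + y))^-1 else 0.

Lemma schurw_ge0 y d : 0 <= y -> 0 <= schurw y d.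
Proof.
move=> y0; rewrite /schurw; case: ifPn => // d0.
by rewrite invr_ge0 mulr_ge0 ?sqrtr_ge0// addr_ge0// ltW.
Qed.

Lemma measurable_schurw d (T : measurableType d) (f g : T -> R) : measurable_fun setT f ->
  measurable_fun setT g -> measurable_fun setT (fun x => schurw (f x) (g x)).
Proof. by move=> mf mg; rewrite /schurw; meas. Qed.

Lemma integral_schurw y : 0 < y -> (\int[mu]_x (schurw y x)%:E <= (pi / Num.sqrt y)%:E)%E.
Proof.
move=> y0; apply: le_trans (schur_weight_le y0).
rewrite [leRHS]integral_mkcond; apply: ge0_le_integral => //.
- by move=> x _; rewrite lee_fin schurw_ge0// ltW.
- by apply/measurable_EFinP; apply: measurable_schurw.
- apply/(measurable_restrictT _ _).1; first exact: measurable_itv.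
  by apply/measurable_EFinP; apply: measurable_funTS; meas.
- move=> x _; rewrite /schurw patchE; case: ifPn => x0.
    by rewrite mem_set//= in_itv/= x0.
  by case: ifPn => // xx; rewrite lee_fin invr_ge0 mulr_ge0 ?sqrtr_ge0// addr_ge0//;
   move: xx; rewrite inE /= in_itv/= (negbTE x0).
Qed.

Lemma integral_schurw_dist y t : 0 < y ->
  (\int[mu]_s (schurw y `|s - t|)%:E <= (2 * pi / Num.sqrt y)%:E)%E.
Proof.
move=> y0.
have m1 : measurable_fun setT (fun x : R => (schurw y x)%:E).
  by apply/measurable_EFinP; apply: measurable_schurw.
have m2 : measurable_fun setT (fun x : R => (schurw y (- x))%:E).
  by apply/measurable_EFinP; apply: measurable_schurw; meas.
have m3 : measurable_fun setT (fun x : R => (schurw y `|x|)%:E).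
  by apply/measurable_EFinP; apply: measurable_schurw; meas.
have s0 x : (0 <= (schurw y x)%:E)%E by rewrite lee_fin schurw_ge0// ltW.
have -> : (\int[mu]_s (schurw y `|s - t|)%:E = \int[mu]_s (schurw y `|s|)%:E)%E.
  by rewrite -(@ge0_integral_shift (- t) (fun x : R => (schurw y `|x|)%:E)).
have -> : (2 * pi / Num.sqrt y)%:E = ((pi / Num.sqrt y)%:E + (pi / Num.sqrt y)%:E)%E.
  by rewrite -EFinD; congr (_%:E); ring.
apply: le_trans (leeD (integral_schurw y0) (integral_schurw y0)).
rewrite -[X in (_ <= _ + X)%E](@ge0_integral_opp (fun x => (schurw y x)%:E))//.
rewrite -ge0_integralD//; apply: ge0_le_integral => //.
- exact: emeasurable_funD.
move=> x _; have [x0|x0] := leP 0 x; first by rewrite ger0_norm// leeDl.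
by rewrite ltr0_norm// leeDr.
Qed.

End IntBound.

(** * A Schur test *)

Section Mu2.
Variable R : realType.
Notation mu := (@lebesgue_measure R).

HB.instance Definition _ := Measure.copy (@mu2 R) (mu \x mu)%E.

(** With [mu2] registered as sigma-finite, Tonelli's theorem also applies to products that have
    [mu2] itself as a factor. *)
Lemma mu2_sigma_finite : sigma_finite setT (@mu2 R).
Proof.
have /sigma_finiteP[F [TF ndF Foo]] := sigma_finiteT mu.
exists (fun n => F n `*` F n).
  rewrite -setXTT TF predeqE => -[x y]; split.
    move=> [/= [n _ Fnx] [k _ Gky]]; exists (maxn n k) => //; split.
    - by move: x Fnx; exact/subsetPset/ndF/leq_maxl.
    - by move: y Gky; exact/subsetPset/ndF/leq_maxr.
  by move=> [n _ []/= ? ?]; split; exists n.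
move=> k; have [? ?] := Foo k; split; first exact: measurableX.
by rewrite /mu2 product_measure1E// lte_mul_pinfty// ge0_fin_numE.
Qed.

HB.instance Definition _ := @Measure_isSigmaFinite.Build _ _ _ (@mu2 R) mu2_sigma_finite.

Lemma mu2_tonelli1 (f : R * R -> \bar R) : measurable_fun setT f ->
  (forall p, 0 <= f p)%E -> (\int[@mu2 R]_p f p = \int[mu]_x \int[mu]_y f (x, y))%E.
Proof. by move=> mf f0; rewrite /mu2 (@fubini_tonelli1 _ _ _ _ _ mu mu f). Qed.

Lemma mu2_tonelli2 (f : R * R -> \bar R) : measurable_fun setT f ->
  (forall p, 0 <= f p)%E -> (\int[@mu2 R]_p f p = \int[mu]_y \int[mu]_x f (x, y))%E.
Proof. by move=> mf f0; rewrite /mu2 (@fubini_tonelli2 _ _ _ _ _ mu mu f). Qed.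

End Mu2.

Section Schur.
Variable R : realType.
Notation mu := (@lebesgue_measure R).
Notation mu2 := (@mu2 R).

(* Bounds the difference of the squared Cauchy kernels with poles [q.1], [q.2]; see [kap_diff]. *)
Definition skern (q p : R * R) : R :=
  if 0 < p.2 then if 0 < `|q.1 - q.2| then
    p.2 / ((p.2 + `|q.1 - q.2|) * ((p.1 - q.2) ^+ 2 + p.2 ^+ 2)) else 0 else 0.

Lemma skern_ge0 q p : 0 <= skern q p.
Proof.
rewrite /skern; case: ifPn => // p0; case: ifPn => // d0.
by rewrite divr_ge0 ?mulr_ge0 ?addr_ge0 ?sqr_ge0 ?(ltW p0).
Qed.

Lemma measurable_skern d (T : measurableType d) (f g : T -> R * R) :
  measurable_fun setT f -> measurable_fun setT g ->
  measurable_fun setT (fun x => skern (f x) (g x)).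
Proof.
move=> mf mg; have f1 := measurableT_comp measurable_fst mf.
have f2 := measurableT_comp measurable_snd mf.
have g1 := measurableT_comp measurable_fst mg.
have g2 := measurableT_comp measurable_snd mg.
rewrite /skern; meas; solve [exact: f1|exact: f2|exact: g1|exact: g2].
Qed.

Lemma ge0_int_EFin d (T : measurableType d) (m : {measure set T -> \bar R}) (f : T -> R) :
  (forall x, 0 <= f x) -> (0 <= \int[m]_x (f x)%:E)%E.
Proof. by move=> f0; apply: integral_ge0 => x _; rewrite lee_fin. Qed.

Lemma poisson_mul_le (c t y : R) : 0 < y -> 0 <= c ->
  (\int[mu]_x (c * (y / ((x - t) ^+ 2 + y ^+ 2)))%:E <= (c * pi)%:E)%E.
Proof.
move=> y0 c0; under eq_integral do rewrite EFinM.
rewrite ge0_integralZl_EFin//; last 2 first.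
- by move=> x _; rewrite lee_fin divr_ge0 ?addr_ge0 ?sqr_ge0// ltW.
- by apply/measurable_EFinP; meas.
rewrite EFinM; apply: lee_pmul => //; last exact: poisson_le.
by apply: ge0_int_EFin => x; rewrite divr_ge0 ?addr_ge0 ?sqr_ge0// ltW.
Qed.

(** In the horizontal variable the kernel is a Poisson kernel of mass at most [pi]; what remains in
    the height is [schurw], of integral at most [pi / sqrt d]. *)
Lemma skern_weight_le (q : R * R) : 0 < `|q.1 - q.2| ->
  (\int[mu2]_p (skern q p / Num.sqrt p.2)%:E <= (pi ^+ 2 / Num.sqrt `|q.1 - q.2|)%:E)%E.
Proof.
move=> d0; set d := `|_|.
pose f := fun p : R * R => (skern q p / Num.sqrt p.2)%:E.
have mF : measurable_fun setT f.
  apply/measurable_EFinP; meas; exact: measurable_skern.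
have F0 p : (0 <= f p)%E.
  by rewrite lee_fin divr_ge0 ?skern_ge0 ?sqrtr_ge0.
rewrite mu2_tonelli2//.
apply: (@le_trans _ _ (\int[mu]_y (pi * schurw d y)%:E)%E).
  apply: ge0_le_integral => //.
  - by move=> y _; apply: integral_ge0 => x _; exact: (F0 (x, y)).
  - exact: (@measurable_fun_fubini_tonelli_G _ _ _ _ R mu f mF F0).
  - apply/measurable_EFinP; apply: mfM; first exact: measurable_cst.
    exact: (@measurable_schurw R _ (measurableTypeR R) (cst d) id (measurable_cst d) (@measurable_id _ _ _)).
  move=> y _; rewrite /f /skern/= d0 -/d /schurw.
  case: ifPn => y0; last first.
    by rewrite mulr0; under eq_integral do rewrite mul0r; rewrite integral0.
  rewrite (mulrC pi).
  apply: le_trans (@poisson_mul_le _ q.2 y y0 _); last first.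
    by rewrite invr_ge0 mulr_ge0 ?sqrtr_ge0// addr_ge0// ltW.
  rewrite le_eqVlt; apply/orP; left; apply/eqP; apply: eq_integral => x _; congr (_%:E).
  rewrite -mulrA -[RHS]mulrCA; congr (_ * _); rewrite !invfM; ring.
under eq_integral do rewrite EFinM.
rewrite ge0_integralZl_EFin//; last 3 first.
- by move=> y _; rewrite lee_fin schurw_ge0// ltW.
- by apply/measurable_EFinP; exact: measurable_schurw.
- exact: pi_ge0.
rewrite expr2 -mulrA EFinM; apply: lee_pmul => //; rewrite ?lee_fin ?pi_ge0//.
- by apply: ge0_int_EFin => y; rewrite schurw_ge0// ltW.
- exact: integral_schurw.
Qed.

(** Dual estimate, with the roles exchanged: integrating over [s] first gives [schurw] on both sides
    of [t], hence the factor [2], and the integral over [t] is of Poisson type. *)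
Lemma skern_dual_le (p : R * R) : 0 < p.2 ->
  (\int[mu2]_q (skern q p / Num.sqrt `|q.1 - q.2|)%:E <= (2 * pi ^+ 2 / Num.sqrt p.2)%:E)%E.
Proof.
move=> y0; set y := p.2.
pose f := fun q : R * R => (skern q p / Num.sqrt `|q.1 - q.2|)%:E.
have mF : measurable_fun setT f.
  by apply/measurable_EFinP; meas; exact: measurable_skern.
have F0 q : (0 <= f q)%E.
  by rewrite lee_fin divr_ge0 ?skern_ge0 ?sqrtr_ge0.
rewrite mu2_tonelli2//.
apply: (@le_trans _ _ (\int[mu]_t ((2 * pi / Num.sqrt y) * (y / ((t - p.1) ^+ 2 + y ^+ 2)))%:E)%E).
  apply: ge0_le_integral => //.
  - by move=> t _; apply: integral_ge0 => x _; exact: (F0 (x, t)).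
  - exact: (@measurable_fun_fubini_tonelli_G _ _ _ _ R mu f mF F0).
  - by apply/measurable_EFinP; meas.
  move=> t _; rewrite /f.
  have c0 : 0 <= y / ((t - p.1) ^+ 2 + y ^+ 2).
    by rewrite divr_ge0 ?addr_ge0 ?sqr_ge0// ltW.
  apply: (@le_trans _ _ (\int[mu]_s ((y / ((t - p.1) ^+ 2 + y ^+ 2))%:E * (schurw y `|s - t|)%:E))%E).
    rewrite le_eqVlt; apply/orP; left; apply/eqP; apply: eq_integral.
    move=> s _; rewrite -EFinM /skern/= y0 /schurw -/y; case: ifPn => d0; last by rewrite mul0r mulr0.
    congr (_%:E); rewrite -(sqrrN (t - p.1)) opprB !invfM (addrC y); ring.
  rewrite ge0_integralZl_EFin//; last 2 first.
  - by move=> s _; rewrite lee_fin schurw_ge0// ltW.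
  - by apply/measurable_EFinP; apply: measurable_schurw; meas.
  rewrite [in leRHS]mulrC [leRHS]EFinM; apply: lee_pmul => //.
  - by apply: ge0_int_EFin => s; rewrite schurw_ge0// ltW.
  - exact: integral_schurw_dist.
apply: le_trans (poisson_mul_le _ y0 _) _.
  by rewrite divr_ge0 ?sqrtr_ge0// mulr_ge0// pi_ge0.
rewrite lee_fin le_eqVlt; apply/orP; left; apply/eqP; ring.
Qed.

Section N.
Variable h : R * R -> R.
Hypothesis mh : measurable_fun setT h.
Hypothesis h0 : forall p, 0 <= h p.
Hypothesis hU : forall p, p.2 <= 0 -> h p = 0.

Definition schurN (q : R * R) : \bar R := \int[mu2]_p (h p * skern q p)%:E.

Lemma schurN_ge0 q : (0 <= schurN q)%E.
Proof. by apply: ge0_int_EFin => p; rewrite mulr_ge0 ?skern_ge0. Qed.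

Lemma measurable_schurN : measurable_fun setT schurN.
Proof.
apply: (@measurable_fun_fubini_tonelli_F _ _ _ _ R mu2 (fun x : (R * R) * (R * R) => (h x.2 * skern x.1 x.2)%:E)) => //.
  apply/measurable_EFinP; apply: mfM; first exact: measurableT_comp.
  exact: (measurable_skern measurable_fst measurable_snd).
by move=> x; rewrite lee_fin mulr_ge0 ?skern_ge0.
Qed.

(** Cauchy-Schwarz after splitting [h * skern] as [h * y^(1/4) * skern^(1/2)] times
    [y^(-1/4) * skern^(1/2)], so that the square of the second factor is the integrand of
    [skern_weight_le]. *)
Lemma schurN_sqr_le (q : R * R) : 0 < `|q.1 - q.2| ->
  (schurN q * schurN q <=
   \int[mu2]_p (pi ^+ 2 * (h p ^+ 2 * Num.sqrt p.2 * (skern q p / Num.sqrt `|q.1 - q.2|)))%:E)%E.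
Proof.
move=> d0.
have mk : measurable_fun setT (skern q) by exact: measurable_skern.
have H := @cauchy_schwarz R _ _ mu2 (fun p => h p ^+ 2 * Num.sqrt p.2 * skern q p)
  (fun p => skern q p / Num.sqrt p.2) (fun p => h p * skern q p).
apply: le_trans (H _ _ _ _ _ _ _) _ => //; first by meas.
- by meas.
- by meas.
- by move=> p; rewrite !mulr_ge0 ?sqr_ge0 ?sqrtr_ge0 ?skern_ge0.
- by move=> p; rewrite divr_ge0 ?sqrtr_ge0 ?skern_ge0.
- by move=> p; rewrite mulr_ge0 ?skern_ge0.
- move=> p; have [p0|p0] := leP p.2 0; first by rewrite hU// expr0n/= !mul0r expr0n.
  rewrite le_eqVlt; apply/orP; left; apply/eqP.
  have s0 : Num.sqrt p.2 != 0 by rewrite gt_eqF// sqrtr_gt0.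
  by field.
rewrite [leRHS](_ : _ = (pi ^+ 2 / Num.sqrt `|q.1 - q.2|)%:E * \int[mu2]_p (h p ^+ 2 * Num.sqrt p.2 * skern q p)%:E)%E; last first.
  rewrite -ge0_integralZl_EFin//; last 3 first.
  - by move=> p _; rewrite lee_fin !mulr_ge0 ?sqr_ge0 ?sqrtr_ge0 ?skern_ge0.
  - by apply/measurable_EFinP; meas.
  - by rewrite divr_ge0 ?sqr_ge0 ?sqrtr_ge0.
  by apply: eq_integral => p _; rewrite -EFinM; congr (_%:E); ring.
rewrite muleC; apply: lee_pmul => //.
- by apply: ge0_int_EFin => p; rewrite divr_ge0 ?sqrtr_ge0 ?skern_ge0.
- by apply: ge0_int_EFin => p; rewrite !mulr_ge0 ?sqr_ge0 ?sqrtr_ge0 ?skern_ge0.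
- exact: skern_weight_le.
Qed.

(** Integrate [schurN_sqr_le] over the pairs of poles and exchange the integrals: [skern_dual_le]
    returns [1 / sqrt p.2], which cancels the weight. The constant is [pi^2] times [2 * pi^2]. *)
Lemma schur_test : (\int[mu2]_q (if q.1 == q.2 then 0 else schurN q * schurN q) <=
   (2 * pi ^+ 4)%:E * \int[mu2]_p (h p ^+ 2)%:E)%E.
Proof.
pose F (x : (R * R) * (R * R)) : R :=
  pi ^+ 2 * (h x.2 ^+ 2 * Num.sqrt x.2.2 * (skern x.1 x.2 / Num.sqrt `|x.1.1 - x.1.2|)).
have F0 x : 0 <= F x.
  apply: mulr_ge0; first exact: sqr_ge0.
  apply: mulr_ge0; first by apply: mulr_ge0; [exact: sqr_ge0|exact: sqrtr_ge0].
  by apply: divr_ge0; [exact: skern_ge0|exact: sqrtr_ge0].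
have mF : measurable_fun setT (EFin \o F).
  apply/measurable_EFinP; rewrite /F.
  have m12 := measurableT_comp measurable_fst (@measurable_fst _ _ (R*R)%type (R*R)%type).
  have m11 := measurableT_comp measurable_snd (@measurable_fst _ _ (R*R)%type (R*R)%type).
  have m22 := measurableT_comp measurable_snd (@measurable_snd _ _ (R*R)%type (R*R)%type).
  meas; solve [exact: (measurableT_comp mh measurable_snd)|exact: m22|exact: (measurable_skern measurable_fst measurable_snd)|exact: m12|exact: m11].
apply: (@le_trans _ _ (\int[mu2]_q \int[mu2]_p (F (q, p))%:E)%E).
  apply: ge0_le_integral => //.
  - by move=> q _; case: ifPn => // _; rewrite mule_ge0 ?schurN_ge0.
  - apply: measurable_fun_ifT => //; last by apply: emeasurable_funM; exact: measurable_schurN.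
    exact: measurable_fun_eqr.
  - exact: (@measurable_fun_fubini_tonelli_F _ _ _ _ R mu2 (EFin \o F)).
  - move=> q _; case: ifPn => [_|qq].
      by apply: integral_ge0 => p _; rewrite lee_fin.
    by apply: schurN_sqr_le; rewrite normr_gt0 subr_eq0.
rewrite (@fubini_tonelli _ _ _ _ _ mu2 mu2 (EFin \o F))//=.
rewrite -ge0_integralZl_EFin//; last 3 first.
- by move=> p _; rewrite lee_fin sqr_ge0.
- by apply/measurable_EFinP; meas.
- by rewrite mulr_ge0// exprn_ge0// pi_ge0.
apply: ge0_le_integral => //.
- by move=> p _; apply: integral_ge0 => q _; rewrite lee_fin.
- exact: (@measurable_fun_fubini_tonelli_G _ _ _ _ R mu2 (EFin \o F)).
- by apply/measurable_EFinP; meas.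
move=> p _; rewrite -EFinM.
have [p0|p0] := leP p.2 0.
  under eq_integral do rewrite /F hU//= expr0n !mul0r mulr0.
  by rewrite integral0 lee_fin mulr_ge0 ?sqr_ge0// mulr_ge0// exprn_ge0// pi_ge0.
have c0 : 0 <= pi ^+ 2 * (h p ^+ 2 * Num.sqrt p.2).
  by apply: mulr_ge0; [exact: sqr_ge0|apply: mulr_ge0; [exact: sqr_ge0|exact: sqrtr_ge0]].
have -> : (\int[mu2]_q (F (q, p))%:E = \int[mu2]_q ((pi ^+ 2 * (h p ^+ 2 * Num.sqrt p.2))%:E *
    (skern q p / Num.sqrt `|q.1 - q.2|)%:E))%E.
  by apply: eq_integral => q _; rewrite -EFinM /F/=; congr (_%:E); ring.
rewrite ge0_integralZl_EFin//; last 2 first.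
- by move=> q _; rewrite lee_fin divr_ge0 ?sqrtr_ge0 ?skern_ge0.
- by apply/measurable_EFinP; meas; exact: measurable_skern.
apply: le_trans (lee_pmul _ _ (lexx _) (skern_dual_le p0)) _.
- by rewrite lee_fin.
- by apply: ge0_int_EFin => q; rewrite divr_ge0 ?sqrtr_ge0 ?skern_ge0.
rewrite -EFinM lee_fin le_eqVlt; apply/orP; left; apply/eqP.
have s0 : Num.sqrt p.2 != 0 by rewrite gt_eqF// sqrtr_gt0.
by field.
Qed.
End N.
End Schur.

(** * The Cauchy kernel *)

Section CD.
Variable R : realType.
Section D.
Implicit Types (f g : R -> R) (x : R).
(** Derivative with the function in explicit [fun] form, so that [deriv] can follow the syntax of an
    expression and [dv_eq] leaves an equation for the value. *)
Definition dv x f (df : R) : Prop := is_derive x 1 f df.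
Lemma dv_eq x f df df' : dv x f df -> df = df' -> dv x f df'.
Proof. by move=> + <-. Qed.
Lemma dv_cst x (c : R) : dv x (fun=> c) 0.
Proof. exact: is_derive_cst. Qed.
Lemma dv_id x : dv x (fun y => y) 1.
Proof. exact: is_derive_id. Qed.
Lemma dvD x f g df dg : dv x f df -> dv x g dg -> dv x (fun y => f y + g y) (df + dg).
Proof. exact: is_deriveD. Qed.
Lemma dvB x f g df dg : dv x f df -> dv x g dg -> dv x (fun y => f y - g y) (df - dg).
Proof. exact: is_deriveB. Qed.
Lemma dvN x f df : dv x f df -> dv x (fun y => - f y) (- df).
Proof. exact: is_deriveN. Qed.
Lemma dvM x f g df dg : dv x f df -> dv x g dg -> dv x (fun y => f y * g y) (f x * dg + g x * df).
Proof. exact: is_deriveM. Qed.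
Lemma dvX x f n df : dv x f df -> dv x (fun y => f y ^+ n.+1) (n.+1%:R * f x ^+ n * df).
Proof.
move=> d; have -> : (fun y => f y ^+ n.+1) = f ^+ n.+1 by apply/funext => y; rewrite exprfctE.
exact: is_deriveX.
Qed.
Lemma dvV x f df : f x != 0 -> dv x f df -> dv x (fun y => (f y)^-1) (- (f x ^- 2) * df).
Proof. by move=> f0 d; exact: is_deriveV. Qed.
End D.
Section C.
Context (T : topologicalType).
Implicit Types (f g : T -> R) (x : T).
Lemma ctD x f g : continuous_at x f -> continuous_at x g -> continuous_at x (fun y => f y + g y).
Proof. exact: cvgD. Qed.
Lemma ctB x f g : continuous_at x f -> continuous_at x g -> continuous_at x (fun y => f y - g y).
Proof. exact: cvgB. Qed.
Lemma ctN x f : continuous_at x f -> continuous_at x (fun y => - f y).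
Proof. exact: cvgN. Qed.
Lemma ctM x f g : continuous_at x f -> continuous_at x g -> continuous_at x (fun y => f y * g y).
Proof. exact: cvgM. Qed.
Lemma ctX x f n : continuous_at x f -> continuous_at x (fun y => f y ^+ n).
Proof. move=> cf; exact: (continuous_comp cf (@exprn_continuous _ _ _)). Qed.
Lemma ctV x f : f x != 0 -> continuous_at x f -> continuous_at x (fun y => (f y)^-1).
Proof. exact: cvgV. Qed.
Lemma ctabs x f : continuous_at x f -> continuous_at x (fun y => `|f y|).
Proof. exact: cvg_norm. Qed.
End C.
Lemma ctfst (x : R * R) : continuous_at x (@fst R R).
Proof. exact: cvg_fst. Qed.
Lemma ctsnd (x : R * R) : continuous_at x (@snd R R).
Proof. exact: cvg_snd. Qed.
End CD.

Ltac cont := lazymatch goal with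
  | |- continuous_at _ (fun _ => ?c) => exact: cvg_cst
  | |- continuous_at _ (fun x => @GRing.add _ (@?f x) (@GRing.opp _ (@?g x))) =>
      apply: (@ctB _ _ _ f g); cont
  | |- continuous_at _ (fun x => @GRing.add _ (@?f x) (@?g x)) => apply: (@ctD _ _ _ f g); cont
  | |- continuous_at _ (fun x => @GRing.mul _ (@?f x) (@?g x)) => apply: (@ctM _ _ _ f g); cont
  | |- continuous_at _ (fun x => @GRing.inv _ (@?f x)) => apply: (@ctV _ _ _ f); [idtac|cont]
  | |- continuous_at _ (fun x => @GRing.opp _ (@?f x)) => apply: (@ctN _ _ _ f); cont
  | |- continuous_at _ (fun x => @GRing.exp _ (@?f x) ?n) => apply: (@ctX _ _ _ f n); cont
  | |- continuous_at _ (fun x => @Num.norm _ _ (@?f x)) => apply: (@ctabs _ _ _ f); cont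
  | |- continuous_at _ (fun x => x) => exact: cvg_id
  | |- continuous_at _ (fun x => fst x) => exact: ctfst
  | |- continuous_at _ (fun x => snd x) => exact: ctsnd
  | |- _ => idtac
  end.

Ltac deriv := lazymatch goal with
  | |- dv _ (fun _ => ?c) _ => exact: dv_cst
  | |- dv _ (fun x => @GRing.add _ (@?f x) (@GRing.opp _ (@?g x))) _ => apply: (@dvB _ _ f g); deriv
  | |- dv _ (fun x => @GRing.add _ (@?f x) (@?g x)) _ => apply: (@dvD _ _ f g); deriv
  | |- dv _ (fun x => @GRing.mul _ (@?f x) (@?g x)) _ => apply: (@dvM _ _ f g); deriv
  | |- dv _ (fun x => @GRing.inv _ (@?f x)) _ => apply: (@dvV _ _ f); [idtac|deriv]
  | |- dv _ (fun x => @GRing.opp _ (@?f x)) _ => apply: (@dvN _ _ f); deriv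
  | |- dv _ (fun x => @GRing.exp _ (@?f x) (S ?n)) _ => apply: (@dvX _ _ f n); deriv
  | |- dv _ (fun x => x) _ => exact: dv_id
  | |- _ => first [eassumption|idtac]
  end.

Section Kernel.
Variable R : realType.
Notation mu := (@lebesgue_measure R).
Notation mu2 := (@mu2 R).
Variables g1 g2 : R * R -> R.

Definition rho (x : R) (p : R * R) : R := (p.1 - x) ^+ 2 + p.2 ^+ 2.
Definition cau (x : R) (p : R * R) : R := (g1 p * (p.1 - x) + g2 p * p.2) / rho x p.
(* With [g = g1 + i g2] and [z = p.1 + i p.2]: [cau x p = Re (g / (z - x))], and [kap s p = Re (g / (z - s)^2)] is its derivative in [s]. *)
Definition kap (s : R) (p : R * R) : R :=
  (g1 p * ((p.1 - s) ^+ 2 - p.2 ^+ 2) + g2 p * (2 * (p.1 - s) * p.2)) / rho s p ^+ 2.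
(** [|g| / y], whose squared integral is the energy in the theorem; it is the quantity through which
    [g] is estimated below. *)
Definition hh (p : R * R) : R :=
  if 0 < p.2 then Num.sqrt (g1 p ^+ 2 + g2 p ^+ 2) / p.2 else 0.

Lemma rho_gt0 x p : 0 < p.2 -> 0 < rho x p.
Proof. by move=> p0; rewrite /rho ltr_wpDl ?sqr_ge0 ?exprn_gt0. Qed.

Lemma norm_le_sqr (x y : R) : 0 <= y -> x ^+ 2 <= y ^+ 2 -> `|x| <= y.
Proof. by move=> y0 xy; rewrite -(ger0_norm y0) -!sqrtr_sqr ler_wsqrtr. Qed.

(** With [A = a + i e] and [B = b + i e] the left side is [|A^-2 - B^-2|^2 = |A - B|^2 |A + B|^2 /
    |A B|^4]. Since [|A + B|^2 <= 2 S] and [(e + d)^2 <= 4 S] for [S = |A|^2 + |B|^2], the claim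
    reduces to [8 <= 9]; this is the origin of the [3]. *)
Lemma kap_diff_key (a b e d : R) : 0 < e -> 0 < d -> `|a - b| = d ->
  ((a ^+ 2 - e ^+ 2) / (a ^+ 2 + e ^+ 2) ^+ 2 - (b ^+ 2 - e ^+ 2) / (b ^+ 2 + e ^+ 2) ^+ 2) ^+ 2 +
  ((2 * a * e) / (a ^+ 2 + e ^+ 2) ^+ 2 - (2 * b * e) / (b ^+ 2 + e ^+ 2) ^+ 2) ^+ 2
  <= (3 * d / (e + d) * ((a ^+ 2 + e ^+ 2)^-1 + (b ^+ 2 + e ^+ 2)^-1)) ^+ 2.
Proof.
move=> e0 d0 dE.
have A0 : 0 < a ^+ 2 + e ^+ 2 by rewrite ltr_wpDl ?sqr_ge0 ?exprn_gt0.
have B0 : 0 < b ^+ 2 + e ^+ 2 by rewrite ltr_wpDl ?sqr_ge0 ?exprn_gt0.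
have d2 : d ^+ 2 = (a - b) ^+ 2 by rewrite -dE real_normK// num_real.
have An := lt0r_neq0 A0; have Bn := lt0r_neq0 B0.
have ed0 : 0 < e + d by rewrite addr_gt0.
have edn := lt0r_neq0 ed0.
have -> : ((a ^+ 2 - e ^+ 2) / (a ^+ 2 + e ^+ 2) ^+ 2 - (b ^+ 2 - e ^+ 2) / (b ^+ 2 + e ^+ 2) ^+ 2) ^+ 2 +
  ((2 * a * e) / (a ^+ 2 + e ^+ 2) ^+ 2 - (2 * b * e) / (b ^+ 2 + e ^+ 2) ^+ 2) ^+ 2 =
  (a - b) ^+ 2 * ((a + b) ^+ 2 + 4 * e ^+ 2) / ((a ^+ 2 + e ^+ 2) ^+ 2 * (b ^+ 2 + e ^+ 2) ^+ 2).
  by field; rewrite An Bn.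
have -> : (3 * d / (e + d) * ((a ^+ 2 + e ^+ 2)^-1 + (b ^+ 2 + e ^+ 2)^-1)) ^+ 2 =
  d ^+ 2 * (9 * (a ^+ 2 + e ^+ 2 + (b ^+ 2 + e ^+ 2)) ^+ 2 / (e + d) ^+ 2) / ((a ^+ 2 + e ^+ 2) ^+ 2 * (b ^+ 2 + e ^+ 2) ^+ 2).
  by field; rewrite An Bn edn.
rewrite -d2 ler_pM2r; last by rewrite invr_gt0 mulr_gt0// exprn_gt0.
rewrite ler_pM2l ?exprn_gt0// ler_pdivlMr ?exprn_gt0//.
set S := a ^+ 2 + e ^+ 2 + (b ^+ 2 + e ^+ 2).
have S0 : 0 <= S by rewrite ltW// addr_gt0.
have h1 : (a + b) ^+ 2 + 4 * e ^+ 2 <= 2 * S by have := sqr_ge0 (a - b); rewrite /S; nra.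
have h2 : (e + d) ^+ 2 <= 4 * S.
  have := sqr_ge0 (e - d); have := sqr_ge0 (a + b); have := sqr_ge0 e; rewrite /S; nra.
have h3 : 0 <= (a + b) ^+ 2 + 4 * e ^+ 2 by rewrite addr_ge0 ?sqr_ge0// mulr_ge0 ?sqr_ge0.
apply: le_trans (ler_pM h3 (sqr_ge0 _) h1 h2) _.
have := sqr_ge0 S; nra.
Qed.

Hypothesis g1U : forall p, p.2 <= 0 -> g1 p = 0.
Hypothesis g2U : forall p, p.2 <= 0 -> g2 p = 0.

Lemma hh_ge0 p : 0 <= hh p.
Proof. by rewrite /hh; case: ifPn => // p0; rewrite divr_ge0 ?sqrtr_ge0// ltW. Qed.

Lemma hhU p : p.2 <= 0 -> hh p = 0.
Proof. by rewrite /hh ltNge => ->. Qed.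

Lemma kapU s p : p.2 <= 0 -> kap s p = 0.
Proof. by move=> p0; rewrite /kap g1U// g2U// !mul0r addr0 mul0r. Qed.

Lemma cauU s p : p.2 <= 0 -> cau s p = 0.
Proof. by move=> p0; rewrite /cau g1U// g2U// !mul0r addr0 mul0r. Qed.

Lemma cs2 (x y u v : R) : `|x * u + y * v| <= Num.sqrt (x ^+ 2 + y ^+ 2) * Num.sqrt (u ^+ 2 + v ^+ 2).
Proof.
apply: norm_le_sqr; first by rewrite mulr_ge0 ?sqrtr_ge0.
rewrite exprMn !sqr_sqrtr ?addr_ge0 ?sqr_ge0//.
have := sqr_ge0 (x * v - y * u); nra.
Qed.

(** The Cauchy-Schwarz inequality [cs2] separates [|g|] from the kernels, and [|g| = y * h] provides
    the height in the numerator of [skern]. *)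
Lemma kap_diff s t p :
  `|kap s p - kap t p| <= 3 * `|s - t| * (hh p * (skern (s, t) p + skern (t, s) p)).
Proof.
have [p0|p0] := leP p.2 0; first by rewrite !kapU// hhU// subrr normr0 mul0r mulr0.
have [->|st] := eqVneq s t; first by rewrite !subrr !normr0 mulr0 mul0r.
have d0 : 0 < `|s - t| by rewrite normr_gt0 subr_eq0.
have d0' : 0 < `|t - s| by rewrite distrC.
rewrite /skern /hh p0 /= d0 d0' (distrC t s).
have Rs := rho_gt0 s p0; have Rt := rho_gt0 t p0.
rewrite /kap; set a := p.1 - s; set b := p.1 - t; set e := p.2.
rewrite -/(rho s p) -/(rho t p).
have abd : `|a - b| = `|s - t|.
  by rewrite /a /b opprB addrC subrKA distrC.
have -> : (g1 p * (a ^+ 2 - e ^+ 2) + g2 p * (2 * a * e)) / rho s p ^+ 2 -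
    (g1 p * (b ^+ 2 - e ^+ 2) + g2 p * (2 * b * e)) / rho t p ^+ 2 =
  g1 p * ((a ^+ 2 - e ^+ 2) / rho s p ^+ 2 - (b ^+ 2 - e ^+ 2) / rho t p ^+ 2) +
  g2 p * ((2 * a * e) / rho s p ^+ 2 - (2 * b * e) / rho t p ^+ 2) by ring.
apply: le_trans (cs2 _ _ _ _) _.
have -> : 3 * `|s - t| * (Num.sqrt (g1 p ^+ 2 + g2 p ^+ 2) / e * (e / ((e + `|s - t|) * rho t p) +
     e / ((e + `|s - t|) * rho s p))) =
   Num.sqrt (g1 p ^+ 2 + g2 p ^+ 2) * (3 * `|s - t| / (e + `|s - t|) * ((rho s p)^-1 + (rho t p)^-1)).
  have ed : 0 < e + `|s - t| by rewrite addr_gt0.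
  by field; rewrite !lt0r_neq0.
apply: ler_wpM2l; first exact: sqrtr_ge0.
have c0 : 0 <= 3 * `|s - t| / (e + `|s - t|) * ((rho s p)^-1 + (rho t p)^-1).
  by rewrite mulr_ge0 ?addr_ge0 ?invr_ge0 ?(ltW Rs) ?(ltW Rt)// mulr_ge0// invr_ge0 addr_ge0// ltW.
rewrite -[leRHS](ger0_norm c0) -sqrtr_sqr ler_wsqrtr//.
exact: kap_diff_key.
Qed.

(** The distance from [z] to the real point [s] is at least the height of [z]; the majorant does not
    depend on [s]. *)
Lemma cau_le s p : `|cau s p| <= hh p.
Proof.
have [p0|p0] := leP p.2 0; first by rewrite cauU// hhU// normr0.
have Rs := rho_gt0 s p0.
rewrite /cau /hh p0 normrM normrV ?unitfE ?gt_eqF// (ger0_norm (ltW Rs)) ler_pdivrMr//.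
apply: le_trans (cs2 _ _ _ _) _; rewrite -/(rho s p) -mulrA ler_wpM2l ?sqrtr_ge0//.
rewrite mulrC ler_pdivlMr//.
have r0 := sqrtr_ge0 (rho s p); have := sqr_sqrtr (ltW Rs).
have : p.2 <= Num.sqrt (rho s p).
  by rewrite -[leLHS](ger0_norm (ltW p0)) -sqrtr_sqr ler_wsqrtr// /rho lerDr sqr_ge0.
nra.
Qed.

Lemma rho_dv (p : R * R) (s : R) : dv s (fun x => rho x p) (- (2 * (p.1 - s))).
Proof.
rewrite /rho; eapply dv_eq; [deriv|]; cbv beta; ring.
Qed.

Lemma cau_dv (p : R * R) (s : R) : 0 < p.2 -> dv s (fun x => cau x p) (kap s p).
Proof.
move=> p0; have Rs := rho_gt0 s p0; have Rn := lt0r_neq0 Rs.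
rewrite /cau; eapply dv_eq; [deriv|].
- exact: Rn.
- exact: rho_dv.
cbv beta; rewrite /kap; move: Rn; rewrite /rho => Rn; by field.
Qed.

Lemma kap_cont (p : R * R) : continuous (fun s => kap s p).
Proof.
move=> s; have [p0|p0] := leP p.2 0.
  have -> : (fun s => kap s p) = cst 0 by apply/funext => x; rewrite kapU.
  exact: cvg_cst.
have Rn := lt0r_neq0 (rho_gt0 s p0).
by rewrite /kap /rho; cont; rewrite expf_neq0.
Qed.

End Kernel.

(** * Energy of the boundary density *)

Section FubiniIn.
Context d1 d2 (T1 : measurableType d1) (T2 : measurableType d2) (R : realType).
Variables (m1 : {sigma_finite_measure set T1 -> \bar R}) (m2 : {sigma_finite_measure set T2 -> \bar R}).
Variables (D : set T1) (mD : measurable D).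

Let ind (x : T1) : bool := x \in D.
Let mind : measurable_fun setT ind.
Proof.
apply: (measurable_fun_bool true); rewrite (_ : _ @^-1` _ = D) ?setTI//.
by apply/seteqP; split=> x /=; rewrite /ind; [move/set_mem|move/mem_set].
Qed.

Lemma tonelli_in (f : T1 * T2 -> \bar R) : measurable_fun setT f -> (forall z, 0 <= f z)%E ->
  (\int[m1]_(x in D) \int[m2]_y f (x, y) = \int[m2]_y \int[m1]_(x in D) f (x, y))%E.
Proof.
move=> mf f0.
pose g z := if ind z.1 then f z else 0%E.
have mg : measurable_fun setT g.
  apply: measurable_fun_ifT => //; exact: measurableT_comp mind measurable_fst.
have g0 z : (0 <= g z)%E by rewrite /g; case: ifP.
have H := @fubini_tonelli _ _ _ _ _ m1 m2 g mg g0.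
rewrite integral_mkcond; rewrite [LHS](_ : _ = (\int[m1]_x \int[m2]_y g (x, y))%E).
  rewrite H; apply: eq_integral => y _; rewrite [RHS]integral_mkcond; apply: eq_integral => x _.
  by rewrite patchE.
apply: eq_integral => x _; rewrite patchE /g/= /ind; case: ifPn => // _.
by rewrite integral0.
Qed.

Variable f : T1 * T2 -> R.
Hypothesis mf : measurable_fun setT f.
Hypothesis ff : (\int[m1]_(x in D) \int[m2]_y `|f (x, y)|%:E < +oo)%E.

Let g z : \bar R := if ind z.1 then (f z)%:E else 0%E.
Let mg : measurable_fun setT g.
Proof.
apply: measurable_fun_ifT => //; first exact: measurableT_comp mind measurable_fst.
exact/measurable_EFinP.
Qed.
Let ig : (m1 \x m2)%E.-integrable setT g.
Proof.
apply/(integrable12ltyP _ _ mg); apply: le_lt_trans ff; rewrite [leRHS]integral_mkcond.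
rewrite le_eqVlt; apply/orP; left; apply/eqP; apply: eq_integral => x _.
rewrite patchE /g/= /ind; case: ifPn => // _.
by under eq_integral do rewrite abse0; rewrite integral0.
Qed.

Lemma integrable_fubini_in : m1.-integrable D (fun x => \int[m2]_y (f (x, y))%:E)%E.
Proof.
apply/(integrable_mkcond _ mD); have := integrable_fubini_F ig.
apply: eq_integrable => // x _; rewrite /fubini_F patchE /g/= /ind; case: ifPn => // _.
by rewrite integral0.
Qed.

Lemma fubini_in : (\int[m1]_(x in D) \int[m2]_y (f (x, y))%:E = \int[m2]_y \int[m1]_(x in D) (f (x, y))%:E)%E.
Proof.
have H := Fubini ig.
rewrite integral_mkcond; rewrite [LHS](_ : _ = (\int[m1]_x \int[m2]_y g (x, y))%E).
  rewrite H; apply: eq_integral => y _; rewrite [RHS]integral_mkcond; apply: eq_integral => x _.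
  by rewrite patchE.
apply: eq_integral => x _; rewrite patchE /g/= /ind; case: ifPn => // _.
by rewrite integral0.
Qed.

Lemma ae_integrable_in : {ae m1, forall x, D x -> m2.-integrable setT (fun y => (f (x, y))%:E)}.
Proof.
have := ae_integrable1 ig; apply: filterS.
by move=> x + Dx; rewrite /g /= /ind mem_set.
Qed.

Lemma integrable_fubini_in2 : m2.-integrable setT (fun y => \int[m1]_(x in D) (f (x, y))%:E)%E.
Proof.
have mh : measurable_fun setT (fun y => \int[m1]_(x in D) (f (x, y))%:E)%E.
  have := measurable_fubini_G ig; apply: eq_measurable_fun => y _.
  by rewrite /fubini_G [RHS]integral_mkcond; apply: eq_integral => x _; rewrite patchE.
have ma : measurable_fun setT (fun z => `|f z|%:E).
  by apply/measurable_EFinP; exact: measurableT_comp.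
apply/integrableP; split => //; apply: le_lt_trans ff.
rewrite (@tonelli_in (fun z => `|f z|%:E))//.
apply: ge0_le_integral => //; first exact: measurableT_comp.
  have mk : measurable_fun setT (fun z : T1 * T2 => if ind z.1 then `|f z|%:E else 0%E).
    apply: measurable_fun_ifT => //; exact: measurableT_comp mind measurable_fst.
  have k0 z : (0 <= (if ind z.1 then `|f z|%:E else 0))%E by case: ifP.
  have := @measurable_fun_fubini_tonelli_G _ _ _ _ _ m1 _ mk k0.
  apply: eq_measurable_fun => y _.
  by rewrite /fubini_G [RHS]integral_mkcond; apply: eq_integral => x _; rewrite patchE.
move=> y _; under [leRHS]eq_integral do rewrite -abse_EFin.
apply: le_abse_integral => //; apply/measurable_EFinP.
apply: measurable_funTS; apply: (measurableT_comp mf); exact: measurable_pair2.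
Qed.

End FubiniIn.

Section Gen.
Variable R : realType.
Notation mu := (@lebesgue_measure R).
Notation mu2 := (@mu2 R).

Lemma dv_FTC (f F : R -> R) (a b : R) : a <= b -> (forall x, dv x F (f x)) -> continuous f ->
  (\int[mu]_(s in `[a, b]) (f s)%:E = (F b - F a)%:E)%E.
Proof.
move=> + dF cf; rewrite le_eqVlt => /orP[/eqP ->|ab].
  by rewrite set_itv1 integral_set1// subrr.
have cF : continuous F.
  move=> x; apply: differentiable_continuous; apply/derivable1_diffP.
  by have [] := dF x.
rewrite (@continuous_FTC2 _ f F)//.
- exact: continuous_subspaceT.
- split.
  + by move=> x _; have [] := dF x.
  + exact/cvg_at_right_filter/cF.
  + exact/cvg_at_left_filter/cF.
- by move=> x _; rewrite derive1E; have [_ ->] := dF x.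
Qed.

Lemma sqr_adde (a b : \bar R) : (0 <= a -> 0 <= b ->
  (a + b) * (a + b) <= 2%:E * (a * a) + 2%:E * (b * b))%E.
Proof.
have pyy : (2%:E * (+oo * +oo) = +oo :> \bar R)%E by rewrite mulyy gt0_muley ?lte_fin.
move: a b => [a| |] [b| |]//= a0 b0.
- change (((a + b) * (a + b))%:E <= (2 * (a * a) + 2 * (b * b))%:E)%E.
  by rewrite lee_fin; have := sqr_ge0 (a - b); nra.
- by rewrite pyy addey ?leey// -!EFinM.
- by rewrite pyy addye ?leey// -!EFinM.
- by rewrite pyy addye ?leey.
Qed.

Lemma mu2_swap (F : R * R -> \bar R) : measurable_fun setT F ->
  measurable_fun setT (fun q : R * R => F (q.2, q.1)) -> (forall q, 0 <= F q)%E ->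
  (\int[mu2]_q F (q.2, q.1) = \int[mu2]_q F q)%E.
Proof. by move=> mF mS F0; rewrite (mu2_tonelli1 mS)// (mu2_tonelli2 mF). Qed.

End Gen.

Lemma integral_2D_lty d (T : measurableType d) (R : realType) (m : {measure set T -> \bar R})
  (N A B : T -> \bar R) : measurable_fun setT N -> measurable_fun setT A -> measurable_fun setT B ->
  (forall x, 0 <= N x)%E -> (forall x, 0 <= A x)%E -> (forall x, 0 <= B x)%E ->
  (forall x, N x <= 2%:E * A x + 2%:E * B x)%E ->
  (\int[m]_x A x < +oo -> \int[m]_x B x < +oo -> \int[m]_x N x < +oo)%E.
Proof.
move=> mN mA mB N0 A0 B0 NAB fA fB.
have m2A : measurable_fun setT (fun x => 2%:E * A x)%E by exact: measurable_funeM.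
have m2B : measurable_fun setT (fun x => 2%:E * B x)%E by exact: measurable_funeM.
apply: (@le_lt_trans _ _ (\int[m]_x (2%:E * A x + 2%:E * B x))%E).
  by apply: ge0_le_integral => //; exact: emeasurable_funD.
rewrite ge0_integralD//; last 2 first.
- by move=> q _; rewrite mule_ge0.
- by move=> q _; rewrite mule_ge0.
by rewrite !ge0_integralZl//= lte_add_pinfty// lte_mul_pinfty.
Qed.

(** * The Schur integral symmetrised in its two poles *)

Section NNs.
Variable R : realType.
Notation mu := (@lebesgue_measure R).
Notation mu2 := (@mu2 R).
Variable h : R * R -> R.
Hypothesis mh : measurable_fun setT h.
Hypothesis h0 : forall p, 0 <= h p.
Hypothesis hU : forall p, p.2 <= 0 -> h p = 0.
Hypothesis hf : (\int[mu2]_p (h p ^+ 2)%:E < +oo)%E.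

Definition schurS (s t : R) : \bar R := (schurN h (s, t) + schurN h (t, s))%E.
(** Zero on the diagonal, like the energy quotient that it is to dominate, where division by zero
    gives zero. *)
Definition schurSq (s t : R) : \bar R := (if s == t then 0 else schurS s t * schurS s t)%E.

Lemma schurS_ge0 s t : (0 <= schurS s t)%E.
Proof. by rewrite adde_ge0// schurN_ge0. Qed.

Lemma schurSq_ge0 s t : (0 <= schurSq s t)%E.
Proof. by rewrite /schurSq; case: ifP => // _; rewrite mule_ge0 ?schurS_ge0. Qed.

(** From [X <= 1 + X^2]: finiteness of the squared integral yields local integrability of
    [schurS]. *)
Lemma schurS_le s t : s != t -> (schurS s t <= 1 + schurSq s t)%E.
Proof.
move=> st; rewrite /schurSq (negbTE st); have := schurS_ge0 s t; move: (schurS s t) => [a| |]//= a0.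
  change (a%:E <= (1 + a * a)%:E)%E; rewrite lee_fin; have := sqr_ge0 (a - 1); rewrite lee_fin in a0; nra.
Qed.

Lemma measurable_schurN_comp d (T : measurableType d) (f g : T -> R) :
  measurable_fun setT f -> measurable_fun setT g ->
  measurable_fun setT (fun x => schurN h (f x, g x)).
Proof.
move=> mf mg.
apply: (@measurable_fun_fubini_tonelli_F _ _ _ _ R mu2
  (fun x : T * (R * R) => (h x.2 * skern (f x.1, g x.1) x.2)%:E)) => //.
  apply/measurable_EFinP; apply: mfM; first exact: measurableT_comp.
  apply: measurable_skern; last exact: measurable_snd.
  by apply: measurable_fun_pair; exact: (measurableT_comp _ measurable_fst).
by move=> x; rewrite lee_fin mulr_ge0 ?skern_ge0.
Qed.

Lemma measurable_schurS d (T : measurableType d) (f g : T -> R) :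
  measurable_fun setT f -> measurable_fun setT g ->
  measurable_fun setT (fun x => schurS (f x) (g x)).
Proof. by move=> mf mg; apply: emeasurable_funD; exact: measurable_schurN_comp. Qed.

Lemma measurable_schurSq d (T : measurableType d) (f g : T -> R) :
  measurable_fun setT f -> measurable_fun setT g ->
  measurable_fun setT (fun x => schurSq (f x) (g x)).
Proof.
move=> mf mg; apply: measurable_fun_ifT => //; first exact: measurable_fun_eqr.
by apply: emeasurable_funM; exact: measurable_schurS.
Qed.

(** The two orders of the poles have the same energy because [mu2] is invariant under exchange of
    the coordinates, and it is finite by the Schur test. *)
Lemma schurSq_energy : (\int[mu2]_q schurSq q.1 q.2 < +oo)%E.
Proof.
pose F1 (q : R * R) : \bar R := (if q.1 == q.2 then 0 else schurN h q * schurN h q)%E.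
pose F (q : R * R) : \bar R := (if q.1 == q.2 then 0 else schurN h (q.1, q.2) * schurN h (q.1, q.2))%E.
have FF1 q : F q = F1 q by rewrite /F /F1; case: q.
have F0 q : (0 <= F q)%E by rewrite /F; case: ifP => // _; rewrite mule_ge0 ?schurN_ge0.
have mF : measurable_fun setT F.
  apply: measurable_fun_ifT => //; first exact: measurable_fun_eqr.
  by apply: emeasurable_funM; exact: measurable_schurN_comp.
have mS : measurable_fun setT (fun q : R * R => F (q.2, q.1)).
  rewrite /F /=; apply: measurable_fun_ifT => //; first exact: measurable_fun_eqr.
  by apply: emeasurable_funM; exact: measurable_schurN_comp.
have FE : (\int[mu2]_q F q < +oo)%E.
  have -> : (\int[mu2]_q F q = \int[mu2]_q F1 q)%E by apply: eq_integral.
  apply: le_lt_trans (schur_test mh h0 hU) _.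
  by apply: lte_mul_pinfty => //; rewrite lee_fin mulr_ge0// exprn_ge0// pi_ge0.
refine (@integral_2D_lty _ _ R mu2 (fun q => schurSq q.1 q.2) F (fun q => F (q.2, q.1)) _ mF mS _ F0 (fun q => F0 _) _ FE _).
- exact: measurable_schurSq.
- by move=> q; exact: schurSq_ge0.
- move=> q; rewrite /schurSq /F/= (eq_sym q.2); case: ifP => _.
    by rewrite mule0 adde0.
  by apply: sqr_adde; exact: schurN_ge0.
- by rewrite mu2_swap.
Qed.

End NNs.

(** * Local integrability of the differentiated kernel *)

Section KernelInt.
Variable R : realType.
Notation mu := (@lebesgue_measure R).
Notation mu2 := (@mu2 R).
Variables g1 g2 : R * R -> R.
Hypothesis mg1 : measurable_fun setT g1.
Hypothesis mg2 : measurable_fun setT g2.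
Hypothesis g1U : forall p, p.2 <= 0 -> g1 p = 0.
Hypothesis g2U : forall p, p.2 <= 0 -> g2 p = 0.
Notation h := (hh g1 g2).
Notation kap := (kap g1 g2).
Notation cau := (cau g1 g2).

Lemma measurable_hh : measurable_fun setT h.
Proof. by rewrite /hh; meas. Qed.

Hypothesis hf : (\int[mu2]_p (h p ^+ 2)%:E < +oo)%E.

Section meas2.
Context d (T : measurableType d) (f : T -> R) (g : T -> R * R).
Hypotheses (mf : measurable_fun setT f) (mg : measurable_fun setT g).
Let m1 := measurableT_comp measurable_fst mg.
Let m2 := measurableT_comp measurable_snd mg.
Let m3 := measurableT_comp mg1 mg.
Let m4 := measurableT_comp mg2 mg.

Lemma measurable_kap : measurable_fun setT (fun x => kap (f x) (g x)).
Proof. by rewrite /kap /rho; meas; solve [exact: m1|exact: m2|exact: m3|exact: m4]. Qed.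

Lemma measurable_cau : measurable_fun setT (fun x => cau (f x) (g x)).
Proof. by rewrite /cau /rho; meas; solve [exact: m1|exact: m2|exact: m3|exact: m4]. Qed.
End meas2.

(* [cauN x] is the Cauchy kernel minus its interpolation at [0] and [1], which decays like [|z|^-3]; [kap s - k0] is its derivative. *)
Definition k0 p := cau 1 p - cau 0 p.
Definition cauN (x : R) p := cau x p - cau 0 p - x * k0 p.
(** The density of the integral of [cauN]. [fine] assigns [0] where the integral is infinite; by
    [psi_good] this concerns only a null set of [s]. *)
Definition psi (s : R) := fine (\int[mu2]_p (kap s p - k0 p)%:E)%E.

Lemma measurable_k0 d (T : measurableType d) (g : T -> R * R) : measurable_fun setT g ->
  measurable_fun setT (fun x => k0 (g x)).
Proof. by move=> mg; rewrite /k0; meas; apply: measurable_cau. Qed.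

Lemma kap_diff_int s t :
  (\int[mu2]_p `|kap s p - kap t p|%:E <= (3 * `|s - t|)%:E * schurS h s t)%E.
Proof.
have mk x y : measurable_fun setT (fun p => h p * skern (x, y) p).
  by apply: mfM; [exact: measurable_hh|exact: measurable_skern].
rewrite /schurS /schurN -ge0_integralD//; last 4 first.
- by move=> p _; rewrite lee_fin mulr_ge0 ?skern_ge0 ?hh_ge0.
- by apply/measurable_EFinP; apply: mk.
- by move=> p _; rewrite lee_fin mulr_ge0 ?skern_ge0 ?hh_ge0.
- by apply/measurable_EFinP; apply: mk.
rewrite -ge0_integralZl_EFin//; last 2 first.
- by move=> p _; apply: adde_ge0; rewrite lee_fin mulr_ge0 ?skern_ge0 ?hh_ge0.
- by apply: emeasurable_funD; apply/measurable_EFinP; apply: mk.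
apply: ge0_le_integral => //.
- by apply/measurable_EFinP; meas; apply: measurable_kap.
- by apply: measurable_funeM; apply: emeasurable_funD; by apply/measurable_EFinP; apply: mk.
- move=> p _; change (`|kap s p - kap t p|%:E <= (3 * `|s - t| * (h p * skern (s, t) p + h p * skern (t, s) p))%:E)%E.
  by rewrite lee_fin -mulrDr kap_diff.
Qed.

Lemma cau_dv_all (p : R * R) (s : R) : dv s (fun x => cau x p) (kap s p).
Proof.
have [p0|p0] := leP p.2 0; last exact: cau_dv.
rewrite (kapU g1U g2U s p0); have -> : (fun x => cau x p) = cst 0.
  by apply/funext => x; rewrite (cauU g1U g2U x p0).
exact: dv_cst.
Qed.

(** [k0] is the mean of [kap r] over [r] in [[0, 1]], because [kap] is the derivative of [cau] and
    [k0] its increment. The antiderivative in [r] is [r * kap s - cau r]. *)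
Lemma kap_k0_le s p :
  (`|kap s p - k0 p|%:E <= \int[mu]_(r in `[0%R, 1%R]) `|kap s p - kap r p|%:E)%E.
Proof.
have dF (r : R) : dv r (fun x => x * kap s p - cau x p) (kap s p - kap r p).
  eapply dv_eq; [deriv; exact: cau_dv_all|]; cbv beta; ring.
have cF : continuous (fun r => kap s p - kap r p).
  by move=> r; cont; exact: kap_cont.
have := @dv_FTC R (fun r => kap s p - kap r p) (fun x => x * kap s p - cau x p) 0 1 ler01 dF cF.
rewrite (_ : 1 * _ - _ - _ = kap s p - k0 p); last by rewrite /k0; ring.
move=> H; rewrite -abse_EFin -H.
under [leRHS]eq_integral do rewrite -abse_EFin.
apply: le_abse_integral => //; apply/measurable_EFinP; apply: measurable_funTS.
exact: continuous_measurable_fun.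
Qed.

(** For [r] in [[0, 1]] the distance [|s - r|] is at most [|a| + |b| + 1]. Averaging [kap_diff_int]
    over [r], in place of fixing one [r], is what makes the square integrability of the Schur
    integral usable. *)
Lemma kap_k0_int (a b s : R) : a <= s <= b ->
  (\int[mu2]_p `|kap s p - k0 p|%:E <=
   (3 * (`|a| + `|b| + 1))%:E * (1 + \int[mu]_r schurSq h s r))%E.
Proof.
move=> /andP[as_ sb]; set M := _ + _ + 1.
have mI : measurable (`[0%R, 1%R]%classic : set R) by exact: measurable_itv.
have M0 : 0 <= 3 * M by rewrite mulr_ge0// !addr_ge0.
have mN : measurable_fun setT (fun r => schurSq h s r).
  by apply: measurable_schurSq; [exact: measurable_hh|exact: hh_ge0|..].
have mk : measurable_fun setT (fun z : R * (R * R) => `|kap s z.2 - kap z.1 z.2|%:E).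
  by apply/measurable_EFinP; meas; apply: measurable_kap.
apply: (@le_trans _ _ (\int[mu2]_p \int[mu]_(r in `[0%R, 1%R]) `|kap s p - kap r p|%:E)%E).
  apply: ge0_le_integral => //.
  - by apply/measurable_EFinP; meas; [apply: measurable_kap|apply: measurable_k0].
  - have mm : measurable_fun setT (fun z : R * (R * R) =>
      if (0 <= z.1) && (z.1 <= 1) then `|kap s z.2 - kap z.1 z.2|%:E else 0%E).
      apply: measurable_fun_ifT => //; apply: measurable_and; exact: measurable_fun_ler.
    have mm0 (z : R * (R * R)) : (0 <= (if ((0 <= z.1) && (z.1 <= 1))%R then `|kap s z.2 - kap z.1 z.2|%:E else 0))%E.
      by case: ifP.
    have := @measurable_fun_fubini_tonelli_G _ _ _ _ _ mu _ mm mm0.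
    apply: eq_measurable_fun => p _; rewrite /fubini_G [RHS]integral_mkcond.
    by apply: eq_integral => r _; rewrite patchE mem_setE in_itv.
  - by move=> p _; exact: kap_k0_le.
rewrite -(@tonelli_in _ _ _ _ R mu mu2 _ mI (fun z => `|kap s z.2 - kap z.1 z.2|%:E))//.
apply: (@le_trans _ _ (\int[mu]_(r in `[0%R, 1%R]) ((3 * M)%:E * (1 + schurSq h s r)))%E).
  apply: ge0_le_integral => //.
  - by move=> r _; apply: integral_ge0.
  - apply: measurable_funTS; exact: (@measurable_fun_fubini_tonelli_F _ _ _ _ _ mu2 _ mk).
  - by apply: measurable_funTS; apply: measurable_funeM; apply: emeasurable_funD.
  move=> r; rewrite /= in_itv/= => /andP[r0 r1]; apply: le_trans (kap_diff_int s r) _.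
  have [->|sr] := eqVneq s r.
    by rewrite subrr normr0 mulr0 mul0e mule_ge0// adde_ge0// schurSq_ge0//; exact: hh_ge0.
  apply: lee_pmul; rewrite ?lee_fin ?schurS_ge0 ?mulr_ge0//; first exact: hh_ge0.
  - rewrite ler_pM2l//; apply: le_trans (ler_normB _ _) _; rewrite (ger0_norm r0) /M lerD//.
    rewrite ler_norml; apply/andP; split.
      by have := ler_norm (- a); rewrite normrN; have := normr_ge0 b; lra.
    by have := ler_norm b; have := normr_ge0 a; lra.
  - by apply: schurS_le => //; exact: hh_ge0.
rewrite ge0_integralZl_EFin//; last 2 first.
- by move=> r _; rewrite adde_ge0// schurSq_ge0//; exact: hh_ge0.
- by apply: measurable_funTS; apply: emeasurable_funD.
apply: lee_pmul => //.
  by apply: integral_ge0 => r _; rewrite adde_ge0// schurSq_ge0//; exact: hh_ge0.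
rewrite ge0_integralD//; last 2 first.
- by move=> r _; rewrite schurSq_ge0//; exact: hh_ge0.
- exact: measurable_funTS.
rewrite integral_cst//= lebesgue_measure_itv/= lte_fin ltr01 oppr0 adde0 mul1e leeD2l//.
apply: ge0_subset_integral => //.
by move=> r _; rewrite schurSq_ge0//; exact: hh_ge0.
Qed.

(** Joint integrability in [(s, p)], the hypothesis under which the integrals over [[a, b]] and over
    the plane are exchanged below. *)
Lemma kap_k0_loc (a b : R) : a <= b ->
  (\int[mu]_(s in `[a, b]) \int[mu2]_p `|kap s p - k0 p|%:E < +oo)%E.
Proof.
move=> ab.
have mI : measurable (`[a, b]%classic : set R) by exact: measurable_itv.
have mN2 : measurable_fun setT (fun q : R * R => schurSq h q.1 q.2).
  by apply: measurable_schurSq; [exact: measurable_hh|exact: hh_ge0|..].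
have N0 s t : (0 <= schurSq h s t)%E by apply: schurSq_ge0; exact: hh_ge0.
have mN : measurable_fun setT (fun s => \int[mu]_r schurSq h s r)%E.
  exact: (@measurable_fun_fubini_tonelli_F _ _ _ _ _ mu _ mN2).
have mk : measurable_fun setT (fun z : R * (R * R) => `|kap z.1 z.2 - k0 z.2|%:E).
  by apply/measurable_EFinP; meas; [apply: measurable_kap|apply: measurable_k0].
have M0 : 0 <= 3 * (`|a| + `|b| + 1) by rewrite mulr_ge0// !addr_ge0.
apply: (@le_lt_trans _ _ (\int[mu]_(s in `[a, b]) ((3 * (`|a| + `|b| + 1))%:E * (1 + \int[mu]_r schurSq h s r)))%E).
  apply: ge0_le_integral => //.
  - by move=> s _; apply: integral_ge0.
  - apply: measurable_funTS; exact: (@measurable_fun_fubini_tonelli_F _ _ _ _ _ mu2 _ mk).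
  - by apply: measurable_funTS; apply: measurable_funeM; apply: emeasurable_funD.
  - by move=> s; rewrite /= in_itv/= => sab; exact: kap_k0_int.
have I0 s : (0 <= \int[mu]_r schurSq h s r)%E by apply: integral_ge0.
rewrite ge0_integralZl_EFin//; last 2 first.
- by move=> r _; rewrite adde_ge0.
- by apply: measurable_funTS; apply: emeasurable_funD.
apply: lte_mul_pinfty => //.
rewrite ge0_integralD//; last exact: measurable_funTS.
rewrite lte_add_pinfty//.
  by rewrite integral_cst//= lebesgue_measure_itv/= lte_fin; case: ifP => // _; rewrite mul1e ltry.
apply: (@le_lt_trans _ _ (\int[mu]_s \int[mu]_r schurSq h s r)%E).
  by apply: ge0_subset_integral.
by rewrite -(@mu2_tonelli1 R (fun q => schurSq h q.1 q.2))//; apply: schurSq_energy => //; [exact: measurable_hh|exact: hh_ge0|exact: hhU].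
Qed.

End KernelInt.

(** * The density and its energy *)

Section Psi.
Variable R : realType.
Notation mu := (@lebesgue_measure R).
Notation mu2 := (@mu2 R).
Variables g1 g2 : R * R -> R.
Hypothesis mg1 : measurable_fun setT g1.
Hypothesis mg2 : measurable_fun setT g2.
Hypothesis g1U : forall p, p.2 <= 0 -> g1 p = 0.
Hypothesis g2U : forall p, p.2 <= 0 -> g2 p = 0.
Notation h := (hh g1 g2).
Notation kap := (kap g1 g2).
Notation cau := (cau g1 g2).
Notation k0 := (k0 g1 g2).
Notation cauN := (cauN g1 g2).
Notation psi := (psi g1 g2).
Hypothesis hf : (\int[mu2]_p (h p ^+ 2)%:E < +oo)%E.

Let Kd (z : R * (R * R)) : R := kap z.1 z.2 - k0 z.2.
Let mKd : measurable_fun setT Kd.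
Proof. by apply: mfB; [apply: measurable_kap|apply: measurable_k0]. Qed.
Let Kdf a b : a <= b -> (\int[mu]_(s in `[a, b]) \int[mu2]_p `|Kd (s, p)|%:E < +oo)%E.
Proof. exact: (kap_k0_loc mg1 mg2 g1U g2U hf). Qed.
Let mI a b : measurable (`[a, b]%classic : set (measurableTypeR R)).
Proof. exact: measurable_itv. Qed.

Lemma KK0 p : cauN 0 p = 0.
Proof. by rewrite /cauN subrr mul0r subr0. Qed.

Lemma KK_FTC a b p : a <= b ->
  (\int[mu]_(s in `[a, b]) (Kd (s, p))%:E = (cauN b p - cauN a p)%:E)%E.
Proof.
move=> ab.
have dF (r : R) : dv r (fun x => cau x p - x * k0 p) (kap r p - k0 p).
  eapply dv_eq; [deriv; exact: (cau_dv_all g1U g2U)|]; cbv beta; ring.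
have cF : continuous (fun r => kap r p - k0 p).
  by move=> r; cont; exact: (kap_cont g1U g2U).
rewrite (@dv_FTC R (fun r => kap r p - k0 p) (fun x => cau x p - x * k0 p) a b ab dF cF).
by congr (_%:E); rewrite /cauN; ring.
Qed.

Lemma KK_diff_integrable a b : a <= b -> mu2.-integrable setT (fun p => (cauN b p - cauN a p)%:E).
Proof.
move=> ab; have := @integrable_fubini_in2 _ _ _ _ R mu mu2 _ (mI a b) Kd mKd (Kdf ab).
by apply: eq_integrable => // p _; rewrite KK_FTC.
Qed.

(** [cauN x] is the integral of [kap s - k0] between [0] and [x], so its integrability follows from
    Fubini's theorem and not from pointwise decay of the kernel; a negative [x] reverses the
    interval. *)
Lemma cauN_integrable x : mu2.-integrable setT (fun p => (cauN x p)%:E).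
Proof.
have [x0|x0] := leP 0 x.
  by have := KK_diff_integrable x0; apply: eq_integrable => // p _; rewrite KK0 subr0.
have := integrableN (KK_diff_integrable (ltW x0)).
by apply: eq_integrable => // p _; rewrite /= KK0 sub0r opprK.
Qed.

Let Phi (s : R) : \bar R := (\int[mu2]_p (Kd (s, p))%:E)%E.

Let iPhi a b : a <= b -> mu.-integrable `[a, b]%classic Phi.
Proof.
by move=> ab; exact: (@integrable_fubini_in _ _ _ _ R mu mu2 _ (mI a b) Kd mKd (Kdf ab)).
Qed.

Lemma psi_ae a b : a <= b -> ae_eq mu `[a, b]%classic Phi (fun s => (psi s)%:E).
Proof.
move=> ab; have := integrable_ae (mI a b) (iPhi ab).
have FF := ae_filter_ringOfSetsType mu.
by apply: filterS => s + sab => /(_ sab) fs; rewrite /psi fineK.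
Qed.

Lemma measurable_psi : measurable_fun setT psi.
Proof.
apply: measurableT_comp; first exact: fine_measurable.
have mKE : measurable_fun setT (EFin \o Kd) by exact/measurable_EFinP.
have mp := @measurable_fun_fubini_tonelli_F _ _ _ _ R mu2 _ (measurable_funepos mKE) (fun=> funepos_ge0 _ _).
have mn := @measurable_fun_fubini_tonelli_F _ _ _ _ R mu2 _ (measurable_funeneg mKE) (fun=> funeneg_ge0 _ _).
have := emeasurable_funB mp mn; apply: eq_measurable_fun => s _.
rewrite /fubini_F [RHS]integralE; congr (_ - _)%E; apply: eq_integral => p _.
  by rewrite !funeposE.
by rewrite !funenegE.
Qed.

Lemma psi_integrable a b : a <= b -> mu.-integrable `[a, b]%classic (EFin \o psi).
Proof.
move=> ab; have [mP fP] := integrableP _ _ _ (iPhi ab).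
have mp : measurable_fun `[a, b]%classic (EFin \o psi).
  by apply/measurable_EFinP; apply: measurable_funTS; exact: measurable_psi.
apply/integrableP; split => //; apply: le_lt_trans fP.
apply: ge0_le_integral => //.
- exact: measurableT_comp.
- exact: measurableT_comp.
- by move=> s _; rewrite /= /psi -/(Phi s); case: (Phi s) => [r| |] //=; rewrite normr0 leey.
Qed.

(** Fubini exchanges the integral over [[a, b]] with the one over the plane, and the inner integral
    is then an increment of [cauN]. This is the integrated form of differentiating under the
    integral. *)
Lemma psi_int a b : a <= b ->
  (\int[mu]_(s in `[a, b]) (psi s)%:E = (\int[mu2]_p cauN b p - \int[mu2]_p cauN a p)%:E)%E.
Proof.
move=> ab; rewrite EFinB /Rintegral !fineK; last 2 first.
- exact: integrable_fin_num (cauN_integrable a).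
- exact: integrable_fin_num (cauN_integrable b).
rewrite -integralB_EFin//; last 2 first.
- exact: cauN_integrable.
- exact: cauN_integrable.
have mp : measurable_fun `[a, b]%classic (fun s => (psi s)%:E).
  by apply/measurable_EFinP; apply: measurable_funTS; exact: measurable_psi.
rewrite -(@ae_eq_integral _ _ _ mu _ _ _ (mI a b) (measurable_int _ (iPhi ab)) mp (psi_ae ab)).
rewrite /Phi (@fubini_in _ _ _ _ R mu mu2 _ (mI a b) Kd mKd (Kdf ab)).
by apply: eq_integral => p _; rewrite KK_FTC.
Qed.

Lemma psi_good : {ae mu, forall s, mu2.-integrable setT (fun p => (kap s p - k0 p)%:E)}.
Proof.
have H n : {ae mu, forall s, `[- n.+1%:R, n.+1%:R]%classic s ->
    mu2.-integrable setT (fun p => (Kd (s, p))%:E)}.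
  have nn : - n.+1%:R <= n.+1%:R :> R by apply: (@le_trans _ _ 0); rewrite ?oppr_le0.
  exact: (@ae_integrable_in _ _ _ _ R mu mu2 _ (mI _ _) Kd mKd (Kdf nn)).
have := ae_foralln H; have FF := ae_filter_ringOfSetsType mu; apply: filterS.
move=> s Hs; have : [set: R] s by [].
by rewrite itvT_bigcup => -[n _ sn]; exact: (Hs n sn).
Qed.

(** [k0] cancels in the difference, which leaves [kap_diff_int]; the [9] is its factor [3]
    squared. *)
Lemma psi_diff_le s t : s != t -> mu2.-integrable setT (fun p => (kap s p - k0 p)%:E) ->
  mu2.-integrable setT (fun p => (kap t p - k0 p)%:E) ->
  (((psi s - psi t) ^+ 2 / (s - t) ^+ 2)%:E <= 9%:E * schurSq h s t)%E.
Proof.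
move=> st is_ it; rewrite /schurSq (negbTE st).
have d0 : 0 < `|s - t| by rewrite normr_gt0 subr_eq0.
have dn : `|s - t| != 0 by rewrite gt_eqF.
have E : (`|psi s - psi t|%:E <= (3 * `|s - t|)%:E * schurS h s t)%E.
  apply: le_trans (kap_diff_int mg1 mg2 g1U g2U s t).
  rewrite -abse_EFin EFinB !fineK; last 2 first.
  - exact: integrable_fin_num it.
  - exact: integrable_fin_num is_.
  rewrite -integralB_EFin//.
  under eq_integral do rewrite -EFinB.
  have -> : (\int[mu2]_p `|kap s p - kap t p|%:E = \int[mu2]_p `|(kap s p - k0 p - (kap t p - k0 p))%:E|)%E.
    by apply: eq_integral => p _; rewrite abse_EFin; congr (`|_|%:E); ring.
  apply: le_abse_integral => //; apply/measurable_EFinP; apply: mfB.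
    by have /measurable_EFinP := measurable_int _ is_.
  by have /measurable_EFinP := measurable_int _ it.
have := schurS_ge0 (hh_ge0 g1 g2) s t; move: E; case: (schurS h s t) => [a| |]//= E a0; last first.
  by rewrite mulyy gt0_muley ?leey// lte_fin.
change (((psi s - psi t) ^+ 2 / (s - t) ^+ 2)%:E <= (9 * (a * a))%:E)%E.
rewrite lee_fin; have {}E : `|psi s - psi t| <= 3 * `|s - t| * a by rewrite -lee_fin.
rewrite -(real_normK (num_real (s - t))) ler_pdivrMr ?exprn_gt0//.
rewrite -(real_normK (num_real (psi s - psi t))).
have := normr_ge0 (psi s - psi t); move: (`|_|) (`|_|) E d0 => x y; nra.
Qed.

Lemma psi_energy :
  (\int[mu]_s \int[mu]_t ((psi s - psi t) ^+ 2 / (s - t) ^+ 2)%:E < +oo)%E.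
Proof.
have mh := measurable_hh mg1 mg2.
have h0 := hh_ge0 g1 g2.
have mpsi2 : measurable_fun setT (fun q : R * R => ((psi q.1 - psi q.2) ^+ 2 / (q.1 - q.2) ^+ 2)%:E).
  apply/measurable_EFinP; meas.
  - exact: (measurableT_comp measurable_psi measurable_fst).
  - exact: (measurableT_comp measurable_psi measurable_snd).
have p0 (q : R * R) : (0 <= ((psi q.1 - psi q.2) ^+ 2 / (q.1 - q.2) ^+ 2)%:E)%E.
  by rewrite lee_fin divr_ge0 ?sqr_ge0.
have mN : measurable_fun setT (fun q : R * R => 9%:E * schurSq h q.1 q.2)%E.
  by apply: measurable_funeM; exact: measurable_schurSq.
have N0 s t : (0 <= 9%:E * schurSq h s t)%E by rewrite mule_ge0// schurSq_ge0.
apply: (@le_lt_trans _ _ (\int[mu]_s \int[mu]_t (9%:E * schurSq h s t))%E); last first.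
  rewrite -(@mu2_tonelli1 R (fun q => 9%:E * schurSq h q.1 q.2)%E)//.
  rewrite ge0_integralZl//; last 2 first.
  - exact: measurable_schurSq.
  - by move=> q _; exact: schurSq_ge0.
  by rewrite lte_mul_pinfty//; apply: schurSq_energy => //; exact: hhU.
(* Both [s] and [t] must avoid the null set where the kernel fails to be integrable, so the
   comparison is almost everywhere in each of the iterated integrals. *)
apply: ae_ge0_le_integral => //.
- by move=> s _; apply: integral_ge0 => t _; exact: (p0 (s, t)).
- exact: (@measurable_fun_fubini_tonelli_F _ _ _ _ _ mu _ mpsi2).
- by move=> s _; apply: integral_ge0 => t _.
- exact: (@measurable_fun_fubini_tonelli_F _ _ _ _ _ mu _ mN).
have := psi_good; have FF := ae_filter_ringOfSetsType mu; apply: filterS.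
move=> s is_ _; apply: ae_ge0_le_integral => //.
- by move=> t _; exact: (p0 (s, t)).
- by apply/measurable_EFinP; meas; exact: measurable_psi.
- by apply: measurable_funeM; apply: measurable_schurSq.
have := psi_good; apply: filterS.
move=> t it _; have [->|st] := eqVneq s t; last exact: psi_diff_le.
by rewrite !subrr expr0n/= mul0r.
Qed.

End Psi.

(** * Functions with a density of finite energy *)

Section Conclude.
Variable R : realType.
Notation mu := (@lebesgue_measure R).

(** Absolute continuity of the integral: the union of the intervals has measure below [dl], so the
    integral of [|w|] over it is below [e]. *)
Lemma integral_abs_cont (f w : R -> R) a b : a <= b ->
  mu.-integrable `[a, b]%classic (EFin \o w) ->
  (forall x y, a <= x -> x <= y -> y <= b ->
     ((f y - f x)%:E = \int[mu]_(s in `[x, y]) (w s)%:E)%E) ->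
  abs_cont_on f a b.
Proof.
move=> ab iw fw e e0.
have mI x y : measurable (`]x, y]%classic : set (measurableTypeR R)) by exact: measurable_itv.
have mJ : measurable (`[a, b]%classic : set (measurableTypeR R)) by exact: measurable_itv.
pose w' := w \_ `[a, b]%classic.
have iw' : mu.-integrable setT (EFin \o w') by rewrite -restrict_EFin; apply/(integrable_mkcond _ mJ).
have [dl [dl0 Hd]] := integral_normr_continuous iw' e0.
exists dl => // n c d cd dc sd.
(* Indices from [n] on get the empty interval []b, b]], so that disjointness holds for the whole
   sequence. *)
pose c' i := if (i < n)%N then c i else b; pose d' i := if (i < n)%N then d i else b.
pose F i : set R := `]c' i, d' i]%classic.
have mF (i : nat) : measurable (F i : set (measurableTypeR R)) by exact: mI.
have dcl k : forall l, (l < k)%N -> (k < n)%N -> d l <= c k.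
  elim: k => // k IH l; rewrite ltnS leq_eqVlt => /orP[/eqP ->|lk] kn; first exact: dc.
  have kn' : (k < n)%N by apply: ltn_trans kn.
  by apply: le_trans (IH _ lk kn') _; apply: le_trans (dc _ kn); have [_ []] := cd _ kn'.
have tF : trivIset setT F.
  apply: ltn_trivIset => k l lk; apply/seteqP; split=> // x [].
  rewrite /F /= !in_itv/= => /andP[h1 h2] /andP[h3 h4].
  suff : d' l <= c' k by move=> dlck; move: (lt_le_trans h3 h2); rewrite ltNge dlck.
  rewrite /d' /c'; case: ifPn => ln; case: ifPn => kn //.
  - exact: dcl.
  - by have [_ []] := cd _ ln.
  - by rewrite (ltn_trans lk kn) in ln.
pose A := \big[setU/set0]_(i < n) F i.
have mA : measurable A by apply: bigsetU_measurable => i _; exact: mF.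
have EA : (mu A = (\sum_(i < n) (d i - c i))%:E)%E.
  rewrite /A measure_bigsetU//= -sumEFin; apply: eq_bigr => i _.
  rewrite /F /c' /d' ltn_ord lebesgue_measure_itv/= lte_fin.
  by case: ltP => // h; have [_ [h' _]] := cd _ (ltn_ord i); have -> : d i = c i; [apply/le_anti; rewrite h h'|rewrite subrr].
have EA' : (mu A < dl%:E)%E by rewrite EA lte_fin.
apply: le_lt_trans (Hd A mA EA').
rewrite -lee_fin -sumEFin /Rintegral fineK; last first.
  apply: integrable_fin_num => //; apply: integrableS (_ : mu.-integrable setT (EFin \o (fun x => `|w' x|))) => //.
  by have := integrable_abse iw'; apply: eq_integrable => // x _ /=.
have mw' : measurable_fun setT (fun x => `|w' x|%:E).
  by have := measurable_int _ (integrable_abse iw'); apply: eq_measurable_fun => x _ /=.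
rewrite /A -(big_mkord xpredT F) ge0_integral_bigsetU//; last 3 first.
- exact: iota_uniq.
- by apply: sub_trivIset tF.
- exact: measurable_funS mw'.
rewrite big_mkord; apply: lee_sum => i _.
have [ac [cdi db]] := cd _ (ltn_ord i).
rewrite -abse_EFin fw//.
have iwi : mu.-integrable `[c i, d i]%classic (EFin \o w).
  apply: integrableS iw => //.
  by move=> x /=; rewrite !in_itv/= => /andP[h1 h2]; rewrite (le_trans ac h1) (le_trans h2 db).
have -> : (\int[mu]_(s in `[c i, d i]) (w s)%:E = \int[mu]_(s in `]c i, d i]) (w s)%:E)%E.
  rewrite integral_itv_obnd_cbnd//; have := measurable_int _ iwi; apply: measurable_funS => //.
  by apply: subset_itvr; rewrite bnd_simp.
rewrite /F /c' /d' ltn_ord.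
apply: le_trans (le_abse_integral _ _ _) _ => //.
  have := measurable_int _ iwi; apply: measurable_funS => //; exact: subset_itv_oc_cc.
rewrite le_eqVlt; apply/orP; left; apply/eqP; apply: eq_integral => x.
rewrite inE /= in_itv/= => /andP[h1 h2]; rewrite /w' patchE mem_set//=.
by rewrite in_itv/= (le_trans ac (ltW h1)) (le_trans h2 db).
Qed.

Lemma continuous_shiftr (h : R) : continuous (fun a : R => a + h).
Proof. by move=> a; apply: cvgD; [exact: cvg_id|exact: cvg_cst]. Qed.

Lemma continuous_shift_fun (f : R -> R) (h : R) : continuous f -> continuous (fun a : R => f (a + h)).
Proof. by move=> cf a; apply: cvg_comp; [exact: continuous_shiftr|exact: cf]. Qed.

Section derive1.
Variable f : R -> R.
Hypothesis cf : continuous f.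

(** Cauchy criterion for the difference quotient, with rational candidates [c] for the slope so that
    unions stay countable. Multiplying through by [h] keeps each condition closed in [a]. *)
Definition dapx (k m : nat) (c : rat) : set R :=
  [set a | forall h : R, `|h| < m.+1%:R^-1 -> `|f (a + h) - f a - ratr c * h| <= `|h| / k.+1%:R].

Lemma dapx_closed k m c : closed (dapx k m c).
Proof.
have -> : dapx k m c = \bigcap_(h in [set h : R | `|h| < m.+1%:R^-1])
    ((fun a => `|f (a + h) - f a - ratr c * h| - `|h| / k.+1%:R) @^-1` [set x | x <= 0]).
  apply/seteqP; split=> [a H h hm|a H h hm]; first by rewrite /preimage /= subr_le0; exact: H.
  by have := H h hm; rewrite /preimage /= subr_le0.
apply: closed_bigI => h _; apply: closed_comp; last exact: closed_le.
suff H : continuous (fun a => `|f (a + h) - f a - ratr c * h| - `|h| / k.+1%:R) by move=> a _; exact: H.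
move=> a; cont; last exact: cf.
exact: continuous_shift_fun.
Qed.

Definition dset : set R := \bigcap_k \bigcup_m \bigcup_(c : rat) dapx k m c.

Lemma measurable_dset : measurable dset.
Proof.
apply: bigcap_measurableType => k _; apply: bigcupT_measurable => m.
apply: bigcupT_measurable_rat => c; apply: closed_measurable; exact: dapx_closed.
Qed.

Lemma dset_derivable a : dset a -> derivable f a 1.
Proof.
move=> H; rewrite /derivable.
apply: cauchy_cvg; apply: cauchy_exP => e e0.
pose k := Num.bound (e^-1).
have ke : k.+1%:R^-1 < e.
  rewrite -[ltRHS]invrK ltf_pV2 ?posrE ?invr_gt0//.
  apply: lt_trans (archi_boundP _) _; first by rewrite invr_ge0 ltW.
  by rewrite ltr_nat.
have [m _ [c _ Hc]] := H k I.
exists (ratr c).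
change (\forall h \near 0^', ball (ratr c : R) e (h^-1 *: ((f \o shift a) (h *: 1) - f a))).
near=> h.
have hn : h != 0 by near: h; exact: nbhs_dnbhs_neq.
have hm : `|h| < m.+1%:R^-1.
  near: h; apply: dnbhs0_lt; by rewrite invr_gt0.
rewrite /ball /= -[X in X < _]distrC.
apply: le_lt_trans ke; have := Hc h hm.
have -> : f (a + h) - f a - ratr c * h = h * (h^-1 * (f (h + a) - f a) - ratr c).
  by rewrite (addrC h a); field.
rewrite normrM ler_pM2l ?normr_gt0//.
have -> : h *: 1 = h by rewrite /GRing.scale /= mulr1.
by [].
Unshelve. all: by end_near. Qed.

Lemma derivable_dset a : derivable f a 1 -> dset a.
Proof.
move=> /cvg_ex[l Hl] k _.
pose e : R := k.+1%:R^-1 / 2.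
have e0 : 0 < e by rewrite /e divr_gt0 ?invr_gt0.
have H1 : \forall h \near 0^', `|l - h^-1 *: ((f \o shift a) (h *: 1) - f a)| < e.
  exact: cvgr_dist_lt Hl _ e0.
have [d /= d0 Hd] := (nbhs_ballP (0 : R) _).1 H1.
have [c cl] : exists c : rat, `|l - ratr c| < e.
  have [c] : exists c : rat, ratr c \in `](l - e), (l + e)[.
    apply: rat_in_itvoo; lra.
  by rewrite in_itv/= => /andP[h1 h2]; exists c; rewrite ltr_norml; apply/andP; split; lra.
pose m := Num.bound (d^-1).
have md : m.+1%:R^-1 < d.
  rewrite -[ltRHS]invrK ltf_pV2 ?posrE ?invr_gt0//.
  apply: lt_trans (archi_boundP _) _; first by rewrite invr_ge0 ltW.
  by rewrite ltr_nat.
exists m => //; exists c => // h hm.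
have [->|hn] := eqVneq h 0; first by rewrite addr0 subrr mulr0 subrr normr0 mul0r.
have := Hd h; rewrite /ball /= sub0r normrN => /(_ (lt_trans hm md) hn) H2.
have -> : f (a + h) - f a - ratr c * h = h * ((l - ratr c) - (l - h^-1 * (f (h + a) - f a))).
  by rewrite (addrC h a); field.
rewrite normrM ler_pM2l ?normr_gt0//.
apply: le_trans (ler_normB _ _) _.
have -> : k.+1%:R^-1 = e + e :> R by rewrite /e -splitr.
move: H2; rewrite (_ : h *: 1 = h); last by rewrite /GRing.scale /= mulr1.
by move=> H2; apply: lerD; apply: ltW.
Qed.

(** On the set of differentiability [derive1 f] is a limit of continuous difference quotients;
    elsewhere it is constant. *)
Lemma measurable_derive1 : measurable_fun setT (derive1 f).
Proof.
have mE := measurable_dset.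
rewrite -(setUv dset); apply/measurable_funU; [exact: mE|exact: measurableC|split].
  pose q (n : nat) (a : R) := n.+1%:R * (f (a + n.+1%:R^-1) - f a).
  have mq n : measurable_fun dset (q n).
    apply: measurable_funTS; apply: continuous_measurable_fun => a; rewrite /q; cont; last exact: cf.
    exact: continuous_shift_fun.
    apply: (measurable_fun_cvg mq) => a /dset_derivable da.
  have : h^-1 *: ((f \o shift a) (h *: 1) - f a) @[h --> 0^'] --> derive1 f a.
    by rewrite derive1E.
  move=> H; apply/cvgrPdist_lt => e e0.
  have H1 : \forall h \near 0^', `|derive1 f a - h^-1 * (f (a + h) - f a)| < e.
    have H0 : \forall h \near 0^', `|derive1 f a - h^-1 *: ((f \o shift a) (h *: 1) - f a)| < e.
      exact: cvgr_dist_lt H _ e0.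
    move: H0; apply: filterS => h.
    by rewrite /= (_ : h *: 1 = h) ?(addrC h)// /GRing.scale /= mulr1.
  have [d /= d0 Hd] := (nbhs_ballP (0 : R) _).1 H1.
  exists (Num.bound (d^-1)) => // n /= dn.
  have nd : n.+1%:R^-1 < d.
    rewrite -[ltRHS]invrK ltf_pV2 ?posrE ?invr_gt0//.
    apply: lt_trans (archi_boundP _) _; first by rewrite invr_ge0 ltW.
    by rewrite ltr_nat ltnS.
  have := Hd (n.+1%:R^-1); rewrite /ball /= sub0r normrN ger0_norm ?invr_ge0// => /(_ nd).
  by rewrite invr_neq0// => /(_ isT); rewrite invrK.
(* Without a limit, [lim] falls back to [get] of the empty predicate, the same value at every such
   point. *)
have nE : forall a, (~` dset) a -> derive1 f a = get (fun _ : R => False).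
  move=> a na; rewrite derive1E /derive /lim /lim_in; congr get.
  apply/funext => l; apply/propext; split => // Hl; apply: na; apply: derivable_dset.
  by apply/cvg_ex; exists l.
apply: (eq_measurable_fun (cst (get (fun _ : R => False)))); last exact: measurable_cst.
by move=> a; rewrite inE => /nE ->.
Qed.

End derive1.

Section final.
Variables (f w : R -> R).
Hypothesis cf : continuous f.
Hypothesis mw : measurable_fun setT w.
Hypothesis iw : forall a b, a <= b -> mu.-integrable `[a, b]%classic (EFin \o w).
Hypothesis fw : forall a b, a <= b -> ((f b - f a)%:E = \int[mu]_(s in `[a, b]) (w s)%:E)%E.
Hypothesis wE : (\int[mu]_s \int[mu]_t ((w s - w t) ^+ 2 / (s - t) ^+ 2)%:E < +oo)%E.

Lemma compact_sub_itv (K : set R) : compact K -> exists2 n : nat, True & K `<=` `[- n.+1%:R, n.+1%:R]%classic.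
Proof.
move=> /compact_bounded[M [Mr HM]]; exists (Num.bound (M + 1)) => // x Kx.
have := HM (M + 1) ltac:(by rewrite ltrDl) x Kx; rewrite /= in_itv/= -ler_norml => xM.
have M0 : 0 <= M + 1 by apply: le_trans xM.
apply: le_trans xM _; apply: le_trans (ltW (archi_boundP M0)) _.
by rewrite ler_nat.
Qed.

Lemma w_locally_integrable : locally_integrable setT w.
Proof.
split => // [|K _ cK]; first exact: openT.
have [n _ Kn] := compact_sub_itv cK.
have nn : - n.+1%:R <= n.+1%:R :> R by apply: (@le_trans _ _ 0); rewrite ?oppr_le0.
have [mK fK] := integrableP _ _ _ (iw nn).
apply: le_lt_trans fK; apply: ge0_subset_integral => //.
- by apply: closed_measurable; apply: compact_closed => //; exact: Rhausdorff.
- by apply/measurable_EFinP; apply: measurable_funTS; exact: measurableT_comp.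
Qed.

(** Lebesgue differentiation on the half-lines starting at [-(n+1)], which exhaust the line. *)
Lemma derive1_ae : {ae mu, forall x, derive1 f x = w x}.
Proof.
have H n : {ae mu, forall x, - n.+1%:R < x -> derive1 f x = w x}.
  set a : R := - n.+1%:R.
  have ia y : mu.-integrable [set` Interval (BLeft a) (BRight y)] (EFin \o w).
    have [ay|ya] := leP a y; first exact: iw.
    rewrite (_ : [set` _] = set0) ?integrable_set0//.
    by apply/seteqP; split=> // x /=; rewrite in_itv/= => /andP[h1 h2]; have := lt_le_trans ya (le_trans h1 h2); rewrite ltxx.
  have := @FTC1 R w (BLeft a) ia w_locally_integrable.
  have FF := ae_filter_ringOfSetsType mu; apply: filterS => x Hx ax.
  have [] := Hx ltac:(by rewrite lte_fin).
  set F := (fun y : R => _) => dF <-.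
  apply/esym; apply: (derive1_near_shift (c := f a) dF); near=> y.
  have ay : a <= y by apply: ltW; near: y; exact: near_gtr.
  by rewrite /F /Rintegral -fw//= subrK.
have := ae_foralln H; have FF := ae_filter_ringOfSetsType mu; apply: filterS => x Hx.
apply: (Hx (Num.bound `|x|)); rewrite ltrNl.
apply: le_lt_trans (_ : `|x| < _); first by rewrite -normrN ler_norm.
by apply: lt_trans (archi_boundP _) _; rewrite ?ltr_nat.
Unshelve. all: by end_near. Qed.

(** The conditions on [derive1 f] in [H32] concern integrals and measurability, so up to
    [measurable_derive1] it may be replaced by [w], to which it is equal almost everywhere; in the
    double integral this is done in one variable after the other. *)
Lemma H32_of_integral : H32 f.
Proof.
have FF := ae_filter_ringOfSetsType mu.
have md := measurable_derive1 cf.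
have nonneg (g : R -> R) s t : (0 <= ((g s - g t) ^+ 2 / (s - t) ^+ 2)%:E)%E.
  by rewrite lee_fin divr_ge0 ?sqr_ge0.
have mm (g : R -> R) : measurable_fun setT g ->
    measurable_fun setT (fun q : R * R => ((g q.1 - g q.2) ^+ 2 / (q.1 - q.2) ^+ 2)%:E).
  move=> mg; apply/measurable_EFinP; meas.
  - exact: (measurableT_comp mg measurable_fst).
  - exact: (measurableT_comp mg measurable_snd).
split; [|split].
- move=> a b ab; apply: (integral_abs_cont ab (iw ab)) => x y _ xy _; exact: fw.
- split => // [|K _ cK]; first exact: openT.
  have mK : measurable K by apply: closed_measurable; apply: compact_closed => //; exact: Rhausdorff.
  have [_ _ /(_ K (@subsetT _ _) cK)] := w_locally_integrable.
  apply: le_lt_trans; rewrite le_eqVlt; apply/orP; left; apply/eqP.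
  apply: ae_eq_integral => //.
  + by apply/measurable_EFinP; apply: measurable_funTS; exact: measurableT_comp.
  + by apply/measurable_EFinP; apply: measurable_funTS; exact: measurableT_comp.
  + by have := derive1_ae; apply: filterS => x -> _.
- apply: lte_mul_pinfty; [by rewrite lee_fin divr_ge0// mulr_ge0// sqr_ge0|by []|].
  apply: le_lt_trans wE.
  apply: ae_ge0_le_integral => //.
  + by move=> s _; apply: integral_ge0 => t _.
  + exact: (@measurable_fun_fubini_tonelli_F _ _ _ _ _ mu _ (mm _ md)).
  + by move=> s _; apply: integral_ge0 => t _.
  + exact: (@measurable_fun_fubini_tonelli_F _ _ _ _ _ mu _ (mm _ mw)).
  have := derive1_ae; apply: filterS => s -> _.
  apply: ae_ge0_le_integral => //.
  + by move=> t _; rewrite lee_fin divr_ge0 ?sqr_ge0.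
  + by apply/measurable_EFinP; meas.
  + by apply/measurable_EFinP; meas.
  by have := derive1_ae; apply: filterS => t -> _.
Qed.

End final.
End Conclude.

(** * Cut-offs and differentiation along the axes *)

Section Tools.
Variable R : realType.
Notation mu := (@lebesgue_measure R).
Notation mu2 := (@mu2 R).

Lemma dxE (phi : R * R -> R) (p : R * R) (d : R) : dv p.1 (fun x => phi (x, p.2)) d -> dx phi p = d.
Proof.
move=> [_ <-]; rewrite /dx /derive.
have -> : (fun h : R => h^-1 *: ((phi \o shift p) (h *: ((1, 0) : R * R)) - phi p)) =
  (fun h : R => h^-1 *: (((fun x : R => phi (x, p.2)) \o shift p.1) (h *: 1) - (fun x : R => phi (x, p.2)) p.1)).
  apply/funext => h /=; case: p => p1 p2 /=.
  congr (h^-1 *: (phi _ - _)).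
  by rewrite [LHS]surjective_pairing /=; congr pair; rewrite scaler0 add0r.
by [].
Qed.

Lemma dyE (phi : R * R -> R) (p : R * R) (d : R) : dv p.2 (fun y => phi (p.1, y)) d -> dy phi p = d.
Proof.
move=> [_ <-]; rewrite /dy /derive.
have -> : (fun h : R => h^-1 *: ((phi \o shift p) (h *: ((0, 1) : R * R)) - phi p)) =
  (fun h : R => h^-1 *: (((fun x : R => phi (p.1, x)) \o shift p.2) (h *: 1) - (fun x : R => phi (p.1, x)) p.2)).
  apply/funext => h /=; case: p => p1 p2 /=.
  congr (h^-1 *: (phi _ - _)).
  by rewrite [LHS]surjective_pairing /=; congr pair; rewrite scaler0 add0r.
by [].
Qed.

Lemma Rdominated d (T : measurableType d) (m : {measure set T -> \bar R})
    (f_ : nat -> T -> R) (f g : T -> R) :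
  (forall n, measurable_fun setT (f_ n)) ->
  (forall x, f_ n x @[n --> \oo] --> f x) ->
  m.-integrable setT (EFin \o g) -> (forall n x, `|f_ n x| <= g x) ->
  m.-integrable setT (EFin \o f) /\
  (\int[m]_x f_ n x)%R @[n --> \oo] --> (\int[m]_x f x)%R.
Proof.
move=> mf_ cvf ig fg.
have mf : measurable_fun setT f by apply: (measurable_fun_cvg mf_) => x _; exact: cvf.
have [] := @dominated_convergence _ _ _ m _ measurableT (fun n x => (f_ n x)%:E) (EFin \o f) (EFin \o g).
- by move=> n; exact/measurable_EFinP.
- exact/measurable_EFinP.
- by apply: aeW => x _; apply: cvg_EFin; [exact: nearW|exact: cvf].
- exact: ig.
- by apply: aeW => x n _; rewrite /= lee_fin.
move=> if_ _ H; split => //.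
by apply: fine_cvg; rewrite /Rintegral fineK; [exact: H|exact: integrable_fin_num].
Qed.

Lemma dv_sstep (f : R -> R) (x d : R) : dv x f d -> dv x (fun y => sstep (f y)) (sstep' (f x) * d).
Proof.
move=> df; have H := @is_derive1_comp _ (@sstep R) f x _ _ (sstep_is_derive (f x)) df.
exact: (dv_eq H).
Qed.

Lemma ctcomp (T : topologicalType) (g : R -> R) (f : T -> R) (x : T) : continuous g -> continuous_at x f ->
  continuous_at x (fun y => g (f y)).
Proof. by move=> cg cf; apply: cvg_comp cf _; exact: cg. Qed.

Lemma sstep_continuous : continuous (@sstep R).
Proof.
move=> x; apply: differentiable_continuous; apply/derivable1_diffP.
by have [] := sstep_is_derive x.
Qed.

(** [aN N] cuts off at infinity: [1] on [[-N, N]], [0] beyond [2 * N]. [sd d] cuts off near the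
    axis: [0] below [d], [1] above [2 * d]. *)
Definition aN (N t : R) : R := sstep (2 + t / N) * sstep (2 - t / N).
Definition aN' (N t : R) : R :=
  (sstep' (2 + t / N) * sstep (2 - t / N) - sstep (2 + t / N) * sstep' (2 - t / N)) / N.
Definition sd (d y : R) : R := sstep (y / d - 1).
Definition sd' (d y : R) : R := sstep' (y / d - 1) / d.

Lemma aN_dv N t : dv t (aN N) (aN' N t).
Proof.
rewrite /aN; eapply dv_eq.
  by deriv; apply: dv_sstep; deriv.
by cbv beta; rewrite /aN'; ring.
Qed.

Lemma sd_dv d y : dv y (sd d) (sd' d y).
Proof.
rewrite /sd; eapply dv_eq.
  by apply: dv_sstep; deriv.
by cbv beta; rewrite /sd'; ring.
Qed.

Lemma aN_ge0 N t : 0 <= aN N t.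
Proof. by rewrite mulr_ge0// sstep_ge0. Qed.

Lemma aN_le1 N t : aN N t <= 1.
Proof. by rewrite mulr_ile1// ?sstep_ge0// sstep_le1. Qed.

Lemma sd_ge0 d t : 0 <= sd d t. Proof. exact: sstep_ge0. Qed.
Lemma sd_le1 d t : sd d t <= 1. Proof. exact: sstep_le1. Qed.

Lemma aN1 N t : 0 < N -> `|t| <= N -> aN N t = 1.
Proof.
move=> N0; rewrite ler_norml => /andP[h1 h2]; rewrite /aN !sstep1 ?mulr1//.
- have : t / N <= 1 by rewrite ler_pdivrMr ?mul1r.
  lra.
- have : -1 <= t / N by rewrite ler_pdivlMr ?mulN1r.
  lra.
Qed.

Lemma dv_continuous (f f' : R -> R) : (forall x, dv x f (f' x)) -> continuous f.
Proof.
move=> df x; apply: differentiable_continuous; apply/derivable1_diffP.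
by have [] := df x.
Qed.

Lemma aN_outer N t : 0 < N -> (2 * N <= `|t| -> aN N t = 0) /\
  ((`|t| < N) || (2 * N < `|t|) -> aN' N t = 0).
Proof.
move=> N0; have ts : `|t| = `|t / N| * N.
  by rewrite normrM normfV (gtr0_norm N0) divfK// gt_eqF.
have -> : (2 * N <= `|t|) = (2 <= `|t / N|) by rewrite ts ler_pM2r.
have -> : (`|t| < N) = (`|t / N| < 1) by rewrite ts gtr_pMl.
have -> : (2 * N < `|t|) = (2 < `|t / N|) by rewrite ts ltr_pM2r.
rewrite /aN /aN'; set s := t / N; have [s0|s0] := leP 0 s; [rewrite ger0_norm//|rewrite ltr0_norm//].
- split=> [h|/orP[h|h]].
  + by rewrite (@sstep0 _ (2 - s)) ?mulr0//; lra.
  + rewrite (@sstep'_eq0 _ (2 + s)) ?(@sstep'_eq0 _ (2 - s)) ?mulr0 ?mul0r ?subr0 ?mul0r//; apply/orP; right; lra.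
  + rewrite (@sstep'_eq0 _ (2 - s)) ?(@sstep0 _ (2 - s)) ?mulr0 ?subr0 ?mul0r//; [lra|apply/orP; left; lra].
- split=> [h|/orP[h|h]].
  + by rewrite (@sstep0 _ (2 + s)) ?mul0r//; lra.
  + rewrite (@sstep'_eq0 _ (2 + s)) ?(@sstep'_eq0 _ (2 - s)) ?mulr0 ?mul0r ?subr0 ?mul0r//; apply/orP; right; lra.
  + rewrite (@sstep'_eq0 _ (2 + s)) ?(@sstep0 _ (2 + s)) ?mul0r ?subr0 ?mul0r//; [lra|apply/orP; left; lra].
Qed.

Lemma cutoff_bound : exists2 K, 0 <= K & forall N t : R, 0 < N ->
  `|aN' N t| <= K / N /\ `|sd' N t| <= K / N.
Proof.
have [K K0 HK] : exists2 K : R, 0 <= K & forall t : R, `|sstep' t| <= K := @sstep'_bounded R.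
exists (2 * K); first by rewrite mulr_ge0.
move=> N t N0; split.
  rewrite /aN' normrM normfV (gtr0_norm N0) ler_pM2r ?invr_gt0//.
  have A (x : R) : `|sstep x| <= 1 by rewrite ger0_norm ?sstep_ge0// sstep_le1.
  apply: le_trans (ler_normB _ _) _; apply: (@le_trans _ _ (K * 1 + 1 * K)); last lra.
  by apply: lerD; rewrite normrM; apply: ler_pM.
rewrite /sd' normrM normfV (gtr0_norm N0) ler_pM2r ?invr_gt0//.
by apply: le_trans (HK _) _; lra.
Qed.

Lemma sd_supp d y : 0 < d -> (y <= d -> sd d y = 0) /\ (2 * d <= y -> sd d y = 1) /\
  ((y < d) || (2 * d < y) -> sd' d y = 0).
Proof.
move=> d0; split=> [h|]; first by rewrite /sd sstep0// subr_le0 ler_pdivrMr// mul1r.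
split=> [h|/orP[h|h]].
- by rewrite /sd sstep1// lerBrDr ler_pdivlMr//; lra.
- by rewrite /sd' sstep'_eq0 ?mul0r// subr_lt0 ltr_pdivrMr// mul1r h.
- by rewrite /sd' sstep'_eq0 ?mul0r// ltrBrDr ltr_pdivlMr//; apply/orP; right; lra.
Qed.

Lemma aN'_continuous N : continuous (aN' N).
Proof.
by move=> t; rewrite /aN'; cont; apply: ctcomp; solve [exact: sstep'_continuous|exact: sstep_continuous|cont].
Qed.

Lemma sd'_continuous d : continuous (sd' d).
Proof. by move=> t; rewrite /sd'; cont; apply: ctcomp; solve [exact: sstep'_continuous|cont]. Qed.

End Tools.

(** * The Cauchy-Pompeiu representation *)

Section BoxInt.
Variable R : realType.
Notation mu := (@lebesgue_measure R).
Notation mu2 := (@mu2 R).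

Definition bx (N : R) (p : R * R) : R := if (`|p.1| <= N) && (`|p.2| <= N) then 1 else 0.

Lemma bx_ge0 N p : 0 <= bx N p. Proof. by rewrite /bx; case: ifP. Qed.

Lemma measurable_bx N : measurable_fun setT (bx N).
Proof.
rewrite /bx; apply: measurable_fun_ifT => //; apply: measurable_and; apply: measurable_fun_ler => //.
- exact: mfabs measurable_fst.
- exact: mfabs measurable_snd.
Qed.

Lemma strip_integral (c N a b : R) : 0 <= c -> 0 <= N -> a <= b ->
  (\int[mu2]_p (c * (if (`|p.1| <= N) && ((a <= p.2) && (p.2 <= b)) then 1 else 0))%:E =
   (c * (2 * N) * (b - a))%:E)%E.
Proof.
move=> c0 N0 ab.
have mf : measurable_fun setT (fun p : R * R => (c * (if (`|p.1| <= N) && ((a <= p.2) && (p.2 <= b)) then 1 else 0))%:E).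
  apply/measurable_EFinP; apply: mfM; first exact: measurable_cst.
  apply: measurable_fun_ifT => //; apply: measurable_and.
    by apply: measurable_fun_ler => //; exact: mfabs measurable_fst.
  by apply: measurable_and; apply: measurable_fun_ler.
rewrite mu2_tonelli1//; last by move=> p; rewrite lee_fin mulr_ge0//; case: ifP.
have len x y : x <= y -> mu (`[x, y]%classic) = (y - x)%:E :> \bar R.
  move=> xy; rewrite lebesgue_measure_itv/= lte_fin; case: ltP => // yx.
  by have -> : y = x; [apply/le_anti; rewrite xy yx|rewrite subrr].
have ind x y t : (if (x <= t) && (t <= y) then 1 else 0 : R) = \1_(`[x, y]%classic) t.
  by rewrite indicE mem_setE in_itv /=; case: ifP.
have inn x : (\int[mu]_y (c * (if (`|x| <= N) && ((a <= y) && (y <= b)) then 1 else 0))%:E =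
   ((c * (b - a)) * (if (- N <= x) && (x <= N) then 1 else 0))%:E)%E.
  rewrite ler_norml; case: ifP => _ /=; last by under eq_integral do rewrite mulr0; rewrite integral0 mulr0.
  under eq_integral do rewrite ind EFinM.
  rewrite ge0_integralZl_EFin//; last by apply/measurable_EFinP.
  by rewrite integral_indic// setIT [X in (_ * X)%E](len _ _ ab) mulr1 EFinM.
under eq_integral do rewrite inn ind EFinM.
have ba : 0 <= c * (b - a) by rewrite mulr_ge0// subr_ge0.
rewrite ge0_integralZl_EFin//; last by apply/measurable_EFinP.
rewrite integral_indic// setIT [X in (_ * X)%E](len (- N) N) ?gerNr ?(le_trans _ N0) ?oppr_le0//.
by rewrite -EFinM; congr (_%:E); ring.
Qed.

Lemma bx_integrable N : mu2.-integrable setT (EFin \o bx N).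
Proof.
apply/integrableP; split; first by apply/measurable_EFinP; exact: measurable_bx.
have [N0|N0] := leP 0 N; last first.
  under eq_integral => p _ do rewrite /= /bx leNgt (lt_le_trans N0 (normr_ge0 _)) /= normr0.
  by rewrite integral0.
have -> : (\int[mu2]_p `|(EFin \o bx N) p| = \int[mu2]_p (1 * (if (`|p.1| <= N) && ((- N <= p.2) && (p.2 <= N)) then 1 else 0))%:E)%E.
  by apply: eq_integral => p _; rewrite /= ger0_norm ?bx_ge0// mul1r /bx (ler_norml p.2).
by rewrite strip_integral ?ltry// ?gerNr ?(le_trans _ N0) ?oppr_le0.
Qed.

Lemma bounded_integrable (F : R * R -> R) (C N : R) : measurable_fun setT F ->
  (forall p, `|F p| <= C * bx N p) -> mu2.-integrable setT (EFin \o F).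
Proof.
move=> mF FC; apply: (@le_integrable _ _ _ mu2 _ measurableT _ (fun p => C%:E * (EFin \o bx N) p)%E).
- exact/measurable_EFinP.
- move=> p _ /=; rewrite lee_fin; apply: le_trans (FC p) _; exact: ler_norm.
- by apply: integrableZl => //; exact: bx_integrable.
Qed.

Lemma continuous_bx_bound (F : R * R -> R) (N : R) : continuous F ->
  (forall p, N < `|p.1| \/ N < `|p.2| -> F p = 0) ->
  exists2 C, 0 <= C & forall p, `|F p| <= C * bx N p.
Proof.
move=> cF F0.
have cK : compact (`[- N, N]%classic `*` `[- N, N]%classic : set (R * R)).
  by apply: compact_setX; exact: segment_compact.
have := compact_bounded (continuous_compact (continuous_subspaceT cF) cK).
move=> [M [_ HM]]; exists (`|M| + 1); first by rewrite addr_ge0.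
move=> p; rewrite /bx; case: ifPn => [/andP[p1 p2]|]; last first.
  by rewrite negb_and -!ltNge => /orP h; rewrite F0// normr0 mulr0.
rewrite mulr1; apply: (HM (`|M| + 1)); first by rewrite (le_lt_trans (ler_norm M))// ltrDl.
by exists p => //; split; rewrite /= in_itv/= -ler_norml.
Qed.

Lemma continuous_bx_integrable (F : R * R -> R) (N : R) : continuous F ->
  (forall p, N < `|p.1| \/ N < `|p.2| -> F p = 0) -> mu2.-integrable setT (EFin \o F).
Proof.
move=> cF F0; have [C _ H] := continuous_bx_bound cF F0.
by apply: bounded_integrable H; exact: continuous_measurable_fun2.
Qed.

(** Tube lemma: continuity at the points of the axis becomes uniform over the compact interval
    [[-N, N]]. *)
Lemma strip_vanish (W : R * R -> R) (N : R) : continuous W -> (forall x, W (x, 0) = 0) ->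
  forall e, 0 < e -> \forall y \near 0, forall x, `|x| <= N -> `|W (x, y)| <= e.
Proof.
move=> cW W0 e e0.
have cK := @segment_compact R (- N) N.
have /(_ R (nbhs (0 : R)) (fun y x => `|W (x, y)| <= e) _) := (compact_near_coveringP _).1 cK.
move=> H; have H2 : \forall y \near (0 : R), `[- N, N]%classic `<=` (fun x => `|W (x, y)| <= e).
  apply: H => x _.
  have /cvgrPdist_le /(_ e e0) := cW (x, 0).
  by rewrite W0; apply: filterS => p; rewrite sub0r normrN; case: p.
by apply: filterS H2 => y Hy x xN; apply: Hy; rewrite /= in_itv/= -ler_norml.
Qed.

End BoxInt.

Lemma smooth2_sub (R : realType) f g : smooth2 f -> smooth2 g -> @smooth2 R (fun p => f p - g p).
Proof.
move=> sf sg; have -> : (fun p => f p - g p) = (fun p => f p + (-1) * g p).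
  by apply/funext => p; rewrite mulN1r.
by apply: smooth2_add => //; apply: smooth2_mul => //; exact: smooth2_cst.
Qed.

Lemma smooth2_opp (R : realType) g : smooth2 g -> @smooth2 R (fun p => - g p).
Proof.
move=> sg; have -> : (fun p => - g p) = (fun p => (-1) * g p) by apply/funext => p; rewrite mulN1r.
by apply: smooth2_mul => //; exact: smooth2_cst.
Qed.

Ltac smo := lazymatch goal with
  | |- smooth2 (fun _ => ?c) => exact: smooth2_cst
  | |- smooth2 (fun x => @GRing.add _ (@?f x) (@GRing.opp _ (@?g x))) => apply: (@smooth2_sub _ f g); smo
  | |- smooth2 (fun x => @GRing.add _ (@?f x) (@?g x)) => apply: (@smooth2_add _ f g); smo
  | |- smooth2 (fun x => @GRing.mul _ (@?f x) (@?g x)) => apply: (@smooth2_mul _ f g); smo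
  | |- smooth2 (fun x => @GRing.opp _ (@?f x)) => apply: (@smooth2_opp _ f); smo
  | |- smooth2 (fun x => @GRing.inv _ (@?f x)) => apply: (@smooth2_inv _ f); [smo|idtac]
  | |- smooth2 (fun x => @GRing.exp _ (@?f x) 2) => apply: (@smooth2_mul _ f f); smo
  | |- smooth2 (fun x => sstep (@?f x)) => apply: (@smooth2_sstep _ f); smo
  | |- smooth2 (fun x => fst x) => exact: smooth2_fst
  | |- smooth2 (fun x => snd x) => exact: smooth2_snd
  | |- _ => idtac
  end.

(** Linear bookkeeping for a complex kernel [al + i be]. Test functions are real, so it enters
    through two of them; the first dbar equation for [al] minus the second for [be] yields the real
    part of [g * (al + i be)]. *)
Lemma I_comb d (T : measurableType d) (R : realType) (m : {measure set T -> \bar R})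
  (f1 f2 a1 a2 b1 b2 c1 c2 : T -> R) :
  m.-integrable setT (EFin \o f1) -> m.-integrable setT (EFin \o f2) ->
  m.-integrable setT (EFin \o a1) -> m.-integrable setT (EFin \o a2) ->
  m.-integrable setT (EFin \o b1) -> m.-integrable setT (EFin \o b2) ->
  m.-integrable setT (EFin \o c1) -> m.-integrable setT (EFin \o c2) ->
  (\int[m]_x f1 x = - \int[m]_x ((a1 x - a2 x) / 2))%R ->
  (\int[m]_x f2 x = - \int[m]_x ((b1 x + b2 x) / 2))%R ->
  (forall x, a1 x - a2 x - (b1 x + b2 x) = c1 x - c2 x) ->
  (\int[m]_x (f1 x - f2 x) = - (\int[m]_x c1 x - \int[m]_x c2 x) / 2)%R.
Proof.
move=> if1 if2 ia1 ia2 ib1 ib2 ic1 ic2 h1 h2 E.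
have ia : m.-integrable setT (EFin \o (fun x => a1 x - a2 x)).
  by have := integrableB measurableT ia1 ia2; apply: eq_integrable.
have ib : m.-integrable setT (EFin \o (fun x => b1 x + b2 x)).
  by have := integrableD measurableT ib1 ib2; apply: eq_integrable.
rewrite RintegralB// h1 h2 -RintegralB//.
rewrite (_ : (\int[m]_x (c1 x - c2 x))%R = (\int[m]_x ((a1 x - a2 x) - (b1 x + b2 x)))%R); last first.
  by apply: eq_Rintegral => x _; rewrite E.
rewrite RintegralB//.
have half (w : T -> R) : m.-integrable setT (EFin \o w) -> (\int[m]_x (w x / 2) = (\int[m]_x w x) / 2)%R.
  by move=> iw; rewrite mulrC -RintegralZl//; apply: eq_Rintegral => x _; rewrite mulrC.
by rewrite (half _ ia) (half _ ib); lra.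
Qed.

(** * The dbar equation tested against the regularized kernel *)

Section Repr.
Variable R : realType.
Notation mu := (@lebesgue_measure R).
Notation mu2 := (@mu2 R).
Variables u v g1 g2 : R * R -> R.
Hypotheses (cu : continuous u) (cv : continuous v).
Hypothesis v0 : forall x, v (x, 0) = 0.
Hypotheses (mg1 : measurable_fun setT g1) (mg2 : measurable_fun setT g2).
Hypothesis g1U : forall p, p.2 <= 0 -> g1 p = 0.
Hypothesis g2U : forall p, p.2 <= 0 -> g2 p = 0.
Notation h := (hh g1 g2).
Notation cau := (cau g1 g2).
Hypothesis hf : (\int[mu2]_p (h p ^+ 2)%:E < +oo)%E.
Notation I F := (Rintegral mu2 setT F).
Hypothesis Hd1 : forall phi, test_fun_UHP phi ->
  I (fun p => g1 p * phi p) = - I (fun p => (u p * dx phi p - v p * dy phi p) / 2).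
Hypothesis Hd2 : forall phi, test_fun_UHP phi ->
  I (fun p => g2 p * phi p) = - I (fun p => (v p * dx phi p + u p * dy phi p) / 2).

Lemma h2_integrable : mu2.-integrable setT (EFin \o (fun p => h p ^+ 2)).
Proof.
apply/integrableP; split.
  by apply/measurable_EFinP; apply: mfX; exact: measurable_hh.
by under eq_integral do rewrite /= ger0_norm ?sqr_ge0//.
Qed.

Lemma dom_integrable (C N : R) : mu2.-integrable setT (EFin \o (fun p => C * (bx N p + h p ^+ 2))).
Proof.
have := integrableZl (measurableT) C (integrableD (measurableT) (bx_integrable N) h2_integrable).
by apply: eq_integrable => // p _ /=; rewrite EFinM.
Qed.

Lemma dominated_integrable (F : R * R -> R) (C N : R) : measurable_fun setT F ->
  (forall p, `|F p| <= C * (bx N p + h p ^+ 2)) -> mu2.-integrable setT (EFin \o F).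
Proof.
move=> mF FC; apply: (@le_integrable _ _ _ mu2 _ measurableT _ (EFin \o (fun p => C * (bx N p + h p ^+ 2)))).
- exact/measurable_EFinP.
- move=> p _ /=; rewrite lee_fin; apply: le_trans (FC p) _; exact: ler_norm.
- exact: dom_integrable.
Qed.

(** [h] is only square integrable; on a box it is dominated by the integrable [1 + h^2], the
    majorant in the limits of integrals containing [g]. *)
Lemma hh_le_dom N p : bx N p * h p <= bx N p + h p ^+ 2.
Proof.
rewrite /bx; case: ifP => _; last by rewrite mul0r add0r sqr_ge0.
by rewrite mul1r; have := sqr_ge0 (h p - 1); have := sqr_ge0 (h p); nra.
Qed.

Variable x0 : R.
Section eps.
Variable e : R.

(* [al + i be] is the regularized kernel [conj (z - x0) / (|z - x0|^2 + e^2)]. *)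
Definition dn (p : R * R) := rho x0 p + e ^+ 2.
Definition al (p : R * R) := (p.1 - x0) / dn p.
Definition be (p : R * R) := - p.2 / dn p.
Definition cae (p : R * R) := g1 p * al p - g2 p * be p.

Lemma rho_ge0 p : 0 <= rho x0 p. Proof. by rewrite addr_ge0 ?sqr_ge0. Qed.

(** From [|z - x0| / (|z - x0|^2 + e^2) <= 1 / |z - x0| <= 1 / y]: the regularized kernel has the
    same majorant [h] for all [e]. *)
Lemma cae_bound (c : R) (p : R * R) : 0 < p.2 ->
  `|c| <= Num.sqrt (g1 p ^+ 2 + g2 p ^+ 2) * Num.sqrt (rho x0 p) -> `|c / dn p| <= h p.
Proof.
move=> p0 hc; have Rs := rho_gt0 x0 p0.
have D0 : 0 < dn p by rewrite ltr_wpDr ?sqr_ge0.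
rewrite /hh p0 normrM normfV (gtr0_norm D0) ler_pdivrMr//.
apply: le_trans hc _; rewrite -mulrA ler_wpM2l ?sqrtr_ge0//.
rewrite mulrC ler_pdivlMr//.
have r0 := sqrtr_ge0 (rho x0 p); have := sqr_sqrtr (ltW Rs).
have : p.2 <= Num.sqrt (rho x0 p).
  by rewrite -[leLHS](ger0_norm (ltW p0)) -sqrtr_sqr ler_wsqrtr// /rho lerDr sqr_ge0.
rewrite /dn; have := sqr_ge0 e; nra.
Qed.

Lemma g1al_le p : `|g1 p * al p| <= h p.
Proof.
have [p0|p0] := leP p.2 0; first by rewrite g1U// hhU// mul0r normr0.
rewrite /al mulrA; apply: cae_bound => //; rewrite normrM ler_pM// -sqrtr_sqr ler_wsqrtr//.
  by rewrite lerDl sqr_ge0.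
by rewrite /rho lerDl sqr_ge0.
Qed.

Lemma g2be_le p : `|g2 p * be p| <= h p.
Proof.
have [p0|p0] := leP p.2 0; first by rewrite g2U// hhU// mul0r normr0.
rewrite /be mulrA; apply: cae_bound => //; rewrite normrM ler_pM// -sqrtr_sqr ler_wsqrtr//.
  by rewrite lerDr sqr_ge0.
by rewrite /rho sqrrN lerDr sqr_ge0.
Qed.

Lemma cae_le p : `|cae p| <= h p.
Proof.
have [p0|p0] := leP p.2 0; first by rewrite /cae g1U// g2U// hhU// !mul0r subrr normr0.
rewrite (_ : cae p = (g1 p * (p.1 - x0) + g2 p * p.2) / dn p); last by rewrite /cae /al /be; ring.
exact: cae_bound p0 (cs2 _ _ _ _).
Qed.

Hypothesis e0 : 0 < e.

Lemma dn_gt0 p : 0 < dn p.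
Proof. by rewrite ltr_wpDl ?rho_ge0 ?exprn_gt0. Qed.

Definition chi (N d : R) (p : R * R) := aN N p.1 * aN N p.2 * sd d p.2.

Lemma smooth2_chi N d : smooth2 (chi N d).
Proof. by rewrite /chi /aN /sd; smo. Qed.

Lemma smooth2_al : smooth2 al.
Proof. by rewrite /al /dn /rho; smo => p; rewrite gt_eqF// -/(rho x0 p) -/(dn p) dn_gt0. Qed.

Lemma smooth2_be : smooth2 be.
Proof. by rewrite /be /dn /rho; smo => p; rewrite gt_eqF// -/(rho x0 p) -/(dn p) dn_gt0. Qed.

Lemma chi_ge0 N d p : 0 <= chi N d p.
Proof. by apply: mulr_ge0; [apply: mulr_ge0; exact: aN_ge0|exact: sd_ge0]. Qed.

Lemma chi_le1 N d p : chi N d p <= 1.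
Proof.
apply: mulr_ile1; [apply: mulr_ge0; exact: aN_ge0|exact: sd_ge0| |exact: sd_le1].
by apply: mulr_ile1; [exact: aN_ge0|exact: aN_ge0|exact: aN_le1|exact: aN_le1].
Qed.

Lemma chi0 N d p : 0 < N -> 0 < d -> ~ (- (2 * N) <= p.1 <= 2 * N /\ d <= p.2 <= 2 * N) -> chi N d p = 0.
Proof.
move=> N0 d0 H; rewrite /chi.
have [h1|h1] := leP (2 * N) `|p.1|; first by rewrite (aN_outer p.1 N0).1// !mul0r.
have [h2|h2] := leP (2 * N) `|p.2|; first by rewrite (aN_outer p.2 N0).1// mulr0 mul0r.
have [h3|h3] := leP p.2 d; first by rewrite (sd_supp p.2 d0).1// mulr0.
exfalso; apply: H; rewrite -ler_norml (ltW h1) (ltW h3); split => //.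
exact: le_trans (ler_norm _) (ltW h2).
Qed.

Lemma test_al N d : 0 < N -> 0 < d -> test_fun_UHP (fun p => al p * chi N d p).
Proof.
move=> N0 d0; apply: (@smooth2_test _ _ (- (2 * N)) (2 * N) d (2 * N)) => //.
  by apply: smooth2_mul; [exact: smooth2_al|exact: smooth2_chi].
by move=> p Hp; rewrite chi0// mulr0.
Qed.

Lemma test_be N d : 0 < N -> 0 < d -> test_fun_UHP (fun p => be p * chi N d p).
Proof.
move=> N0 d0; apply: (@smooth2_test _ _ (- (2 * N)) (2 * N) d (2 * N)) => //.
  by apply: smooth2_mul; [exact: smooth2_be|exact: smooth2_chi].
by move=> p Hp; rewrite chi0// mulr0.
Qed.

Lemma dx_al N d p : dx (fun p => al p * chi N d p) p =
  ((dn p)^-1 - 2 * (p.1 - x0) ^+ 2 / dn p ^+ 2) * chi N d p +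
  al p * (aN' N p.1 * aN N p.2 * sd d p.2).
Proof.
have Dn := lt0r_neq0 (dn_gt0 p).
apply: dxE; rewrite /al /chi /dn /rho /=; eapply dv_eq; [deriv; [exact: Dn|exact: aN_dv]|].
by cbv beta; move: Dn; rewrite /dn /rho /= => Dn; field.
Qed.

Lemma dy_al N d p : dy (fun p => al p * chi N d p) p =
  (- (2 * (p.1 - x0) * p.2 / dn p ^+ 2)) * chi N d p +
  al p * (aN N p.1 * (aN' N p.2 * sd d p.2 + aN N p.2 * sd' d p.2)).
Proof.
have Dn := lt0r_neq0 (dn_gt0 p).
apply: dyE; rewrite /al /chi /dn /rho /=; eapply dv_eq; [deriv; [exact: Dn|exact: aN_dv|exact: sd_dv]|].
by cbv beta; move: Dn; rewrite /dn /rho /= => Dn; field.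
Qed.

Lemma dx_be N d p : dx (fun p => be p * chi N d p) p =
  (2 * (p.1 - x0) * p.2 / dn p ^+ 2) * chi N d p +
  be p * (aN' N p.1 * aN N p.2 * sd d p.2).
Proof.
have Dn := lt0r_neq0 (dn_gt0 p).
apply: dxE; rewrite /be /chi /dn /rho /=; eapply dv_eq; [deriv; [exact: Dn|exact: aN_dv]|].
by cbv beta; move: Dn; rewrite /dn /rho /= => Dn; field.
Qed.

Lemma dy_be N d p : dy (fun p => be p * chi N d p) p =
  (- (dn p)^-1 + 2 * p.2 ^+ 2 / dn p ^+ 2) * chi N d p +
  be p * (aN N p.1 * (aN' N p.2 * sd d p.2 + aN N p.2 * sd' d p.2)).
Proof.
have Dn := lt0r_neq0 (dn_gt0 p).
apply: dyE; rewrite /be /chi /dn /rho /=; eapply dv_eq; [deriv; [exact: Dn|exact: aN_dv|exact: sd_dv]|].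
by cbv beta; move: Dn; rewrite /dn /rho /= => Dn; field.
Qed.

(* [T0] comes from the dbar derivative of the regularized kernel, [T1] from the cut-off at infinity, [WW] from the cut-off near the real axis. *)
Definition T0 N p := u p * (2 * e ^+ 2 / dn p ^+ 2) * (aN N p.1 * aN N p.2).
Definition T1 N p := (u p * al p - v p * be p) * (aN' N p.1 * aN N p.2)
  - (u p * be p + v p * al p) * (aN N p.1 * aN' N p.2).
Definition WW N p := (u p * be p + v p * al p) * (aN N p.1 * aN N p.2).

(** The left side is the real part of [F] times [(d/dx + i d/dy)] of the cut-off kernel, that is
    twice dbar. For [w = z - x0], dbar of [conj w / (|w|^2 + e^2)] is [e^2 / (|w|^2 + e^2)^2], which
    accounts for [T0]; the rest are derivatives of the cut-offs. *)
Lemma dbar_integrand N d p :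
  u p * dx (fun p => al p * chi N d p) p - v p * dy (fun p => al p * chi N d p) p
  - (v p * dx (fun p => be p * chi N d p) p + u p * dy (fun p => be p * chi N d p) p) =
  (T0 N p + T1 N p) * sd d p.2 - WW N p * sd' d p.2.
Proof.
have Dn := lt0r_neq0 (dn_gt0 p).
rewrite dx_al dy_al dx_be dy_be /T0 /T1 /WW /chi /al /be.
have -> : 2 * e ^+ 2 / dn p ^+ 2 = 2 / dn p - 2 * rho x0 p / dn p ^+ 2.
  by rewrite /dn; move: Dn; rewrite /dn => Dn; field.
rewrite -!exprVn /rho; move: (dn p)^-1 (sd _ _) (sd' _ _) (aN _ _) (aN _ _) (aN' _ _) (aN' _ _) => r *; ring.
Qed.

Lemma al_continuous : continuous al.
Proof. by move=> p; exact/differentiable_continuous/smooth2_differentiable/smooth2_al. Qed.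

Lemma be_continuous : continuous be.
Proof. by move=> p; exact/differentiable_continuous/smooth2_differentiable/smooth2_be. Qed.

Lemma outb (N : R) (p : R * R) : 0 < N -> 2 * N < `|p.1| \/ 2 * N < `|p.2| ->
  [/\ aN N p.1 * aN N p.2 = 0, aN' N p.1 * aN N p.2 = 0 & aN N p.1 * aN' N p.2 = 0].
Proof.
move=> N0 [h1|h1].
- have [a0 a'0] := aN_outer p.1 N0.
  by rewrite a0 ?(ltW h1)// a'0 ?h1 ?orbT// !mul0r.
- have [a0 a'0] := aN_outer p.2 N0.
  by rewrite a0 ?(ltW h1)// a'0 ?h1 ?orbT// !mulr0.
Qed.

Lemma T0_continuous N : continuous (T0 N).
Proof.
move=> p; have Dn := lt0r_neq0 (dn_gt0 p).
rewrite /T0 /dn /rho; cont; try solve [exact: cu|exact: expf_neq0];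
  apply: ctcomp; solve [exact: (dv_continuous (@aN_dv R N))|exact: ctfst|exact: ctsnd].
Qed.

Lemma T1_continuous N : continuous (T1 N).
Proof.
move=> p; rewrite /T1; cont;
  lazymatch goal with
  | |- continuous_at _ (fun p => aN _ _) => apply: (ctcomp (dv_continuous (@aN_dv R N))); first [exact: ctfst|exact: ctsnd]
  | |- continuous_at _ (fun p => aN' _ _) => apply: (ctcomp (@aN'_continuous R N)); first [exact: ctfst|exact: ctsnd]
  | |- continuous_at _ (fun p => u p) => exact: cu
  | |- continuous_at _ (fun p => v p) => exact: cv
  | |- continuous_at _ (fun p => al p) => exact: al_continuous
  | |- continuous_at _ (fun p => be p) => exact: be_continuous
  end.
Qed.

Lemma WW_continuous N : continuous (WW N).
Proof.
move=> p; rewrite /WW; cont;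
  lazymatch goal with
  | |- continuous_at _ (fun p => aN _ _) => apply: (ctcomp (dv_continuous (@aN_dv R N))); first [exact: ctfst|exact: ctsnd]
  | |- continuous_at _ (fun p => aN' _ _) => apply: (ctcomp (@aN'_continuous R N)); first [exact: ctfst|exact: ctsnd]
  | |- continuous_at _ (fun p => u p) => exact: cu
  | |- continuous_at _ (fun p => v p) => exact: cv
  | |- continuous_at _ (fun p => al p) => exact: al_continuous
  | |- continuous_at _ (fun p => be p) => exact: be_continuous
  end.
Qed.

Lemma chi_continuous N d : continuous (chi N d).
Proof. by move=> p; exact/differentiable_continuous/smooth2_differentiable/smooth2_chi. Qed.

Section fixN.
Variable N : R.
Hypothesis N0 : 0 < N.

Lemma TT_out (p : R * R) : 2 * N < `|p.1| \/ 2 * N < `|p.2| -> T0 N p + T1 N p = 0 /\ WW N p = 0.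
Proof. by move=> /(outb N0)[a b c]; rewrite /T0 /T1 /WW a b c !mulr0 subrr addr0. Qed.

Lemma chi_out d (p : R * R) : 2 * N < `|p.1| \/ 2 * N < `|p.2| -> chi N d p = 0.
Proof. by move=> /(outb N0)[a b c]; rewrite /chi a mul0r. Qed.

Lemma dchi_integrable (w : R * R -> R) (c : R * R -> R) d : 0 < d ->
  continuous w -> test_fun_UHP (fun p => c p * chi N d p) ->
  (forall p, 2 * N < `|p.1| \/ 2 * N < `|p.2| -> dx (fun p => c p * chi N d p) p = 0) ->
  mu2.-integrable setT (EFin \o (fun p => w p * dx (fun p => c p * chi N d p) p)).
Proof.
move=> d0 cw [H _] z; apply: (@continuous_bx_integrable R _ (2 * N)).
  move=> p; apply: (@ctM _ _ _ w (dx (fun p => c p * chi N d p))); first exact: cw.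
  exact: (H [:: ((1, 0) : R * R)]).
by move=> p Hp; rewrite z// mulr0.
Qed.

Lemma dchi_integrable2 (w : R * R -> R) (c : R * R -> R) d : 0 < d ->
  continuous w -> test_fun_UHP (fun p => c p * chi N d p) ->
  (forall p, 2 * N < `|p.1| \/ 2 * N < `|p.2| -> dy (fun p => c p * chi N d p) p = 0) ->
  mu2.-integrable setT (EFin \o (fun p => w p * dy (fun p => c p * chi N d p) p)).
Proof.
move=> d0 cw [H _] z; apply: (@continuous_bx_integrable R _ (2 * N)).
  move=> p; apply: (@ctM _ _ _ w (dy (fun p => c p * chi N d p))); first exact: cw.
  exact: (H [:: ((0, 1) : R * R)]).
by move=> p Hp; rewrite z// mulr0.
Qed.

Lemma mg_al d p : `|g1 p * (al p * chi N d p)| <= 1 * (bx (2 * N) p + h p ^+ 2) /\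
  `|g2 p * (be p * chi N d p)| <= 1 * (bx (2 * N) p + h p ^+ 2).
Proof.
have c1 : `|chi N d p| <= bx (2 * N) p.
  rewrite /bx; case: ifPn => [_|]; last first.
    by rewrite negb_and -!ltNge => /orP h1; rewrite chi_out// normr0.
  by rewrite ger0_norm ?chi_ge0 ?chi_le1.
split; rewrite mulrA normrM mul1r; apply: le_trans (hh_le_dom (2 * N) p); rewrite mulrC; apply: ler_pM => //.
- exact: g1al_le.
- exact: g2be_le.
Qed.

Lemma dbar_cutoff d : 0 < d -> I (fun p => cae p * chi N d p) =
  - (I (fun p => (T0 N p + T1 N p) * sd d p.2) - I (fun p => WW N p * sd' d p.2)) / 2.
Proof.
move=> d0; have ta := test_al N0 d0; have tb := test_be N0 d0.
have mal := continuous_measurable_fun2 al_continuous.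
have mbe := continuous_measurable_fun2 be_continuous.
have mchi := continuous_measurable_fun2 (@chi_continuous N d).
have cc := chi_out d.
have ou := outb N0.
have i1 : mu2.-integrable setT (EFin \o (fun p => g1 p * (al p * chi N d p))).
  apply: (@dominated_integrable _ 1 (2 * N)); first by meas.
  by move=> p; have [] := mg_al d p.
have i2 : mu2.-integrable setT (EFin \o (fun p => g2 p * (be p * chi N d p))).
  apply: (@dominated_integrable _ 1 (2 * N)); first by meas.
  by move=> p; have [] := mg_al d p.
have j1 : mu2.-integrable setT (EFin \o (fun p => u p * dx (fun p => al p * chi N d p) p)).
  apply: dchi_integrable => // p Hp; rewrite dx_al cc//; have [a b c] := ou p Hp.
  by rewrite b !mul0r !mulr0 addr0.
have j2 : mu2.-integrable setT (EFin \o (fun p => v p * dy (fun p => al p * chi N d p) p)).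
  apply: dchi_integrable2 => // p Hp; rewrite dy_al cc//; have [a b c] := ou p Hp.
  have -> : aN N p.1 * (aN' N p.2 * sd d p.2 + aN N p.2 * sd' d p.2) =
    aN N p.1 * aN' N p.2 * sd d p.2 + aN N p.1 * aN N p.2 * sd' d p.2 by ring.
  by rewrite a c !mul0r addr0 !mulr0 addr0.
have j3 : mu2.-integrable setT (EFin \o (fun p => v p * dx (fun p => be p * chi N d p) p)).
  apply: dchi_integrable => // p Hp; rewrite dx_be cc//; have [a b c] := ou p Hp.
  by rewrite b !mul0r !mulr0 addr0.
have j4 : mu2.-integrable setT (EFin \o (fun p => u p * dy (fun p => be p * chi N d p) p)).
  apply: dchi_integrable2 => // p Hp; rewrite dy_be cc//; have [a b c] := ou p Hp.
  have -> : aN N p.1 * (aN' N p.2 * sd d p.2 + aN N p.2 * sd' d p.2) =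
    aN N p.1 * aN' N p.2 * sd d p.2 + aN N p.1 * aN N p.2 * sd' d p.2 by ring.
  by rewrite a c !mul0r addr0 !mulr0 addr0.
have k1 : mu2.-integrable setT (EFin \o (fun p => (T0 N p + T1 N p) * sd d p.2)).
  apply: (@continuous_bx_integrable R _ (2 * N)).
    move=> p; cont; [exact: T0_continuous|exact: T1_continuous|].
    by apply: ctcomp; [exact: (dv_continuous (@sd_dv R d))|exact: ctsnd].
  by move=> p /TT_out[-> _]; rewrite mul0r.
have k2 : mu2.-integrable setT (EFin \o (fun p => WW N p * sd' d p.2)).
  apply: (@continuous_bx_integrable R _ (2 * N)).
    move=> p; cont; [exact: WW_continuous|].
    by apply: ctcomp; [exact: sd'_continuous|exact: ctsnd].
  by move=> p /TT_out[_ ->]; rewrite mul0r.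
have -> : I (fun p => cae p * chi N d p) =
    I (fun p => g1 p * (al p * chi N d p) - g2 p * (be p * chi N d p)).
  by apply: eq_Rintegral => p _; rewrite /cae; ring.
exact: (I_comb i1 i2 j1 j2 j3 j4 k1 k2 (Hd1 ta) (Hd2 tb) (dbar_integrand N d)).
Qed.

Let dl (n : nat) : R := n.+1%:R^-1.
Let dl0 n : 0 < dl n. Proof. by rewrite invr_gt0. Qed.

Lemma sd_cvg (y : R) : sd (dl n) y @[n --> \oo] --> (if 0 < y then 1 else 0 : R).
Proof.
case: ifPn => y0; last first.
  rewrite (_ : (fun n => sd (dl n) y) = cst 0); first exact: cvg_cst.
  apply/funext => n; rewrite (sd_supp y (dl0 n)).1//.
  by apply: le_trans (ltW (dl0 n)); rewrite leNgt.
apply/cvgrPdist_le => e' e'0; exists (Num.bound (2 / y)) => // n /= yn.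
rewrite (sd_supp y (dl0 n)).2.1 ?subrr ?normr0 ?(ltW e'0)// /dl.
rewrite ler_pdivrMr// -ler_pdivrMl// mulrC; apply: le_trans (ltW (archi_boundP _)) _.
  by rewrite divr_ge0// ltW.
by rewrite ler_nat ltnW.
Qed.

Definition aa p := aN N p.1 * aN N p.2.
Definition iU (p : R * R) : R := if 0 < p.2 then 1 else 0.

Lemma aa_cont : continuous aa.
Proof.
by move=> p; rewrite /aa; cont; apply: (ctcomp (dv_continuous (@aN_dv R N))); first [exact: ctfst|exact: ctsnd].
Qed.

(** The strip between [d] and [2 * d] has area of order [d] and [sd'] is of order [1 / d], so the
    term vanishes only because [WW] tends to [0] at the axis: there [be = 0] by its formula and
    [v = 0] because [f] is real. *)
Lemma WW_lim : I (fun p => WW N p * sd' (dl n) p.2) @[n --> \oo] --> (0 : R).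
Proof.
have [K K0 HK] := @cutoff_bound R.
have W0 x : WW N (x, 0) = 0 by rewrite /WW v0 /be /= oppr0 !mul0r mulr0 addr0 mul0r.
apply/cvgr0Pnorm_le => e' e'0.
have c0 : 0 < K * (4 * N) + 1 by rewrite ltr_pwDr// mulr_ge0// mulr_ge0// ltW.
(* [K * (4 * N)] is the factor that the strip estimate leaves over; the [+ 1] allows [K = 0]. *)
pose eta := e' / (K * (4 * N) + 1).
have eta0 : 0 < eta by rewrite divr_gt0.
have := strip_vanish (2 * N) (@WW_continuous N) W0 eta0.
move=> /nbhs_ballP[r /= r0 Hr].
exists (Num.bound (2 / r)) => // n /= rn.
have d2r : 2 * dl n < r.
  rewrite /dl -ltr_pdivlMl// -[ltLHS]invrK -[ltRHS]invrK ltf_pV2 ?posrE ?invr_gt0// ?mulr_gt0//.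
  rewrite !invrK invfM invrK; apply: lt_le_trans (archi_boundP _) _; first by rewrite divr_ge0// ltW.
  by rewrite ler_nat ltnW.
have mF : measurable_fun setT (fun p => WW N p * sd' (dl n) p.2).
  apply: continuous_measurable_fun2 => p; cont; first exact: WW_continuous.
  by apply: ctcomp; [exact: sd'_continuous|exact: ctsnd].
pose c := eta * (K / dl n).
have cge0 : 0 <= c by rewrite mulr_ge0 ?(ltW eta0)// divr_ge0// ltW.
have N2 : 0 <= 2 * N by rewrite mulr_ge0// ltW.
have dd : dl n <= 2 * dl n by rewrite ler_peMl ?(ltW (dl0 n))// ler1n.
have FB p : `|WW N p * sd' (dl n) p.2| <= c * (if (`|p.1| <= 2 * N) && ((dl n <= p.2) && (p.2 <= 2 * dl n)) then 1 else 0).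
  case: ifPn => [/andP[h1 /andP[h2 h3]]|].
    rewrite mulr1 normrM ler_pM//; last by have [] := HK _ p.2 (dl0 n).
    case: p h1 h2 h3 => p1 p2 /= h1 h2 h3; apply: Hr => //.
    rewrite /ball /= sub0r normrN ger0_norm; first exact: le_lt_trans d2r.
    exact: le_trans (ltW (dl0 n)) h2.
  rewrite !negb_and -!ltNge mulr0 => /or3P[h1|h1|h1].
  - by have [_ ->] := TT_out (or_introl h1); rewrite mul0r normr0.
  - by rewrite (sd_supp p.2 (dl0 n)).2.2 ?h1// mulr0 normr0.
  - by rewrite (sd_supp p.2 (dl0 n)).2.2 ?h1 ?orbT// mulr0 normr0.
have := strip_integral cge0 N2 dd.
set G := (fun p : R * R => (c * _)%:E) => EG.
rewrite -lee_fin -abse_EFin /Rintegral fineK; last first.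
  apply: integrable_fin_num => //; apply: (@le_integrable _ _ _ mu2 _ measurableT _ G).
  - exact/measurable_EFinP.
  - by move=> p _; rewrite /G /= lee_fin (le_trans (FB p))// ler_norm.
  - apply/integrableP; split; last first.
      have -> : (\int[mu2]_x `|G x| = \int[mu2]_x G x)%E.
        by apply: eq_integral => p _; rewrite gee0_abs// lee_fin mulr_ge0//; case: ifP.
      by rewrite EG ltry.
    apply/measurable_EFinP; apply: mfM; first exact: measurable_cst.
    apply: measurable_fun_ifT => //; apply: measurable_and.
      by apply: measurable_fun_ler => //; exact: mfabs measurable_fst.
    by apply: measurable_and; apply: measurable_fun_ler.
apply: le_trans (le_abse_integral _ _ _) _ => //; first exact/measurable_EFinP.
apply: (@le_trans _ _ (\int[mu2]_p G p)%E).
  apply: ge0_le_integral => //.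
  - by apply/measurable_EFinP; exact: mfabs.
  - apply/measurable_EFinP; apply: mfM; first exact: measurable_cst.
    apply: measurable_fun_ifT => //; apply: measurable_and.
      by apply: measurable_fun_ler => //; exact: mfabs measurable_fst.
    by apply: measurable_and; apply: measurable_fun_ler.
  - by move=> p _; rewrite /G lee_fin.
rewrite EG lee_fin /c.
have -> : eta * (K / dl n) * (2 * (2 * N)) * (2 * dl n - dl n) = eta * (K * (4 * N)).
  by field; rewrite gt_eqF.
rewrite /eta mulrAC ler_pdivrMr// ler_pM2l//; lra.
Qed.

(** Dominated convergence as the cut-off approaches the axis. The factor [iU] appears because [T0]
    and [T1], unlike [cae], do not vanish below the axis. *)
Lemma dbar_half_plane : I (fun p => cae p * aa p) = - (I (fun p => (T0 N p + T1 N p) * iU p)) / 2.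
Proof.
have mal := continuous_measurable_fun2 al_continuous.
have mbe := continuous_measurable_fun2 be_continuous.
have mc n := continuous_measurable_fun2 (@chi_continuous N (dl n)).
have L1 : I (fun p => cae p * chi N (dl n) p) @[n --> \oo] --> I (fun p => cae p * aa p).
  refine (proj2 (@Rdominated _ _ _ mu2 _ _ (fun p => 1 * (bx (2 * N) p + h p ^+ 2)) _ _ (dom_integrable 1 (2 * N)) _)).
  - by move=> n; rewrite /cae; have m := mc n; meas.
  - move=> p; have [p0|p0] := leP p.2 0.
      have z : cae p = 0 by rewrite /cae g1U// g2U// !mul0r subrr.
      by rewrite z mul0r; under eq_fun => n do rewrite mul0r; exact: cvg_cst.
    rewrite -[X in _ --> X]mulr1 /chi -/(aa p).
    under eq_fun => n do rewrite mulrA.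
    by apply: cvgM; [exact: cvg_cst|have := @sd_cvg p.2; rewrite p0].
  - move=> n p; rewrite mul1r; apply: le_trans (hh_le_dom (2 * N) p).
    rewrite normrM mulrC; apply: ler_pM => //; last exact: cae_le.
    rewrite /bx; case: ifPn => [_|]; first by rewrite ger0_norm ?chi_ge0 ?chi_le1.
    by rewrite negb_and -!ltNge => /orP h1; rewrite chi_out// normr0.
have TC : continuous (fun p => T0 N p + T1 N p).
  by move=> p; cont; [exact: T0_continuous|exact: T1_continuous].
have [C C0 HC] := continuous_bx_bound TC (fun p Hp => (TT_out Hp).1).
have L2 : I (fun p => (T0 N p + T1 N p) * sd (dl n) p.2) @[n --> \oo] --> I (fun p => (T0 N p + T1 N p) * iU p).
  refine (proj2 (@Rdominated _ _ _ mu2 _ _ (fun p => C * bx (2 * N) p) _ _ _ _)).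
  - move=> n; apply: continuous_measurable_fun2 => p; cont; [exact: T0_continuous|exact: T1_continuous|].
    by apply: ctcomp; [exact: (dv_continuous (@sd_dv R (dl n)))|exact: ctsnd].
  - by move=> p; apply: cvgM; [exact: cvg_cst|exact: sd_cvg].
  - by have := integrableZl measurableT C (bx_integrable (2 * N)); apply: eq_integrable.
  - move=> n p; rewrite normrM -[leRHS]mulr1; apply: ler_pM => //.
    by rewrite ger0_norm ?sd_ge0// sd_le1.
have L3 := WW_lim.
have L4 : - (I (fun p => (T0 N p + T1 N p) * sd (dl n) p.2) - I (fun p => WW N p * sd' (dl n) p.2)) / 2
   @[n --> \oo] --> - (I (fun p => (T0 N p + T1 N p) * iU p) - 0) / 2.
  by apply: cvgM; [apply: cvgN; apply: cvgB|exact: cvg_cst].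
rewrite subr0 in L4.
have E : (fun n => I (fun p => cae p * chi N (dl n) p)) =
  (fun n => - (I (fun p => (T0 N p + T1 N p) * sd (dl n) p.2) - I (fun p => WW N p * sd' (dl n) p.2)) / 2).
  by apply/funext => n; exact: dbar_cutoff.
rewrite E in L1; exact: (cvg_unique _ L1 L4).
Qed.

End fixN.
End eps.
End Repr.

(** * The approximate identity and its mass *)

Section Affine.
Variable R : realType.
Notation mu := (@lebesgue_measure R).
Notation mu2 := (@mu2 R).

Lemma ge0_integral_affine (c e : R) (f : R -> \bar R) : 0 < e -> measurable_fun setT f ->
  (forall x, 0 <= f x)%E -> (\int[mu]_x f x = e%:E * \int[mu]_x f (c + e * x)%R)%E.
Proof.
move=> e0 mf f0.
pose phi := fun x : measurableTypeR R => (c + e * x : measurableTypeR R).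
have ms : measurable_fun setT phi.
  apply: (@mfD R _ (measurableTypeR R) setT (cst c) (fun x => e * x)) => //.
  by apply: (@mfM R _ (measurableTypeR R) setT (cst e) id).
pose en := NngNum (ltW e0).
have H := @ge0_integral_pushforward _ _ (measurableTypeR R) (measurableTypeR R) R _ ms (mscale en mu) setT f measurableT mf (fun x _ => f0 x).
rewrite preimage_setT in H.
have mfp : measurable_fun setT (f \o phi) by exact: measurableT_comp.
rewrite ge0_integral_mscale// in H.
rewrite -[RHS]H; apply: eq_measure_integral => A mA _.
apply: lebesgue_measure_unique => //= _ [[a b]] _ <-.
rewrite /pushforward /mscale/= (_ : _ @^-1` _ = `](a - c) / e, (b - c) / e]%classic); last first.
  apply/seteqP; split=> x /=; rewrite !in_itv/= /phi ltr_pdivrMr// ler_pdivlMr// ltrBlDl lerBrDl mulrC//.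
rewrite !lebesgue_measure_itv/= !lte_fin ltr_pM2r ?invr_gt0// ltrD2r; case: ifP => _; last by rewrite mule0.
by rewrite -!EFinB -EFinM; congr (_%:E); field; rewrite gt_eqF.
by move=> x _; exact: f0.
Qed.

Lemma mu2_affine (c e : R) (F : R * R -> \bar R) : 0 < e -> measurable_fun setT F ->
  (forall x, 0 <= F x)%E ->
  (\int[mu2]_p F p = (e * e)%:E * \int[mu2]_p F (c + e * p.1, e * p.2)%R)%E.
Proof.
move=> e0 mF F0.
have mG : measurable_fun setT (fun p : R * R => F (c + e * p.1, e * p.2)).
  have mp : measurable_fun setT (fun p : R * R => (c + e * p.1, e * p.2)).
    by apply: measurable_fun_pair; meas.
  exact: (measurableT_comp mF mp).
have mFx (x : R) : measurable_fun setT (fun y => F (x, y)).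
  by apply: measurableT_comp => //; exact: measurable_pair1.
rewrite mu2_tonelli1// mu2_tonelli1//.
have mH : measurable_fun setT (fun x => \int[mu]_y F (x, y))%E.
  exact: (@measurable_fun_fubini_tonelli_F _ _ _ _ _ mu _ mF).
rewrite (ge0_integral_affine c e0 mH); last by move=> x; apply: integral_ge0.
rewrite EFinM -muleA; congr (_ * _)%E.
rewrite -ge0_integralZl//; last 3 first.
- exact: (@measurable_fun_fubini_tonelli_F _ _ _ _ _ mu _ mG).
- by move=> x _; apply: integral_ge0.
- by rewrite lee_fin ltW.
apply: eq_integral => x _.
rewrite (@ge0_integral_affine 0 e (fun y => F (c + e * x, y)))//.
by congr (_ * _)%E; apply: eq_integral => y _; rewrite add0r.
Qed.

Lemma mu2_affine_EFin (c e : R) (F : R * R -> R) : 0 < e -> measurable_fun setT F ->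
  (forall p, 0 <= F p) ->
  (\int[mu2]_p (F p)%:E = \int[mu2]_p (e * e * F (c + e * p.1, e * p.2))%:E)%E.
Proof.
move=> e0 mF F0.
have mE : measurable_fun setT (EFin \o F) by exact/measurable_EFinP.
rewrite (@mu2_affine c e (EFin \o F))//.
have mp : measurable_fun setT (fun p : R * R => (c + e * p.1, e * p.2)).
  by apply: measurable_fun_pair; meas.
rewrite -ge0_integralZl_EFin//; last 3 first.
- by move=> p _; rewrite lee_fin.
- exact: (measurableT_comp mE mp).
- by rewrite mulr_ge0 ?ltW.
Qed.

(** Profile at scale [1] of the approximate identity in [T0]: the weight
    [2 * e^2 / (|z - x0|^2 + e^2)^2] is its rescaling by [e]. *)
Definition k1 (p : R * R) : R := 2 / (p.1 ^+ 2 + p.2 ^+ 2 + 1) ^+ 2.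

Lemma k1_ge0 p : 0 <= k1 p.
Proof. by rewrite divr_ge0 ?sqr_ge0. Qed.

Lemma measurable_k1 : measurable_fun setT k1.
Proof. by rewrite /k1; meas. Qed.

(** A product of two one-dimensional Poisson kernels; [(a^2 + b^2 + 1)^2 >= (a^2 + 1) (b^2 + 1)]
    makes it, with [c = 2], a majorant of [k1]. *)
Lemma inv2_integrable (c : R) : (\int[mu2]_p (c * ((p.1 ^+ 2 + 1)^-1 * (p.2 ^+ 2 + 1)^-1))%:E <= (`|c| * pi * pi)%:E)%E.
Proof.
have g0 (t : R) : 0 <= (t ^+ 2 + 1)^-1 by rewrite invr_ge0 addr_ge0 ?sqr_ge0.
have mg : measurable_fun setT (fun p : R * R => (`|c| * ((p.1 ^+ 2 + 1)^-1 * (p.2 ^+ 2 + 1)^-1))%:E).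
  by apply/measurable_EFinP; meas.
have mf : measurable_fun setT (fun p : R * R => (c * ((p.1 ^+ 2 + 1)^-1 * (p.2 ^+ 2 + 1)^-1))%:E).
  by apply/measurable_EFinP; meas.
apply: (@le_trans _ _ (\int[mu2]_p (`|c| * ((p.1 ^+ 2 + 1)^-1 * (p.2 ^+ 2 + 1)^-1))%:E)%E).
  apply: le_trans (_ : (\int[mu2]_p `|(c * ((p.1 ^+ 2 + 1)^-1 * (p.2 ^+ 2 + 1)^-1))%:E| <= _)%E).
    by apply: le_trans (lee_abs _) _; apply: le_abse_integral.
  rewrite le_eqVlt; apply/orP; left; apply/eqP; apply: eq_integral => p _.
  by rewrite abse_EFin normrM (ger0_norm (mulr_ge0 (g0 _) (g0 _))).
rewrite mu2_tonelli1//; last by move=> p; rewrite lee_fin !mulr_ge0.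
have I1 (t : R) : 0 <= t -> (\int[mu]_y (t * (y ^+ 2 + 1)^-1)%:E <= (t * pi)%:E)%E.
  move=> t0; have := @poisson_mul_le R t 0 1 ltr01 t0.
  have -> : (\int[mu]_x (t * (1 / ((x - 0) ^+ 2 + 1 ^+ 2)))%:E = \int[mu]_y (t * (y ^+ 2 + 1)^-1)%:E)%E.
    by apply: eq_integral => y _; rewrite subr0 expr1n div1r.
  by [].
apply: (@le_trans _ _ (\int[mu]_x ((`|c| * pi) * (x ^+ 2 + 1)^-1)%:E)%E).
  apply: ge0_le_integral => //.
  - by move=> x _; apply: integral_ge0 => y _; rewrite lee_fin !mulr_ge0.
  - exact: (@measurable_fun_fubini_tonelli_F _ _ _ _ _ mu _ mg (fun p => ltac:(by rewrite lee_fin !mulr_ge0))).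
  - by apply/measurable_EFinP; meas.
  - move=> x _ /=; have := I1 (`|c| * (x ^+ 2 + 1)^-1) ltac:(by rewrite mulr_ge0).
    rewrite (_ : `|c| * pi * _ = `|c| * (x ^+ 2 + 1)^-1 * pi); last by ring.
    by apply: le_trans; rewrite le_eqVlt; apply/orP; left; apply/eqP; apply: eq_integral => y _; rewrite mulrA.
by apply: I1; rewrite mulr_ge0// pi_ge0.
Qed.

Lemma k1_integrable : mu2.-integrable setT (EFin \o k1).
Proof.
apply/integrableP; split; first by apply/measurable_EFinP; exact: measurable_k1.
apply: le_lt_trans (ltry (`|2 : R| * pi * pi)); apply: le_trans (inv2_integrable 2).
apply: ge0_le_integral => //.
- by apply/measurable_EFinP; apply: mfabs; exact: measurable_k1.
- by apply/measurable_EFinP; meas.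
move=> p _; rewrite /= lee_fin (ger0_norm (k1_ge0 p)) /k1 ler_pM2l// -invfM lef_pV2 ?posrE.
- have := sqr_ge0 p.1; have := sqr_ge0 p.2; nra.
- by rewrite exprn_gt0// ltr_wpDl// addr_ge0 ?sqr_ge0.
- by rewrite mulr_gt0// ltr_wpDl ?sqr_ge0.
Qed.

Lemma iU_01 (p : R * R) : 0 <= iU p <= 1.
Proof. by rewrite /iU; case: ifP; rewrite ?lexx ?ler01. Qed.

Lemma measurable_iU : measurable_fun setT (@iU R).
Proof. by rewrite /iU; apply: measurable_fun_ifT => //; exact: measurable_fun_ltr. Qed.

Lemma mul_iU_integrable (F : R * R -> R) : mu2.-integrable setT (EFin \o F) ->
  mu2.-integrable setT (EFin \o (fun p => F p * iU p)).
Proof.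
move=> iF; apply: (@le_integrable _ _ _ mu2 _ measurableT _ (EFin \o F)) => //.
  apply/measurable_EFinP; apply: mfM; last exact: measurable_iU.
  by have /measurable_EFinP := measurable_int _ iF.
move=> p _; rewrite /= lee_fin normrM -[leRHS]mulr1; apply: ler_pM => //.
by have /andP[a b] := iU_01 p; rewrite ger0_norm.
Qed.

(** The mass that the approximate identity puts on the upper half-plane. It stays symbolic and is
    divided out at the end, whence [pompeiu_gt0]. *)
Definition pompeiu : R := (\int[mu2]_p (k1 p * iU p))%R.

Lemma pompeiu_gt0 : 0 < pompeiu.
Proof.
have ik := mul_iU_integrable k1_integrable.
(* On the box [|p.1| <= 1], [1/2 <= p.2 <= 1] one has [p.1^2 + p.2^2 + 1 <= 3], so [k1] is at least
   [2/9] there. *)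
apply: (@lt_le_trans _ _ (2 / 9 * (2 * 1) * (1 - 1 / 2))); first lra.
rewrite -lee_fin /pompeiu /Rintegral fineK; last exact: integrable_fin_num.
rewrite -strip_integral//; last lra.
apply: ge0_le_integral => //.
- by move=> p _; rewrite lee_fin; case: ifP => _; rewrite ?mulr0 ?mulr1; lra.
- apply/measurable_EFinP; apply: mfM; first exact: measurable_cst.
  apply: measurable_fun_ifT => //; apply: measurable_and.
    by apply: measurable_fun_ler => //; exact: mfabs measurable_fst.
  by apply: measurable_and; apply: measurable_fun_ler.
- exact: measurable_int ik.
move=> p _; rewrite lee_fin; case: ifPn => [/andP[h1 /andP[h2 h3]]|_]; last first.
  by rewrite mulr0 mulr_ge0 ?k1_ge0//; have /andP[] := iU_01 p.
have p0 : 0 < p.2 by lra.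
rewrite /iU p0 !mulr1 /k1 ler_pM2l// lef_pV2 ?posrE//.
- have -> : 9 = 3 ^+ 2 :> R by ring.
  rewrite ler_pXn2r ?nnegrE ?addr_ge0 ?sqr_ge0//.
  have : p.1 ^+ 2 <= 1 by rewrite -real_normK ?num_real// expr_le1.
  nra.
- by rewrite exprn_gt0// ltr_wpDl// addr_ge0 ?sqr_ge0.
Qed.

End Affine.

Lemma aN'_cases (R : realType) (a b : R) : ((a != 0) || (b != 0)) \/ (a = 0 /\ b = 0).
Proof. by have [->|a0] := eqVneq a 0; have [->|b0] := eqVneq b 0; [right|left|left|left]. Qed.

(** * Removing the regularization of the kernel *)

Section Eps.
Variable R : realType.
Notation mu := (@lebesgue_measure R).
Notation mu2 := (@mu2 R).
Variables u v g1 g2 : R * R -> R.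
Hypotheses (cu : continuous u) (cv : continuous v).
Hypothesis v0 : forall x, v (x, 0) = 0.
Hypotheses (mg1 : measurable_fun setT g1) (mg2 : measurable_fun setT g2).
Hypothesis g1U : forall p, p.2 <= 0 -> g1 p = 0.
Hypothesis g2U : forall p, p.2 <= 0 -> g2 p = 0.
Notation h := (hh g1 g2).
Notation cau := (cau g1 g2).
Hypothesis hf : (\int[mu2]_p (h p ^+ 2)%:E < +oo)%E.
Notation I F := (Rintegral mu2 setT F).
Hypothesis Hd1 : forall phi, test_fun_UHP phi ->
  I (fun p => g1 p * phi p) = - I (fun p => (u p * dx phi p - v p * dy phi p) / 2).
Hypothesis Hd2 : forall phi, test_fun_UHP phi ->
  I (fun p => g2 p * phi p) = - I (fun p => (v p * dx phi p + u p * dy phi p) / 2).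
Variables (x0 N : R).
Hypothesis HN : 2 * `|x0| + 2 <= N.

Let N0 : 0 < N. Proof. by apply: lt_le_trans HN; rewrite ltr_pwDr// mulr_ge0. Qed.
Let ep (n : nat) : R := n.+1%:R^-1.
Let ep0 n : 0 < ep n. Proof. by rewrite invr_gt0. Qed.

Lemma ep_cvg : ep n @[n --> \oo] --> (0 : R).
Proof.
apply/cvgr0Pnorm_le => e e0; exists (Num.bound (e^-1)) => // n /= en.
rewrite ger0_norm ?(ltW (ep0 n))// /ep -[leRHS]invrK lef_pV2 ?posrE ?invr_gt0//.
apply: le_trans (ltW (archi_boundP _)) _; first by rewrite invr_ge0 ltW.
by rewrite ler_nat ltnW.
Qed.

(** Where the cut-off varies, one coordinate has size at least [N], and [HN] then keeps [z] at
    distance at least [N / 2] from the pole. The bounds on [T1] are thus uniform in the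
    regularization parameter, the value [0] included. *)
Lemma outer_rho p : (aN' N p.1 != 0) || (aN' N p.2 != 0) -> N ^+ 2 / 4 <= rho x0 p.
Proof.
have nx := normr_ge0 x0.
move=> /orP[h1|h1].
- have : N <= `|p.1|.
    by rewrite leNgt; apply/negP => h2; rewrite (aN_outer p.1 N0).2 ?h2// eqxx in h1.
  rewrite /rho -(real_normK (num_real (p.1 - x0))) => h4.
  have h6 := ler_normB (p.1 - x0) (- x0); rewrite opprK subrK normrN in h6.
  have h5 : N / 2 <= `|p.1 - x0| by have := HN; lra.
  have := sqr_ge0 p.2; have := N0; move: h5; set t := `|_ - _|; nra.
- have h3 : N <= `|p.2|.
    by rewrite leNgt; apply/negP => h2; rewrite (aN_outer p.2 N0).2 ?h2// eqxx in h1.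
  rewrite /rho -(real_normK (num_real p.2)); have := sqr_ge0 (p.1 - x0); have := N0; move: h3; set t := `|p.2|; nra.
Qed.

Lemma al_bound e p : N ^+ 2 / 4 <= rho x0 p -> `|al x0 e p| <= 2 / N /\ `|be x0 e p| <= 2 / N.
Proof.
move=> hr.
have r0 : 0 < rho x0 p by apply: lt_le_trans hr; rewrite divr_gt0 ?exprn_gt0.
have D0 : 0 < dn x0 e p by rewrite /dn ltr_wpDr ?sqr_ge0.
have key (t : R) : `|t| ^+ 2 <= rho x0 p -> `|t / dn x0 e p| <= 2 / N.
  move=> ht; rewrite normrM normfV (gtr0_norm D0) ler_pdivrMr// mulrAC ler_pdivlMr//.
  apply: (@le_trans _ _ (2 * rho x0 p)); last by rewrite ler_pM2l// /dn lerDl sqr_ge0.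
  have : `|t| <= Num.sqrt (rho x0 p) by rewrite -[leLHS](ger0_norm (normr_ge0 t)) -sqrtr_sqr ler_wsqrtr.
  have : N / 2 <= Num.sqrt (rho x0 p).
    have N2 : 0 <= N / 2 by rewrite divr_ge0// ltW.
    rewrite -(ger0_norm N2) -sqrtr_sqr ler_wsqrtr//; apply: le_trans hr; lra.
  have := sqr_sqrtr (ltW r0); have := sqrtr_ge0 (rho x0 p); have := normr_ge0 t; nra.
rewrite /al /be; split; apply: key; rewrite real_normK ?num_real// ?sqrrN /rho.
  by rewrite lerDl sqr_ge0.
by rewrite lerDr sqr_ge0.
Qed.

(** [aa (2 * N)] equals [1] on the square and has compact support, so the bound for compactly
    supported continuous functions applies to the product. *)
Lemma uv_bound : exists2 C, 0 <= C & forall p, `|p.1| <= 2 * N -> `|p.2| <= 2 * N -> `|u p| <= C /\ `|v p| <= C.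
Proof.
have N20 : 0 < 2 * N by rewrite mulr_gt0.
have cA (w : R * R -> R) : continuous w -> continuous (fun p => w p * aa (2 * N) p).
  by move=> cw p; cont; [exact: cw|exact: aa_cont].
have vA (w : R * R -> R) p : 2 * (2 * N) < `|p.1| \/ 2 * (2 * N) < `|p.2| -> w p * aa (2 * N) p = 0.
  by move=> /(outb N20)[a _ _]; rewrite /aa a mulr0.
have [C1 C10 H1] := continuous_bx_bound (cA u cu) (vA u).
have [C2 C20 H2] := continuous_bx_bound (cA v cv) (vA v).
exists (C1 + C2); first exact: addr_ge0.
move=> p h1 h2; have a1 : aa (2 * N) p = 1 by rewrite /aa !aN1 ?mulr1.
have b1 N' : bx N' p <= 1 by rewrite /bx; case: ifP.
split.
- have := H1 p; rewrite a1 mulr1 => /le_trans; apply.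
  apply: (@le_trans _ _ C1); last by rewrite lerDl.
  by rewrite -[leRHS]mulr1 ler_wpM2l.
- have := H2 p; rewrite a1 mulr1 => /le_trans; apply.
  apply: (@le_trans _ _ C2); last by rewrite lerDr.
  by rewrite -[leRHS]mulr1 ler_wpM2l.
Qed.

Lemma T1_bound : exists C, forall e p, `|T1 u v x0 e N p| <= C * bx (2 * N) p.
Proof.
have [C C0 HC] := uv_bound; have [K K0 HK] := @cutoff_bound R.
have Kn : 0 <= K / N by rewrite divr_ge0// ltW.
exists (2 * (2 * C * (2 / N)) * (K / N)) => e p.
have [h1|h1] := leP `|p.1| (2 * N); last first.
  rewrite /T1; have [_ -> ->] := outb N0 (or_introl h1 : 2 * N < `|p.1| \/ 2 * N < `|p.2|).
  by rewrite !mulr0 subrr normr0 /bx (leNgt `|p.1|) h1 /= mulr0.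
have [h2|h2] := leP `|p.2| (2 * N); last first.
  rewrite /T1; have [_ -> ->] := outb N0 (or_intror h2 : 2 * N < `|p.1| \/ 2 * N < `|p.2|).
  by rewrite !mulr0 subrr normr0 /bx (leNgt `|p.2|) h2 andbF mulr0.
rewrite /bx h1 h2 /= mulr1.
have [ub vb] := HC p h1 h2.
have [hz|[z1 z2]] := aN'_cases (aN' N p.1) (aN' N p.2); last first.
  rewrite /T1 z1 z2 (mul0r (aN N p.2)) (mulr0 (aN N p.1)) !mulr0 subrr normr0; apply: mulr_ge0 => //; apply: mulr_ge0 => //.
  by apply: mulr_ge0; [exact: mulr_ge0|rewrite divr_ge0// ltW].
have [ab bb] := al_bound e (outer_rho hz).
have a1 : `|aN' N p.1 * aN N p.2| <= K / N.
  rewrite normrM -[leRHS]mulr1; apply: ler_pM => //; first by have [] := HK N p.1 N0.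
  by rewrite ger0_norm ?aN_ge0// aN_le1.
have a2 : `|aN N p.1 * aN' N p.2| <= K / N.
  rewrite normrM -[leRHS]mul1r; apply: ler_pM => //; last by have [] := HK N p.2 N0.
  by rewrite ger0_norm ?aN_ge0// aN_le1.
have s2 (a b c d : R) : `|a| <= C -> `|b| <= 2 / N -> `|c| <= C -> `|d| <= 2 / N -> `|a * b| + `|c * d| <= 2 * C * (2 / N).
  move=> ha hb hc hd; rewrite (_ : 2 * C * (2 / N) = C * (2 / N) + C * (2 / N)); last by ring.
  by apply: lerD; rewrite normrM; apply: ler_pM.
rewrite /T1; apply: le_trans (ler_normB _ _) _.
rewrite (_ : 2 * _ * _ = 2 * C * (2 / N) * (K / N) + 2 * C * (2 / N) * (K / N)); last by ring.
apply: lerD; rewrite normrM; apply: ler_pM => //.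
- by apply: le_trans (ler_normB _ _) _; exact: s2.
- by apply: le_trans (ler_normD _ _) _; exact: s2.
Qed.

Let u0 := u (x0, 0).
Let ke (e : R) (p : R * R) : R := 2 * e ^+ 2 / dn x0 e p ^+ 2.

Let mke e : measurable_fun setT (ke e).
Proof. by rewrite /ke /dn /rho; meas. Qed.

Let ke_ge0 e p : 0 <= ke e p.
Proof. by rewrite divr_ge0 ?sqr_ge0// mulr_ge0 ?sqr_ge0. Qed.

Let ke_scale (e : R) (p : R * R) : 0 < e -> e * e * ke e (x0 + e * p.1, e * p.2) = k1 p.
Proof.
move=> e0; rewrite /ke /dn /rho /k1 /=.
have -> : (x0 + e * p.1 - x0) ^+ 2 + (e * p.2) ^+ 2 + e ^+ 2 = e ^+ 2 * (p.1 ^+ 2 + p.2 ^+ 2 + 1) by ring.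
have en := lt0r_neq0 e0.
have qn : p.1 ^+ 2 + p.2 ^+ 2 + 1 != 0 by rewrite gt_eqF// ltr_wpDl// addr_ge0 ?sqr_ge0.
by field; rewrite en qn.
Qed.

Let iU_scale (e c : R) (p : R * R) : 0 < e -> iU (c, e * p.2) = iU p.
Proof. by move=> e0; rewrite /iU /= pmulr_rgt0. Qed.

Lemma ke_iU_integrable e : 0 < e -> mu2.-integrable setT (EFin \o (fun p => ke e p * iU p)) /\
  I (fun p => ke e p * iU p) = pompeiu R.
Proof.
move=> e0.
have mk : measurable_fun setT (fun p => ke e p * iU p) by apply: mfM => //; exact: measurable_iU.
have ge0 p : 0 <= ke e p * iU p by apply: mulr_ge0 => //; have /andP[] := iU_01 p.
have E : (\int[mu2]_p (ke e p * iU p)%:E = \int[mu2]_p (k1 p * iU p)%:E)%E.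
  rewrite (mu2_affine_EFin x0 e0)//; apply: eq_integral => p _.
  by rewrite iU_scale// mulrA ke_scale.
split; last by rewrite /pompeiu /Rintegral E.
apply/integrableP; split; first exact/measurable_EFinP.
under eq_integral do rewrite /= ger0_norm//.
rewrite E; have := mul_iU_integrable (k1_integrable R) => /integrable_fin_num -/(_ measurableT).
by rewrite ge0_fin_numE//; apply: integral_ge0 => p _; rewrite lee_fin mulr_ge0 ?k1_ge0//; have /andP[] := iU_01 p.
Qed.

(** Approximate identity: the substitution of [(x0 + e * p.1, e * p.2)] for [p] turns the weight
    into the fixed profile [k1], and [u] is evaluated at points tending to [(x0, 0)]. *)
Lemma T0_lim : I (fun p => T0 u x0 (ep n) N p * iU p) @[n --> \oo] --> pompeiu R * u0.
Proof.
have [C C0 HC] := uv_bound.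
pose w p := u p * aa N p - u0.
have cw : continuous w by move=> p; rewrite /w; cont; [exact: cu|exact: aa_cont].
have w0 : w (x0, 0) = 0.
  rewrite /w /aa /= !aN1 ?normr0 ?(ltW N0)// ?mulr1 ?subrr//.
  by have := normr_ge0 x0; have := HN; lra.
have wb p : `|w p| <= C + `|u0|.
  apply: le_trans (ler_normB _ _) _; rewrite lerD2r.
  have [h1|h1] := leP `|p.1| (2 * N); last first.
    by rewrite /aa; have [-> _ _] := outb N0 (or_introl h1 : 2 * N < `|p.1| \/ 2 * N < `|p.2|); rewrite mulr0 normr0.
  have [h2|h2] := leP `|p.2| (2 * N); last first.
    by rewrite /aa; have [-> _ _] := outb N0 (or_intror h2 : 2 * N < `|p.1| \/ 2 * N < `|p.2|); rewrite mulr0 normr0.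
  have [ub _] := HC p h1 h2.
  rewrite normrM -[leRHS]mulr1; apply: ler_pM => //.
  have a0 : 0 <= aa N p by apply: mulr_ge0; exact: aN_ge0.
  by rewrite ger0_norm// /aa; apply: mulr_ile1; [exact: aN_ge0|exact: aN_ge0|exact: aN_le1|exact: aN_le1].
pose B n (p : R * R) := `|w (x0 + ep n * p.1, ep n * p.2)| * (k1 p * iU p).
have Blim : I (B n) @[n --> \oo] --> (0 : R).
  have -> : (0 : R) = I (fun=> 0 : R) by rewrite /Rintegral integral0.
  refine (proj2 (@Rdominated _ _ _ mu2 B _ (fun p => (C + `|u0|) * (k1 p * iU p)) _ _ _ _)).
  - move=> n; apply: mfM; last by apply: mfM; [exact: measurable_k1|exact: measurable_iU].
    apply: mfabs.
    have mp : measurable_fun setT (fun p : R * R => (x0 + ep n * p.1, ep n * p.2)).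
      by apply: measurable_fun_pair; meas.
    exact: (measurableT_comp (continuous_measurable_fun2 cw) mp).
  - move=> p; rewrite -[X in _ --> X](mul0r (k1 p * iU p)); apply: cvgM; last exact: cvg_cst.
    have -> : (0 : R) = `|w (x0, 0)| by rewrite w0 normr0.
    apply: cvg_norm; apply: (@cvg_comp _ _ _ (fun n => (x0 + ep n * p.1, ep n * p.2)) w _ (nbhs ((x0, 0) : R * R))); last exact: cw.
    have c1 : x0 + ep n * p.1 @[n --> \oo] --> x0.
      rewrite -[X in _ --> X](addr0 x0) -[X in _ --> _ + X](mul0r p.1).
      by apply: cvgD; [exact: cvg_cst|apply: cvgM; [exact: ep_cvg|exact: cvg_cst]].
    have c2 : ep n * p.2 @[n --> \oo] --> (0 : R).
      rewrite -[X in _ --> X](mul0r p.2).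
      by apply: cvgM; [exact: ep_cvg|exact: cvg_cst].
    exact: (cvg_pair c1 c2).
  - have := integrableZl measurableT (C + `|u0|) (mul_iU_integrable (k1_integrable R)).
    by apply: eq_integrable.
  - move=> n p; have k0 : 0 <= k1 p * iU p by rewrite mulr_ge0 ?k1_ge0//; have /andP[] := iU_01 p.
    by rewrite /B normrM normr_id (ger0_norm k0) ler_wpM2r.
have main n : `|I (fun p => T0 u x0 (ep n) N p * iU p) - pompeiu R * u0| <= I (B n).
  have [ik Ek] := ke_iU_integrable (ep0 n).
  have iT : mu2.-integrable setT (EFin \o (fun p => T0 u x0 (ep n) N p * iU p)).
    apply: mul_iU_integrable; apply: (@continuous_bx_integrable R _ (2 * N)).
      exact: T0_continuous.
    by move=> p /(outb N0)[a _ _]; rewrite /T0 a mulr0.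
  have iuk : mu2.-integrable setT (EFin \o (fun p => u0 * (ke (ep n) p * iU p))).
    by have := integrableZl measurableT u0 ik; apply: eq_integrable.
  rewrite -Ek mulrC -RintegralZl// -RintegralB//.
  have iG : mu2.-integrable setT (EFin \o (fun p => T0 u x0 (ep n) N p * iU p - u0 * (ke (ep n) p * iU p))).
    by have := integrableB measurableT iT iuk; apply: eq_integrable.
  apply: le_trans (le_normr_Rintegral measurableT iG) _.
  rewrite le_eqVlt; apply/orP; left; apply/eqP; rewrite /Rintegral; congr fine.
  have mG : measurable_fun setT (fun p => `|T0 u x0 (ep n) N p * iU p - u0 * (ke (ep n) p * iU p)|).
    by apply: mfabs; have /measurable_EFinP := measurable_int _ iG.
  rewrite (mu2_affine_EFin x0 (ep0 n))//; apply: eq_integral => p _.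
  rewrite iU_scale// /B -(ke_scale p (ep0 n)); congr (_%:E).
  set q := (x0 + _, _).
  have -> : T0 u x0 (ep n) N q * iU p - u0 * (ke (ep n) q * iU p) = w q * (ke (ep n) q * iU p).
    by rewrite /T0 /w /aa /ke; ring.
  have k0 : 0 <= ke (ep n) q * iU p by rewrite mulr_ge0//; have /andP[] := iU_01 p.
  by rewrite normrM (ger0_norm k0); ring.
apply/cvgrPdist_le => e e0; move/cvgr0Pnorm_le: Blim => /(_ e e0); apply: filterS => n Hn.
by rewrite distrC; apply: le_trans (main n) _; apply: le_trans Hn; exact: ler_norm.
Qed.

Lemma T1_lim : I (fun p => T1 u v x0 (ep n) N p * iU p) @[n --> \oo] --> I (fun p => T1 u v x0 0 N p * iU p).
Proof.
have [C HC] := T1_bound.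
refine (proj2 (@Rdominated _ _ _ mu2 _ _ (fun p => C * bx (2 * N) p) _ _ _ _)).
- move=> n; apply: mfM; last exact: measurable_iU.
  by apply: continuous_measurable_fun2; exact: T1_continuous.
- move=> p; apply: cvgM; last exact: cvg_cst.
  have dnc : rho x0 p != 0 -> dn x0 (ep n) p @[n --> \oo] --> dn x0 0 p.
    move=> _; rewrite /dn; apply: cvgD; first exact: cvg_cst.
    by rewrite !expr2; apply: cvgM; exact: ep_cvg.
  have [hz|[z1 z2]] := aN'_cases (aN' N p.1) (aN' N p.2); last first.
      rewrite /T1 z1 z2 (mul0r (aN N p.2)) (mulr0 (aN N p.1)) !mulr0 subrr.
    by under eq_fun => n do rewrite !mulr0 subrr; exact: cvg_cst.
  have r0 : rho x0 p != 0 by rewrite gt_eqF//; apply: lt_le_trans (outer_rho hz); rewrite divr_gt0 ?exprn_gt0.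
  have dn0 : dn x0 0 p != 0 by rewrite /dn expr0n addr0.
  have alc : al x0 (ep n) p @[n --> \oo] --> al x0 0 p.
    by rewrite /al; apply: cvgM; [exact: cvg_cst|apply: cvgV => //; exact: dnc].
  have bec : be x0 (ep n) p @[n --> \oo] --> be x0 0 p.
    by rewrite /be; apply: cvgM; [exact: cvg_cst|apply: cvgV => //; exact: dnc].
  rewrite /T1; apply: cvgB; apply: cvgM; try exact: cvg_cst.
    by apply: cvgB; apply: cvgM => //; exact: cvg_cst.
  by apply: cvgD; apply: cvgM => //; exact: cvg_cst.
- by have := integrableZl measurableT C (bx_integrable (2 * N)); apply: eq_integrable.
- move=> n p; rewrite normrM -[leRHS]mulr1; apply: ler_pM => //.
  by have /andP[a b] := iU_01 p; rewrite ger0_norm.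
Qed.

Lemma cae_lim : I (fun p => cae g1 g2 x0 (ep n) p * aa N p) @[n --> \oo] --> I (fun p => cau x0 p * aa N p).
Proof.
refine (proj2 (@Rdominated _ _ _ mu2 _ _ (fun p => 1 * (bx (2 * N) p + h p ^+ 2)) _ _ (dom_integrable mg1 mg2 hf 1 (2 * N)) _)).
- move=> n; have ma := continuous_measurable_fun2 (@aa_cont R N).
  have mal := continuous_measurable_fun2 (@al_continuous R x0 _ (ep0 n)).
  have mbe := continuous_measurable_fun2 (@be_continuous R x0 _ (ep0 n)).
  by rewrite /cae; meas.
- move=> p; apply: cvgM; last exact: cvg_cst.
  have [p0|p0] := leP p.2 0.
    rewrite (cauU g1U g2U _ p0).
    by under eq_fun => n do rewrite /cae g1U// g2U// !mul0r subrr; exact: cvg_cst.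
  have Rn := lt0r_neq0 (rho_gt0 x0 p0).
  have -> : cau x0 p = g1 p * ((p.1 - x0) / rho x0 p) - g2 p * (- p.2 / rho x0 p).
    by rewrite /cau; ring.
  have dnc : dn x0 (ep n) p @[n --> \oo] --> rho x0 p.
    rewrite /dn -[X in _ --> X]addr0; apply: cvgD; first exact: cvg_cst.
    have -> : (0 : R) = 0 * 0 by rewrite mul0r.
    by under eq_fun => n do rewrite expr2; apply: cvgM; exact: ep_cvg.
  rewrite /cae /al /be; apply: cvgB; (apply: cvgM; first exact: cvg_cst);
    (apply: cvgM; first exact: cvg_cst); exact: cvgV.
- move=> n p; rewrite mul1r; apply: le_trans (hh_le_dom g1 g2 (2 * N) p).
  rewrite normrM mulrC; apply: ler_pM => //; last exact: cae_le.
  rewrite /bx; case: ifPn => [_|].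
    have a0 : 0 <= aa N p by apply: mulr_ge0; exact: aN_ge0.
    by rewrite ger0_norm// /aa; apply: mulr_ile1; [exact: aN_ge0|exact: aN_ge0|exact: aN_le1|exact: aN_le1].
  by rewrite negb_and -!ltNge => /orP h1; rewrite /aa; have [-> _ _] := outb N0 h1; rewrite normr0.
Qed.

(** The real part of the Cauchy-Pompeiu formula at a boundary point, with [T1] in place of a contour
    integral at distance [N]. *)
Lemma pompeiu_formula : I (fun p => cau x0 p * aa N p) + I (fun p => T1 u v x0 0 N p * iU p) / 2 + pompeiu R * u (x0, 0) / 2 = 0.
Proof.
have E n : I (fun p => cae g1 g2 x0 (ep n) p * aa N p) =
   - (I (fun p => T0 u x0 (ep n) N p * iU p) + I (fun p => T1 u v x0 (ep n) N p * iU p)) / 2.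
  rewrite (dbar_half_plane cu cv v0 mg1 mg2 g1U g2U hf Hd1 Hd2 x0 (ep0 n) N0) -RintegralD//; last 2 first.
  - apply: mul_iU_integrable; apply: (@continuous_bx_integrable R _ (2 * N)).
      exact: T0_continuous.
    by move=> p /(outb N0)[a _ _]; rewrite /T0 a mulr0.
  - apply: mul_iU_integrable; apply: (@continuous_bx_integrable R _ (2 * N)).
      exact: T1_continuous.
    by move=> p /(outb N0)[_ a b]; rewrite /T1 a b !mulr0 subrr.
  by congr (- _ / 2); apply: eq_Rintegral => p _; rewrite mulrDl.
have L : - (I (fun p => T0 u x0 (ep n) N p * iU p) + I (fun p => T1 u v x0 (ep n) N p * iU p)) / 2
   @[n --> \oo] --> - (pompeiu R * u0 + I (fun p => T1 u v x0 0 N p * iU p)) / 2.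
  by apply: cvgM; [apply: cvgN; apply: cvgD; [exact: T0_lim|exact: T1_lim]|exact: cvg_cst].
have L' := cae_lim.
have EE : (fun n => I (fun p => cae g1 g2 x0 (ep n) p * aa N p)) =
  (fun n => - (I (fun p => T0 u x0 (ep n) N p * iU p) + I (fun p => T1 u v x0 (ep n) N p * iU p)) / 2).
  by apply/funext.
rewrite EE in L'; have -> := cvg_unique _ L' L.
  by rewrite /u0; lra.
exact: norm_hausdorff.
Qed.

End Eps.

(** Modulus squared of the partial fraction identity [1/(z-x) - (1-x)/z - x/(z-1) = x (x-1) / ((z-x)
    z (z-1))], in the real coordinates of [z = X + i y]. *)
Lemma comb_sqr (R : realType) (X y x : R) : (X - x) ^+ 2 + y ^+ 2 != 0 -> X ^+ 2 + y ^+ 2 != 0 ->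
  (X - 1) ^+ 2 + y ^+ 2 != 0 ->
  ((X - x) / ((X - x) ^+ 2 + y ^+ 2) - (1 - x) * (X / (X ^+ 2 + y ^+ 2)) - x * ((X - 1) / ((X - 1) ^+ 2 + y ^+ 2))) ^+ 2 +
  (- y / ((X - x) ^+ 2 + y ^+ 2) - (1 - x) * (- y / (X ^+ 2 + y ^+ 2)) - x * (- y / ((X - 1) ^+ 2 + y ^+ 2))) ^+ 2 =
  (x * (x - 1)) ^+ 2 / (((X - x) ^+ 2 + y ^+ 2) * (X ^+ 2 + y ^+ 2) * ((X - 1) ^+ 2 + y ^+ 2)).
Proof. by move=> h1 h2 h3; field; rewrite h1 h2 h3. Qed.

Lemma sqr_box (R : realType) (a b N : R) : `|a| <= 2 * N -> `|b| <= 2 * N -> a ^+ 2 + b ^+ 2 <= 8 * N ^+ 2.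
Proof.
rewrite -(real_normK (num_real a)) -(real_normK (num_real b)).
move: (normr_ge0 a) (normr_ge0 b); set c := `|a|; set d := `|b|; nra.
Qed.

(** * Letting the cut-off go to infinity *)

Section Limit.
Variable R : realType.
Notation mu := (@lebesgue_measure R).
Notation mu2 := (@mu2 R).
Notation I F := (Rintegral mu2 setT F).

Lemma I_bx (N : R) : 0 <= N -> I (bx N) = 4 * N ^+ 2.
Proof.
move=> N0; rewrite /Rintegral.
have -> : (\int[mu2]_p (bx N p)%:E = \int[mu2]_p (1 * (if (`|p.1| <= N) && ((- N <= p.2) && (p.2 <= N)) then 1 else 0))%:E)%E.
  by apply: eq_integral => p _; rewrite /= mul1r /bx (ler_norml p.2).
rewrite strip_integral//=; last by rewrite (le_trans _ N0) ?oppr_le0.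
ring.
Qed.

Lemma aa_01 (N : R) (p : R * R) : 0 <= aa N p <= 1.
Proof.
rewrite mulr_ge0 ?aN_ge0//=.
by apply: mulr_ile1; [exact: aN_ge0|exact: aN_ge0|exact: aN_le1|exact: aN_le1].
Qed.

Variables u v g1 g2 : R * R -> R.
Hypotheses (cu : continuous u) (cv : continuous v).
Hypothesis v0 : forall x, v (x, 0) = 0.
Hypotheses (mg1 : measurable_fun setT g1) (mg2 : measurable_fun setT g2).
Hypothesis g1U : forall p, p.2 <= 0 -> g1 p = 0.
Hypothesis g2U : forall p, p.2 <= 0 -> g2 p = 0.
Notation h := (hh g1 g2).
Notation cau := (cau g1 g2).
Notation cauN := (cauN g1 g2).
Hypothesis hf : (\int[mu2]_p (h p ^+ 2)%:E < +oo)%E.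
Hypothesis Hd1 : forall phi, test_fun_UHP phi ->
  I (fun p => g1 p * phi p) = - I (fun p => (u p * dx phi p - v p * dy phi p) / 2).
Hypothesis Hd2 : forall phi, test_fun_UHP phi ->
  I (fun p => g2 p * phi p) = - I (fun p => (v p * dx phi p + u p * dy phi p) / 2).
Hypothesis growth : forall eps : R, 0 < eps -> exists M : R, forall p : R * R, 0 <= p.2 ->
        M <= Num.sqrt (p.1 ^+ 2 + p.2 ^+ 2) ->
        Num.sqrt (u p ^+ 2 + v p ^+ 2) <= eps * (p.1 ^+ 2 + p.2 ^+ 2).
Variable x : R.

Let K0 (N : R) := 2 * `|x| + 4 <= N.

Lemma K0_all N : K0 N -> [/\ 2 * `|x| + 2 <= N, 2 * `|0 : R| + 2 <= N, 2 * `|1 : R| + 2 <= N & 0 < N].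
Proof. by rewrite /K0 normr0 normr1 => h; have := normr_ge0 x; split; lra. Qed.

Definition TT N p := T1 u v x 0 N p - (1 - x) * T1 u v 0 0 N p - x * T1 u v 1 0 N p.

Lemma dn0E (x0 : R) (p : R * R) : dn x0 0 p = rho x0 p.
Proof. by rewrite /dn expr0n addr0. Qed.

(** Orders of magnitude where the cut-off varies: each pole is at distance at least [N / 2], so the
    combined kernel is at most [8 * c / N^3]; [F] is at most [eta * 8 * N^2]; the gradient of the
    cut-off is at most [K / N]. The two terms of [T1] give the outer [2]. *)
Lemma TT_bound (N c K eta M : R) (p : R * R) : K0 N -> 0 <= K ->
  (forall t, `|aN' N t| <= K / N) -> c = `|x * (x - 1)| ->
  (forall p : R * R, 0 <= p.2 -> M <= Num.sqrt (p.1 ^+ 2 + p.2 ^+ 2) ->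
        Num.sqrt (u p ^+ 2 + v p ^+ 2) <= eta * (p.1 ^+ 2 + p.2 ^+ 2)) -> 0 < eta ->
  2 * M <= N -> `|TT N p * iU p| <= 2 * (8 * (8 * c)) * K * eta / N ^+ 2 * bx (2 * N) p.
Proof.
move=> KN K00 aK cE gr eta0 MN; have [H1 H2 H3 N0] := K0_all KN.
have c0 : 0 <= c by rewrite cE.
have [p0|p0] := leP p.2 0.
  have iU0 : iU p = 0 by rewrite /iU ltNge p0.
  by rewrite iU0 mulr0 normr0 mulr_ge0 ?bx_ge0// divr_ge0 ?sqr_ge0// !mulr_ge0// ltW.
have -> : iU p = 1 by rewrite /iU p0.
rewrite mulr1.
have [h1|h1] := leP `|p.1| (2 * N); last first.
  rewrite /TT /T1; have [_ -> ->] := outb N0 (or_introl h1 : 2 * N < `|p.1| \/ 2 * N < `|p.2|).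
  by rewrite !mulr0 subrr !mulr0 !subr0 normr0 /bx (leNgt `|p.1|) h1 /= mulr0.
have [h2|h2] := leP `|p.2| (2 * N); last first.
  rewrite /TT /T1; have [_ -> ->] := outb N0 (or_intror h2 : 2 * N < `|p.1| \/ 2 * N < `|p.2|).
  by rewrite !mulr0 subrr !mulr0 !subr0 normr0 /bx (leNgt `|p.2|) h2 andbF mulr0.
rewrite /bx h1 h2 /= mulr1.
have [hz|[z1 z2]] := aN'_cases (aN' N p.1) (aN' N p.2); last first.
  rewrite /TT /T1 z1 z2 (mul0r (aN N p.2)) (mulr0 (aN N p.1)) !mulr0 subrr !mulr0 !subr0 normr0.
  by rewrite divr_ge0 ?sqr_ge0// !mulr_ge0// ltW.
have rx := outer_rho H1 hz; have r0 := outer_rho H2 hz; have r1 := outer_rho H3 hz.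
have q0 : 0 < N ^+ 2 / 4 by rewrite divr_gt0 ?exprn_gt0.
pose AL := al x 0 p - (1 - x) * al 0 0 p - x * al 1 0 p.
pose BE := be x 0 p - (1 - x) * be 0 0 p - x * be 1 0 p.
have r0E : rho 0 p = p.1 ^+ 2 + p.2 ^+ 2 by rewrite /rho subr0.
have TE : TT N p = (u p * AL + v p * (- BE)) * (aN' N p.1 * aN N p.2) - (u p * BE + v p * AL) * (aN N p.1 * aN' N p.2).
  rewrite /TT /T1 /AL /BE.
  move: (al x 0 p) (al 0 0 p) (al 1 0 p) (be x 0 p) (be 0 0 p) (be 1 0 p) => a1 a2 a3 b1 b2 b3.
  by move: (aN' N p.1) (aN' N p.2) (aN N p.1) (aN N p.2) (u p) (v p) => *; ring.
have KB : Num.sqrt (AL ^+ 2 + BE ^+ 2) <= 8 * c / N ^+ 3.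
  have n8 : 0 <= 8 * c / N ^+ 3 by apply: divr_ge0; [exact: mulr_ge0|exact/exprn_ge0/ltW].
  rewrite -(ger0_norm n8) -sqrtr_sqr ler_wsqrtr//.
  rewrite /AL /BE /al /be !dn0E /rho subr0 comb_sqr; last 3 first.
  - by rewrite gt_eqF//; exact: lt_le_trans rx.
  - by rewrite gt_eqF// -r0E; exact: lt_le_trans r0.
  - by rewrite gt_eqF//; exact: lt_le_trans r1.
  rewrite -/(rho x p) -r0E -/(rho 1 p).
  have -> : (8 * c / N ^+ 3) ^+ 2 = (x * (x - 1)) ^+ 2 / (N ^+ 2 / 4 * (N ^+ 2 / 4) * (N ^+ 2 / 4)).
    rewrite cE -(real_normK (num_real (x * (x - 1)))); field; exact: lt0r_neq0.
  have q0' := ltW q0.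
  have P1 : 0 < N ^+ 2 / 4 * (N ^+ 2 / 4) * (N ^+ 2 / 4) by apply: mulr_gt0 => //; exact: mulr_gt0.
  have P2 : 0 < rho x p * rho 0 p * rho 1 p.
    by apply: mulr_gt0; [apply: mulr_gt0|]; [exact: lt_le_trans rx|exact: lt_le_trans r0|exact: lt_le_trans r1].
  apply: ler_wpM2l; first exact: sqr_ge0.
  rewrite lef_pV2 ?posrE//; apply: ler_pM => //; first exact: mulr_ge0.
  exact: ler_pM.
have r8 : rho 0 p <= 8 * N ^+ 2.
  by rewrite r0E sqr_box.
have FB : Num.sqrt (u p ^+ 2 + v p ^+ 2) <= eta * (8 * N ^+ 2).
  apply: (@le_trans _ _ (eta * (p.1 ^+ 2 + p.2 ^+ 2))); last by rewrite ler_pM2l// -r0E.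
  apply: gr; first exact: ltW.
  have N2 : 0 <= N / 2 by rewrite divr_ge0// ltW.
  apply: (@le_trans _ _ (N / 2)); first by rewrite ler_pdivlMr// mulrC.
  rewrite -(ger0_norm N2) -sqrtr_sqr ler_wsqrtr// -r0E.
  by have -> : (N / 2) ^+ 2 = N ^+ 2 / 4 by field.
pose Q := eta * (8 * N ^+ 2) * (8 * c / N ^+ 3).
have Q1 : `|u p * AL + v p * (- BE)| <= Q.
  apply: le_trans (cs2 _ _ _ _) _; rewrite sqrrN; apply: ler_pM; rewrite ?sqrtr_ge0//.
have Q2 : `|u p * BE + v p * AL| <= Q.
  apply: le_trans (cs2 _ _ _ _) _; rewrite (addrC (BE ^+ 2)); apply: ler_pM; rewrite ?sqrtr_ge0//.
have a1 : `|aN' N p.1 * aN N p.2| <= K / N.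
  rewrite normrM -[leRHS]mulr1; apply: ler_pM => //.
  by rewrite ger0_norm ?aN_ge0// aN_le1.
have a2 : `|aN N p.1 * aN' N p.2| <= K / N.
  rewrite normrM -[leRHS]mul1r; apply: ler_pM => //.
  by rewrite ger0_norm ?aN_ge0// aN_le1.
apply: (@le_trans _ _ (Q * (K / N) + Q * (K / N))); last first.
  rewrite le_eqVlt; apply/orP; left; apply/eqP.
  by rewrite /Q; field; exact: lt0r_neq0.
rewrite TE; apply: le_trans (ler_normB _ _) _.
by apply: lerD; rewrite normrM; apply: ler_pM.
Qed.

Lemma measurable_T1 (x0 N : R) : measurable_fun setT (T1 u v x0 0 N).
Proof.
have m1 : measurable_fun setT (fun p : R * R => aN N p.1).
  by apply: (measurableT_comp _ measurable_fst); apply: continuous_measurable_fun; exact: (dv_continuous (@aN_dv R N)).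
have m2 : measurable_fun setT (fun p : R * R => aN N p.2).
  by apply: (measurableT_comp _ measurable_snd); apply: continuous_measurable_fun; exact: (dv_continuous (@aN_dv R N)).
have m3 : measurable_fun setT (fun p : R * R => aN' N p.1).
  by apply: (measurableT_comp _ measurable_fst); apply: continuous_measurable_fun; exact: aN'_continuous.
have m4 : measurable_fun setT (fun p : R * R => aN' N p.2).
  by apply: (measurableT_comp _ measurable_snd); apply: continuous_measurable_fun; exact: aN'_continuous.
have mu' := continuous_measurable_fun2 cu; have mv' := continuous_measurable_fun2 cv.
have mal : measurable_fun setT (al x0 0) by rewrite /al /dn /rho; meas.
have mbe : measurable_fun setT (be x0 0) by rewrite /be /dn /rho; meas.
exact: (mfB (mfM (mfB (mfM mu' mal) (mfM mv' mbe)) (mfM m3 m2)) (mfM (mfD (mfM mu' mbe) (mfM mv' mal)) (mfM m1 m4))).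
Qed.

(** The formulas for the poles [x], [0] and [1] enter with weights [1], [-(1 - x)] and [-x], those
    of linear interpolation between [0] and [1]. *)
Lemma combine N : K0 N -> I (fun p => cauN x p * aa N p) + I (fun p => TT N p * iU p) / 2
   + pompeiu R / 2 * (u (x, 0) - u (0, 0) - x * (u (1, 0) - u (0, 0))) = 0.
Proof.
move=> KN; have [H1 H2 H3 N0] := K0_all KN.
have formula := pompeiu_formula cu cv v0 mg1 mg2 g1U g2U hf Hd1 Hd2.
have E1 := formula _ _ H1; have E2 := formula _ _ H2; have E3 := formula _ _ H3.
have ic s : mu2.-integrable setT (EFin \o (fun p => cau s p * aa N p)).
  apply: (@dominated_integrable _ _ _ mg1 mg2 hf _ 1 (2 * N)).
    apply: mfM; first exact: measurable_cau.
    by apply: continuous_measurable_fun2; exact: aa_cont.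
  move=> p; rewrite mul1r; apply: le_trans (hh_le_dom g1 g2 (2 * N) p).
  rewrite normrM mulrC; apply: ler_pM => //; last exact: cau_le.
  rewrite /bx; case: ifPn => [_|]; first by have /andP[a b] := aa_01 N p; rewrite ger0_norm.
  by rewrite negb_and -!ltNge => /orP h1; rewrite /aa; have [-> _ _] := outb N0 h1; rewrite normr0.
have iT s : 2 * `|s| + 2 <= N -> mu2.-integrable setT (EFin \o (fun p => T1 u v s 0 N p * iU p)).
  move=> Hs; apply: mul_iU_integrable.
  have [C HC] := T1_bound cu cv Hs.
  by apply: bounded_integrable (HC 0); exact: measurable_T1.
have lin3 (A B C : R * R -> R) : mu2.-integrable setT (EFin \o A) -> mu2.-integrable setT (EFin \o B) ->
    mu2.-integrable setT (EFin \o C) -> I (fun p => A p - (1 - x) * B p - x * C p) = I A - (1 - x) * I B - x * I C.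
  move=> iA iB iC.
  have iB' : mu2.-integrable setT (EFin \o (fun p => (1 - x) * B p)).
    by have := integrableZl measurableT (1 - x) iB; apply: eq_integrable.
  have iC' : mu2.-integrable setT (EFin \o (fun p => x * C p)).
    by have := integrableZl measurableT x iC; apply: eq_integrable.
  have iAB : mu2.-integrable setT (EFin \o (fun p => A p - (1 - x) * B p)).
    by have := integrableB measurableT iA iB'; apply: eq_integrable.
  by rewrite RintegralB// RintegralB// !RintegralZl.
have EK : I (fun p => cauN x p * aa N p) = I (fun p => cau x p * aa N p) - (1 - x) * I (fun p => cau 0 p * aa N p)
   - x * I (fun p => cau 1 p * aa N p).
  rewrite -lin3//; apply: eq_Rintegral => p _.
  by rewrite /cauN /k0; ring.
have ET : I (fun p => TT N p * iU p) = I (fun p => T1 u v x 0 N p * iU p) - (1 - x) * I (fun p => T1 u v 0 0 N p * iU p)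
   - x * I (fun p => T1 u v 1 0 N p * iU p).
  rewrite -lin3; [|exact: iT|exact: iT|exact: iT].
  by apply: eq_Rintegral => p _; rewrite /TT; ring.
rewrite EK ET.
move: E1 E2 E3; set a1 := I _; set b1 := I _; set a2 := I _; set b2 := I _; set a3 := I _; set b3 := I _.
move: (u (x, 0)) (u (0, 0)) (u (1, 0)) (pompeiu R) => U1 U2 U3 C E1 E2 E3.
have -> : a1 = - (b1 / 2 + C * U1 / 2) by lra.
have -> : a2 = - (b2 / 2 + C * U2 / 2) by lra.
have -> : a3 = - (b3 / 2 + C * U3 / 2) by lra.
ring.
Qed.

Let Nn (n : nat) : R := n.+1%:R + (2 * `|x| + 4).
Let Nn0 n : K0 (Nn n). Proof. by rewrite /K0 lerDr. Qed.

Lemma TT_lim : I (fun p => TT (Nn n) p * iU p) @[n --> \oo] --> (0 : R).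
Proof.
have [K K00 HK] := @cutoff_bound R.
pose c := `|x * (x - 1)|.
have c0 : 0 <= c by exact: normr_ge0.
apply/cvgr0Pnorm_le => e e0.
have d1 : 0 <= 2 * (8 * (8 * c)) * K by rewrite !mulr_ge0.
have d0 : 0 < 16 * (2 * (8 * (8 * c)) * K) + 1 by rewrite ltr_pwDr// mulr_ge0.
(* The square of half-width [2 * Nn n] has area [16 * Nn n ^+ 2], which cancels the decay in
   [TT_bound] and leaves this constant times [eta]. *)
pose eta := e / (16 * (2 * (8 * (8 * c)) * K) + 1).
have eta0 : 0 < eta by rewrite divr_gt0.
have [M HM] := growth eta0.
exists (Num.bound (2 * `|M|)) => // n /= Mn.
have [_ _ _ N0] := K0_all (Nn0 n).
have MN : 2 * M <= Nn n.
  apply: (@le_trans _ _ (2 * `|M|)); first by rewrite ler_pM2l// ler_norm.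
  apply: le_trans (ltW (archi_boundP _)) _; first by rewrite mulr_ge0.
  apply: (@le_trans _ _ n.+1%:R); first by rewrite ler_nat ltnW.
  by rewrite /Nn lerDl addr_ge0// mulr_ge0.
have B p := TT_bound p (Nn0 n) K00 (fun t => (HK _ t N0).1) (erefl c) HM eta0 MN.
have mT : measurable_fun setT (fun p => TT (Nn n) p * iU p).
  apply: mfM; last exact: measurable_iU.
  have m s : measurable_fun setT (T1 u v s 0 (Nn n)) := measurable_T1 s (Nn n).
  exact: (mfB (mfB (m x) (mfM (measurable_cst (1 - x)) (m 0))) (mfM (measurable_cst x) (m 1))).
have iT := bounded_integrable mT B.
apply: le_trans (le_normr_Rintegral measurableT iT) _.
have ibx : mu2.-integrable setT (EFin \o (fun p => 2 * (8 * (8 * c)) * K * eta / (Nn n) ^+ 2 * bx (2 * Nn n) p)).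
  by have := integrableZl measurableT (2 * (8 * (8 * c)) * K * eta / (Nn n) ^+ 2) (bx_integrable (2 * Nn n)); apply: eq_integrable.
apply: le_trans (le_Rintegral measurableT _ ibx (fun p _ => B p)) _.
  by have := integrable_abse iT; apply: eq_integrable.
rewrite RintegralZl//; last exact: bx_integrable.
rewrite I_bx; last by rewrite mulr_ge0// ltW.
have -> : 2 * (8 * (8 * c)) * K * eta / Nn n ^+ 2 * (4 * (2 * Nn n) ^+ 2) = 16 * (2 * (8 * (8 * c)) * K) * eta.
  by field; exact: lt0r_neq0.
by rewrite [leLHS]mulrC /eta mulrAC ler_pdivrMr// ler_pM2l// lerDl.
Qed.

(** At each fixed point the cut-off is eventually [1], and [|cauN x|] is an integrable majorant, so
    the limit of [combine] can be taken term by term. *)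
Lemma cauN_repr : I (cauN x) = - (pompeiu R / 2 * (u (x, 0) - u (0, 0) - x * (u (1, 0) - u (0, 0)))).
Proof.
have iK : mu2.-integrable setT (EFin \o cauN x) by exact: cauN_integrable.
have mK : measurable_fun setT (cauN x) by have /measurable_EFinP := measurable_int _ iK.
have L1 : I (fun p => cauN x p * aa (Nn n) p) @[n --> \oo] --> I (cauN x).
  refine (proj2 (@Rdominated _ _ _ mu2 _ _ (fun p => `|cauN x p|) _ _ _ _)).
  - move=> n; apply: mfM => //; apply: continuous_measurable_fun2; exact: aa_cont.
  - move=> p; apply/cvgrPdist_le => e e0; exists (Num.bound (`|p.1| + `|p.2|)) => // n /= pn.
    have [_ _ _ N0] := K0_all (Nn0 n).
    have le : `|p.1| + `|p.2| <= Nn n.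
      apply: le_trans (ltW (archi_boundP _)) _; first by rewrite addr_ge0.
      apply: (@le_trans _ _ n.+1%:R); first by rewrite ler_nat ltnW.
      by rewrite /Nn lerDl addr_ge0// mulr_ge0.
    rewrite /aa !aN1//.
    + by rewrite !mulr1 subrr normr0 ltW.
    + by apply: le_trans le; rewrite lerDr.
    + by apply: le_trans le; rewrite lerDl.
  - by have := integrable_abse iK; apply: eq_integrable.
  - move=> n p; rewrite normrM -[leRHS]mulr1; apply: ler_pM => //.
    by have /andP[a b] := aa_01 (Nn n) p; rewrite ger0_norm.
set Lf := pompeiu R / 2 * _.
have L2 : I (fun p => cauN x p * aa (Nn n) p) + I (fun p => TT (Nn n) p * iU p) / 2 + Lf @[n --> \oo] --> I (cauN x) + 0 / 2 + Lf.
  apply: cvgD; last exact: cvg_cst; apply: cvgD => //.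
  by apply: cvgM; [exact: TT_lim|exact: cvg_cst].
have E : (fun n => I (fun p => cauN x p * aa (Nn n) p) + I (fun p => TT (Nn n) p * iU p) / 2 + Lf) = cst 0.
  by apply/funext => n; exact: combine.
rewrite E in L2; have := cvg_unique _ L2 (cvg_cst (0 : R)).
rewrite mul0r addr0 => H; have {}H : I (cauN x) + Lf = 0 by apply: H; exact: norm_hausdorff.
by apply/eqP; rewrite -addr_eq0 H.
Qed.

End Limit.

(** * From extensions to [H32] *)

Section Reverse.
Variable R : realType.
Notation mu := (@lebesgue_measure R).
Notation mu2 := (@mu2 R).
Notation I F := (Rintegral mu2 setT F).
Variables (f : R -> R) (u v g1 g2 : R * R -> R).

(** The extension is given on the closed half-plane only. Even reflection makes it continuous on the
    plane, and [cutU] extends dbar by [0]; nothing changes in the weak equation, since test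
    functions vanish below the axis. *)
Definition refl (p : R * R) : R * R := (p.1, `|p.2|).
Definition cutU (g : R * R -> R) (p : R * R) : R := if 0 < p.2 then g p else 0.

Lemma refl_continuous (w : R * R -> R) : {within @cUHP R, continuous w} -> continuous (w \o refl).
Proof.
move=> /subspace_continuousP cw p.
have rU : @cUHP R (refl p) by rewrite /cUHP /refl /=.
have cr : refl q @[q --> p] --> refl p.
  exact: (cvg_pair (@ctfst R p) (cvg_norm (@ctsnd R p))).
apply: (@cvg_comp _ _ _ refl w _ (within (@cUHP R) (nbhs (refl p)))); last exact: cw.
move=> P /= wP.
have H : \near p, cUHP (refl p) -> P (refl p) := cr _ wP.
change (\near p, P (refl p)); apply: filterS H => q; apply.
by rewrite /cUHP /refl /=.
Qed.

Lemma measurable_UHP : measurable (@UHP R).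
Proof.
have -> : @UHP R = (fun p : R * R => 0 < p.2) @^-1` [set true] by [].
rewrite -[X in measurable X]setTI.
by have := @measurable_fun_ltr _ (R * R)%type R setT (cst 0) snd (measurable_cst _) measurable_snd measurableT [set true] Logic.I.
Qed.

Lemma cutU_patch g : cutU g = g \_ (@UHP R).
Proof.
apply/funext => p; rewrite /cutU patchE; case: ifPn => p0; first by rewrite mem_set.
by rewrite memNset// => h; rewrite h in p0.
Qed.

Lemma measurable_cutU g : measurable_fun (@UHP R) g -> measurable_fun setT (cutU g).
Proof. by move=> mg; rewrite cutU_patch; apply/(measurable_restrictT _ measurable_UHP). Qed.

Lemma int_UHP (F : R * R -> R) : (\int[mu2]_(p in @UHP R) (F p)%:E = \int[mu2]_p (cutU F p)%:E)%E.
Proof.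
rewrite integral_mkcond; apply: eq_integral => p _.
by rewrite cutU_patch !patchE; case: ifP.
Qed.

Lemma test_zero (phi : R * R -> R) (p w : R * R) : test_fun_UHP phi -> p.2 <= 0 -> phi p = 0 /\ 'D_w phi p = 0.
Proof.
move=> [_ [_ [a [b [c [d [c0 H]]]]]]] p0.
have z q : q.2 < c -> phi q = 0 by move=> qc; apply: H => -[_ /andP[h _]]; rewrite leNgt qc in h.
split; first by apply: z; exact: le_lt_trans c0.
rewrite -(derive_cst (0 : R) p w); apply: near_eq_derive.
have nc : \forall q \near p, q.2 < c.
  by have := @ctsnd R p _ (near_ltr (le_lt_trans p0 c0)).
by apply: filterS nc => q /z.
Qed.

Hypothesis hf : continuous f.
Hypothesis cu : {within @cUHP R, continuous u}.
Hypothesis cv : {within @cUHP R, continuous v}.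
Hypothesis bd : forall x : R, u (x, 0) = f x /\ v (x, 0) = 0.
Hypothesis qc : qc_deformation_UHP u v g1 g2.
Hypothesis growth : forall eps : R, 0 < eps -> exists M : R, forall p : R * R, 0 <= p.2 ->
        M <= Num.sqrt (p.1 ^+ 2 + p.2 ^+ 2) ->
        Num.sqrt (u p ^+ 2 + v p ^+ 2) <= eps * (p.1 ^+ 2 + p.2 ^+ 2).
Hypothesis energy : (\int[mu2]_(p in @UHP R) ((g1 p ^+ 2 + g2 p ^+ 2) / p.2 ^+ 2)%:E < +oo)%E.

Let U := u \o refl.
Let V := v \o refl.
Let G1 := cutU g1.
Let G2 := cutU g2.

Let UE p : 0 < p.2 -> U p = u p /\ V p = v p.
Proof. by move=> p0; rewrite /U /V /refl /= gtr0_norm//; case: p p0. Qed.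

Lemma H32_of_extension : H32 f.
Proof.
have [db [mg1 [mg2 _]]] := qc.
have cU : continuous U by exact: refl_continuous.
have cV : continuous V by exact: refl_continuous.
have V0 (x : R) : V (x, 0) = 0 by rewrite /V /refl /= normr0; have [] := bd x.
have U0 (x : R) : U (x, 0) = f x by rewrite /U /refl /= normr0; have [] := bd x.
have mG1 : measurable_fun setT G1 by exact: measurable_cutU.
have mG2 : measurable_fun setT G2 by exact: measurable_cutU.
have z1 (p : R * R) : p.2 <= 0 -> G1 p = 0 by move=> p0; rewrite /G1 /cutU ltNge p0.
have z2 (p : R * R) : p.2 <= 0 -> G2 p = 0 by move=> p0; rewrite /G2 /cutU ltNge p0.
have hfin : (\int[mu2]_p (hh G1 G2 p ^+ 2)%:E < +oo)%E.
  move: energy; rewrite int_UHP; congr (_ < _)%E; apply: eq_integral => p _; congr (_%:E).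
  rewrite /hh /cutU; case: ifPn => p0; last by rewrite expr0n.
  rewrite /G1 /G2 /cutU p0 exprMn exprVn sqr_sqrtr// addr_ge0 ?sqr_ge0//.
have RI (A B : R * R -> R) : (\int[mu2]_(p in @UHP R) (A p)%:E = - \int[mu2]_(p in @UHP R) (B p)%:E)%E ->
    I (cutU A) = - I (cutU B).
  by rewrite !int_UHP /Rintegral => ->; rewrite fineN.
have eqI (A B : R * R -> R) : A =1 B -> I A = I B by move=> AB; apply: eq_Rintegral => p _; exact: AB.
have Hd1 phi : test_fun_UHP phi -> I (fun p => G1 p * phi p) = - I (fun p => (U p * dx phi p - V p * dy phi p) / 2).
  move=> t; have [/RI E _] := db _ t.
  rewrite (eqI _ (cutU (fun p => g1 p * phi p))); last first.
    by move=> p; rewrite /G1 /cutU; case: ifP => // _; rewrite mul0r.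
  rewrite E; congr (- _); apply: eqI => p; rewrite /cutU; case: ifPn => p0.
    by have [-> ->] := UE p0.
  rewrite -leNgt in p0; rewrite /dx /dy.
  by have [_ ->] := test_zero (1, 0) t p0; have [_ ->] := test_zero (0, 1) t p0; rewrite !mulr0 subrr mul0r.
have Hd2 phi : test_fun_UHP phi -> I (fun p => G2 p * phi p) = - I (fun p => (V p * dx phi p + U p * dy phi p) / 2).
  move=> t; have [_ /RI E] := db _ t.
  rewrite (eqI _ (cutU (fun p => g2 p * phi p))); last first.
    by move=> p; rewrite /G2 /cutU; case: ifP => // _; rewrite mul0r.
  rewrite E; congr (- _); apply: eqI => p; rewrite /cutU; case: ifPn => p0.
    by have [-> ->] := UE p0.
  rewrite -leNgt in p0; rewrite /dx /dy.
  by have [_ ->] := test_zero (1, 0) t p0; have [_ ->] := test_zero (0, 1) t p0; rewrite !mulr0 addr0 mul0r.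
have gr (eps : R) : 0 < eps -> exists M : R, forall p : R * R, 0 <= p.2 ->
        M <= Num.sqrt (p.1 ^+ 2 + p.2 ^+ 2) ->
        Num.sqrt (U p ^+ 2 + V p ^+ 2) <= eps * (p.1 ^+ 2 + p.2 ^+ 2).
  move=> /growth[M HM]; exists M => p p0 Mp.
  by have := HM p p0 Mp; rewrite /U /V /refl /= ger0_norm//; case: p p0 Mp.
have rep x := cauN_repr cU cV V0 mG1 mG2 z1 z2 hfin Hd1 Hd2 gr x.
have C0 := pompeiu_gt0 R; have Cn := lt0r_neq0 C0.
(* [c] inverts the factor [pompeiu / 2] of [cauN_repr]; the affine part of [fE] interpolates [f] at
   [0] and [1]. *)
pose s := f 1 - f 0; pose c := 2 / pompeiu R.
have fE x : f x = f 0 + x * s - c * I (cauN G1 G2 x).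
  rewrite rep !U0 /c /s; field; exact: Cn.
pose w t := s - c * psi G1 G2 t.
have ip a b : a <= b -> mu.-integrable `[a, b]%classic (EFin \o psi G1 G2) by move=> ab; exact: psi_integrable.
have icst a b : mu.-integrable `[a, b]%classic (EFin \o cst s).
  apply: continuous_compact_integrable; first exact: segment_compact.
  by apply: continuous_subspaceT => z; exact: cvg_cst.
have mI a b : measurable (`[a, b]%classic : set (measurableTypeR R)) by exact: measurable_itv.
have icp a b : a <= b -> mu.-integrable `[a, b]%classic (EFin \o (fun t => c * psi G1 G2 t)).
  by move=> ab; have := integrableZl (mI a b) c (ip a b ab); apply: eq_integrable.
have iw a b : a <= b -> mu.-integrable `[a, b]%classic (EFin \o w).
  move=> ab; have := integrableB (mI a b) (icst a b) (icp a b ab).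
  by apply: eq_integrable.
apply: (H32_of_integral hf (w := w)).
- by rewrite /w; apply: mfB; [exact: measurable_cst|apply: mfM; [exact: measurable_cst|exact: measurable_psi]].
- exact: iw.
- move=> a b ab; rewrite fE (fE a).
  have -> : (\int[mu]_(t in `[a, b]) (w t)%:E = \int[mu]_(t in `[a, b]) ((cst s t)%:E - (c * psi G1 G2 t)%:E))%E.
    by apply: eq_integral => t _.
  rewrite integralB_EFin//; last exact: icp.
  have -> : (\int[mu]_(t in `[a, b]) (c * psi G1 G2 t)%:E = c%:E * \int[mu]_(t in `[a, b]) (psi G1 G2 t)%:E)%E.
    by rewrite -integralZl//; exact: ip.
  have -> : (\int[mu]_(t in `[a, b]) (cst s t)%:E = (s * (b - a))%:E)%E.
    transitivity (s%:E * mu `[a, b]%classic)%E; first exact: (integral_cst mu (mI a b) s%:E).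
    rewrite lebesgue_measure_itv/= lte_fin.
    have [ab'|ba] := ltP a b; first by rewrite -EFinB -EFinM.
    have -> : a = b by apply/le_anti; rewrite ab ba.
    by rewrite mule0 subrr mulr0.
  rewrite psi_int// -!EFinM -EFinB; congr (_%:E); ring.
have E := psi_energy mG1 mG2 z1 z2 hfin.
have m2 : measurable_fun setT (fun q : R * R => ((psi G1 G2 q.1 - psi G1 G2 q.2) ^+ 2 / (q.1 - q.2) ^+ 2)%:E).
  have mp := measurable_psi mG1 mG2.
  apply/measurable_EFinP; meas.
  - exact: (measurableT_comp mp measurable_fst).
  - exact: (measurableT_comp mp measurable_snd).
have p0 (q : R * R) : (0 <= ((psi G1 G2 q.1 - psi G1 G2 q.2) ^+ 2 / (q.1 - q.2) ^+ 2)%:E)%E.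
  by rewrite lee_fin divr_ge0 ?sqr_ge0.
(* The constant slope drops out of differences of [w], so its energy is [c^2] times that of
   [psi]. *)
have -> : (\int[mu]_s \int[mu]_t ((w s - w t) ^+ 2 / (s - t) ^+ 2)%:E =
  \int[mu]_s \int[mu]_t ((c ^+ 2)%:E * ((psi G1 G2 s - psi G1 G2 t) ^+ 2 / (s - t) ^+ 2)%:E))%E.
  apply: eq_integral => a _; apply: eq_integral => b _; rewrite -EFinM; congr (_%:E).
  by rewrite /w; ring.
have mq a : measurable_fun setT (fun b => ((psi G1 G2 a - psi G1 G2 b) ^+ 2 / (a - b) ^+ 2)%:E).
  by have := measurableT_comp m2 (measurable_pair1 a).
have -> : (\int[mu]_s \int[mu]_t ((c ^+ 2)%:E * ((psi G1 G2 s - psi G1 G2 t) ^+ 2 / (s - t) ^+ 2)%:E) =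
  (c ^+ 2)%:E * \int[mu]_s \int[mu]_t ((psi G1 G2 s - psi G1 G2 t) ^+ 2 / (s - t) ^+ 2)%:E)%E.
  rewrite -ge0_integralZl//; last 3 first.
  - exact: (@measurable_fun_fubini_tonelli_F _ _ _ _ _ mu _ m2).
  - by move=> a _; apply: integral_ge0 => b _; exact: (p0 (a, b)).
  - by rewrite lee_fin sqr_ge0.
  apply: eq_integral => a _; apply: ge0_integralZl => //.
  - exact: mq.
  - by move=> b _; exact: (p0 (a, b)).
  - by rewrite lee_fin sqr_ge0.
by apply: lte_mul_pinfty; rewrite ?lee_fin ?sqr_ge0.
Qed.

End Reverse.

(** * The averaging extension *)

Section Primitive.
Variable R : realType.
Notation mu := (@lebesgue_measure R).

Lemma continuous_integrable_itv (f : R -> R) (a b : R) : continuous f ->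
  mu.-integrable `[a, b] (EFin \o f).
Proof.
move=> cf; apply: continuous_compact_integrable; first exact: segment_compact.
exact: continuous_subspaceT.
Qed.

Lemma Rintegral_split (f : R -> R) (a b c : R) : a <= b -> b <= c ->
  mu.-integrable `[a, c] (EFin \o f) ->
  \int[mu]_(t in `[a, c]) f t = \int[mu]_(t in `[a, b]) f t + \int[mu]_(t in `[b, c]) f t.
Proof.
move=> ab bc fi.
have ibc : mu.-integrable `]b, c] (EFin \o f).
  apply: integrableS fi => //; apply: subset_itvr; rewrite bnd_simp//.
rewrite -(Rintegral_itv_obnd_cbnd ibc) -(Rintegral_itvB fi) ?bnd_simp//.
by rewrite addrC subrK.
Qed.

(** An integral over [[A, x]] is [0] for [x < A], so the base point has to move to the left with
    [x]. Subtracting the integral up to [0] makes the primitive independent of the base point, which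
    can then be held fixed near each point. *)
Lemma antiderivative_exists (f : R -> R) : continuous f -> exists G : R -> R, forall x, dv x G (f x).
Proof.
move=> cf; pose N (x : R) : R := (Num.bound `|x|).+1%:R.
have Nx x : `|x| < N x.
  by apply: lt_trans (archi_boundP _) _ => //; rewrite ltr_nat.
have N0 x : 0 < N x by rewrite ltr0n.
pose F (A x : R) := \int[mu]_(t in `[A, x]) f t - \int[mu]_(t in `[A, 0]) f t.
have FE A B z : A <= B -> B <= z -> B <= 0 -> F A z = F B z.
  move=> AB Bz B0; rewrite /F (Rintegral_split AB Bz (continuous_integrable_itv _ _ cf)).
  rewrite (Rintegral_split AB B0 (continuous_integrable_itv _ _ cf)); ring.
exists (fun x => F (- N x) x) => x.
have d1 : - N x < x by have := Nx x; rewrite ltr_norml => /andP[].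
have xx1 : x < x + 1 by rewrite ltrDl.
have [dF DF] := continuous_FTC1_closed xx1 (@continuous_integrable_itv f (- N x) (x + 1) cf) d1 (cf x).
have H : dv x (F (- N x)) (f x).
  have h : dv x (fun y => \int[mu]_(t in `[- N x, y]) f t) (f x).
    rewrite /dv -DF derive1E; exact: derivableP.
  rewrite /F; eapply dv_eq; [deriv|ring]; exact: h.
have nE : \forall y \near x, F (- N x) y = F (- N y) y.
  near=> y.
  have y1 : - N x <= y by apply: ltW; near: y; exact: near_gtr.
  have y2 : - N y <= y by have := Nx y; rewrite ltr_norml => /andP[/ltW].
  have [xy|/ltW yx] := leP (- N y) (- N x).
    by rewrite -(FE _ _ _ xy)// oppr_le0 ltW.
  by rewrite (FE _ _ _ yx)// oppr_le0 ltW.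
apply: near_eq_is_derive nE H; exact: oner_neq0.
Unshelve. all: by end_near. Qed.

Lemma dv_MVT (F f : R -> R) (a b : R) : a <= b -> (forall x, dv x F (f x)) ->
  exists2 c, a <= c <= b & F b - F a = f c * (b - a).
Proof.
move=> ab dF.
have [|c cI E] := @MVT_segment R F f a b ab (fun x _ => dF x).
  apply: continuous_subspaceT; exact: (dv_continuous dF).
by exists c => //; move: cI; rewrite in_itv.
Qed.

End Primitive.

(** * The extension and its pointwise dbar derivative *)

Section Extension.
Variable R : realType.
Variables (f G : R -> R).
Hypothesis cf : continuous f.
Hypothesis dG : forall x, dv x G (f x).

(** Averages of Beurling-Ahlfors type: for [y > 0], [ext_re] is the mean of [f] over
    [[x - y, x + y]] and [ext_im] is [1/y] times the integral of [f (x + t) - f (x - t)] over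
    [[0, y]]. With this factor the identity extends to [z]. *)
Definition ext_re (p : R * R) : R :=
  if 0 < p.2 then (G (p.1 + p.2) - G (p.1 - p.2)) / (2 * p.2) else f p.1.
Definition ext_im (p : R * R) : R :=
  if 0 < p.2 then (G (p.1 + p.2) + G (p.1 - p.2) - 2 * G p.1) / p.2 else 0.
(** For [y > 0], the classical derivatives [(u_x - v_y) / 2] and [(v_x + u_y) / 2] of the
    extension. *)
Definition dbar_re (p : R * R) : R :=
  ((G (p.1 + p.2) + G (p.1 - p.2) - 2 * G p.1) / p.2 ^+ 2 - (f (p.1 + p.2) - f (p.1 - p.2)) / (2 * p.2)) / 2.
Definition dbar_im (p : R * R) : R :=
  ((f (p.1 + p.2) + f (p.1 - p.2)) / (2 * p.2) - (G (p.1 + p.2) - G (p.1 - p.2)) / (2 * p.2 ^+ 2)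
   + (f (p.1 + p.2) + f (p.1 - p.2) - 2 * f p.1) / p.2) / 2.

(** Mean value theorem for [G]. Continuity up to the axis and growth of the extension thereby reduce
    to those of [f]. *)
Lemma ext_MVT (x y : R) : 0 < y -> exists c1 c2 c3, [/\ x - y <= c1 <= x + y, x - y <= c2 <= x + y,
  x - y <= c3 <= x + y, ext_re (x, y) = f c1 & ext_im (x, y) = f c2 - f c3].
Proof.
move=> y0; rewrite /ext_re /ext_im /= y0.
have y1 : y != 0 by rewrite gt_eqF.
have [c1 c1I E1] : exists2 c, x - y <= c <= x + y & G (x + y) - G (x - y) = f c * (x + y - (x - y)).
  by apply: dv_MVT => //; lra.
have [c2 c2I E2] : exists2 c, x <= c <= x + y & G (x + y) - G x = f c * (x + y - x).
  by apply: dv_MVT => //; lra.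
have [c3 c3I E3] : exists2 c, x - y <= c <= x & G x - G (x - y) = f c * (x - (x - y)).
  by apply: dv_MVT => //; lra.
move: c2I c3I => /andP[a1 a2] /andP[a3 a4].
exists c1, c2, c3; split => //; try (apply/andP; split; lra).
- by rewrite E1; field.
- have -> : G (x + y) + G (x - y) - 2 * G x = (G (x + y) - G x) - (G x - G (x - y)) by ring.
  by rewrite E2 E3; field.
Qed.

Let cG : continuous G := dv_continuous dG.

Let c1 (F : R -> R) (p : R * R) : continuous F -> continuous_at p (fun p : R * R => F (p.1 + p.2)).
Proof. by move=> cF; apply: (@ctcomp R (R * R)%type F (fun p => p.1 + p.2) p cF); cont. Qed.
Let c2 (F : R -> R) (p : R * R) : continuous F -> continuous_at p (fun p : R * R => F (p.1 - p.2)).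
Proof. by move=> cF; apply: (@ctcomp R (R * R)%type F (fun p => p.1 - p.2) p cF); cont. Qed.
Let c3 (F : R -> R) (p : R * R) : continuous F -> continuous_at p (fun p : R * R => F p.1).
Proof. by move=> cF; apply: (@ctcomp R (R * R)%type F fst p cF); exact: ctfst. Qed.

Definition qu (p : R * R) := (G (p.1 + p.2) - G (p.1 - p.2)) / (2 * p.2).
Definition qv (p : R * R) := (G (p.1 + p.2) + G (p.1 - p.2) - 2 * G p.1) / p.2.

Lemma near_pos (p : R * R) : 0 < p.2 -> \forall q \near p, 0 < q.2.
Proof. by move=> p0; have := @ctsnd R p _ (near_gtr p0). Qed.

Lemma ct_near (T : topologicalType) (g h : T -> R) (p : T) : (\forall q \near p, g q = h q) ->
  continuous_at p g -> continuous_at p h.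
Proof.
move=> n cg; rewrite /continuous_at -(nbhs_singleton n).
apply: cvg_trans cg; apply: near_eq_cvg; exact: n.
Qed.

Lemma qu_cont (p : R * R) : 0 < p.2 -> continuous_at p qu.
Proof.
move=> p0; rewrite /qu; cont; first [exact: c1|exact: c2|exact: c3|idtac].
by rewrite gt_eqF// mulr_gt0.
Qed.

Lemma qv_cont (p : R * R) : 0 < p.2 -> continuous_at p qv.
Proof.
move=> p0; rewrite /qv; cont; first [exact: c1|exact: c2|exact: c3|idtac].
by rewrite gt_eqF.
Qed.

Lemma dbar_re_cont (p : R * R) : 0 < p.2 -> continuous_at p dbar_re.
Proof.
move=> p0; have pn : p.2 != 0 by rewrite gt_eqF.
rewrite /dbar_re; cont; first [exact: c1|exact: c2|exact: c3|idtac].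
- by rewrite expf_neq0.
- by rewrite mulf_neq0.
Qed.

Lemma dbar_im_cont (p : R * R) : 0 < p.2 -> continuous_at p dbar_im.
Proof.
move=> p0; have pn : p.2 != 0 by rewrite gt_eqF.
rewrite /dbar_im; cont; first [exact: c1|exact: c2|exact: c3|idtac].
- by rewrite mulf_neq0.
- by rewrite mulf_neq0// expf_neq0.
- by [].
Qed.

Lemma ext_re_pos (p : R * R) : 0 < p.2 -> ext_re p = qu p. Proof. by rewrite /ext_re => ->. Qed.
Lemma ext_im_pos (p : R * R) : 0 < p.2 -> ext_im p = qv p. Proof. by rewrite /ext_im => ->. Qed.

Lemma ext_near (x0 e : R) : 0 < e -> exists2 d : R, 0 < d & forall p : R * R, `|p.1 - x0| < d -> 0 <= p.2 -> p.2 < d ->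
  `|ext_re p - f x0| <= e /\ `|ext_im p| <= e.
Proof.
move=> e0; have e2 : 0 < e / 2 by rewrite divr_gt0.
have /cvgrPdist_le H := @cf x0; have /nbhs_ballP[d /= d0 Hd] := H _ e2; clear H.
have {}Hd c : `|c - x0| < d -> `|f c - f x0| <= e / 2.
  by move=> cd; rewrite distrC; apply: Hd; rewrite /ball/= distrC.
exists (d / 2) => [|[x y] /= xd y0 yd]; first by rewrite divr_gt0.
move: y0; rewrite le_eqVlt => /predU1P[y0|y0].
  rewrite /ext_re /ext_im /= -y0 ltxx normr0; split; last exact: ltW.
  apply: le_trans (Hd x _) _; last by lra.
  by apply: lt_trans xd _; lra.
have [a [b [c [aI bI cI -> ->]]]] := ext_MVT x y0.
have near z : x - y <= z <= x + y -> `|f z - f x0| <= e / 2.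
  move=> /andP[z1 z2]; apply: Hd; move: xd; rewrite !ltr_norml => /andP[h1 h2]; apply/andP; split; lra.
split; first by apply: le_trans (near a aI) _; lra.
have := near b bI; have := near c cI; rewrite !ler_norml => /andP[h1 h2] /andP[h3 h4]; apply/andP; split; lra.
Qed.

Lemma extension_continuous : {within @cUHP R, continuous ext_re} /\ {within @cUHP R, continuous ext_im}.
Proof.
have key (h : R * R -> R) : (forall p : R * R, 0 < p.2 -> continuous_at p h) ->
   (forall x0 e : R, 0 < e -> exists2 d : R, 0 < d & forall p : R * R, `|p.1 - x0| < d -> 0 <= p.2 -> p.2 < d ->
     `|h p - h (x0, 0)| <= e) -> {within @cUHP R, continuous h}.
  move=> h1 h2; apply/subspace_continuousP => -[x0 y0] /= Up.
  move: Up; rewrite /cUHP /= le_eqVlt => /predU1P[<-|yp]; last first.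
    by apply: cvg_within_filter; exact: (h1 (x0, y0) yp).
  apply/cvgrPdist_le => e e0; have [d d0 H] := h2 x0 e e0.
  rewrite near_withinE; apply/nbhs_ballP; exists d => //= -[x y] [/= bx by_] yU.
  rewrite distrC; apply: H => //=; first by rewrite distrC.
  by move: by_; rewrite /ball/= sub0r normrN; apply: le_lt_trans; exact: ler_norm.
split; apply: key.
- move=> p p0; apply: ct_near (qu_cont p0).
  by apply: filterS (near_pos p0) => q /ext_re_pos.
- move=> x0 e e0; have [d d0 H] := ext_near x0 e0; exists d => // p p1 p2 p3.
  have [+ _] := H p p1 p2 p3; by rewrite [ext_re (x0, 0)]/ext_re /= ltxx.
- move=> p p0; apply: ct_near (qv_cont p0).
  by apply: filterS (near_pos p0) => q /ext_im_pos.
- move=> x0 e e0; have [d d0 H] := ext_near x0 e0; exists d => // p p1 p2 p3.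
  have [_ +] := H p p1 p2 p3; by rewrite [ext_im (x0, 0)]/ext_im /= ltxx subr0.
Qed.

Lemma extension_boundary (x : R) : ext_re (x, 0) = f x /\ ext_im (x, 0) = 0.
Proof. by rewrite /ext_re /ext_im /= ltxx. Qed.

Lemma measurable_dbar : measurable_fun (@UHP R) dbar_re /\ measurable_fun (@UHP R) dbar_im.
Proof.
have oU : open (@UHP R).
  by rewrite openE => p p0; exact: near_pos.
split; apply: open_continuous_measurable_fun2 => // p; rewrite inE => p0; [exact: dbar_re_cont|exact: dbar_im_cont].
Qed.

(* [dbar_re] and [dbar_im] vanish when [f] is affine, so [f] may be replaced by its remainder [phi]. *)
Lemma dbar_remainder (x y c D : R) : 0 < y ->
  (forall s, x - y <= s <= x + y -> `|f s - f x - c * (s - x)| <= D) ->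
  `|dbar_re (x, y)| <= 2 * D / y /\ `|dbar_im (x, y)| <= 2 * D / y.
Proof.
move=> y0 HD; have yn : y != 0 by rewrite gt_eqF.
pose phi s := f s - f x - c * (s - x).
(* [P] is a primitive of [phi], so the mean value theorem expresses differences of [G] by values of
   the remainder. *)
pose P s := G s - f x * (s - x) - c * (s - x) ^+ 2 / 2.
have dP s : dv s P (phi s).
  rewrite /P; eapply dv_eq; [deriv; exact: dG|]; cbv beta; rewrite /phi; by field.
have [c1' c1I E1] : exists2 c, x - y <= c <= x + y & P (x + y) - P (x - y) = phi c * (x + y - (x - y)).
  by apply: dv_MVT => //; lra.
have [c2' c2I E2] : exists2 c, x <= c <= x + y & P (x + y) - P x = phi c * (x + y - x).
  by apply: dv_MVT => //; lra.
have [c3' c3I E3] : exists2 c, x - y <= c <= x & P x - P (x - y) = phi c * (x - (x - y)).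
  by apply: dv_MVT => //; lra.
have Hp : `|phi (x + y)| <= D by apply: HD; apply/andP; split; lra.
have Hm : `|phi (x - y)| <= D by apply: HD; apply/andP; split; lra.
have H1 : `|phi c1'| <= D by apply: HD.
have H2 : `|phi c2'| <= D by apply: HD; move: c2I => /andP[? ?]; apply/andP; split; lra.
have H3 : `|phi c3'| <= D by apply: HD; move: c3I => /andP[? ?]; apply/andP; split; lra.
have A1 : dbar_re (x, y) = (phi c2' - phi c3' - (phi (x + y) - phi (x - y)) / 2) / 2 / y.
  have F1 : G (x + y) + G (x - y) - 2 * G x = y * (phi c2' - phi c3') + c * y ^+ 2.
    have -> : y * (phi c2' - phi c3') = P (x + y) - P x - (P x - P (x - y)) by rewrite E2 E3; ring.
    by rewrite /P; field.
  by rewrite /dbar_re /= F1 /phi; field.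
have A2 : dbar_im (x, y) = ((phi (x + y) + phi (x - y)) / 2 - phi c1' + (phi (x + y) + phi (x - y))) / 2 / y.
  have F1 : G (x + y) - G (x - y) = 2 * y * phi c1' + 2 * y * f x.
    have -> : 2 * y * phi c1' = P (x + y) - P (x - y) by rewrite E1; ring.
    by rewrite /P; field.
  by rewrite /dbar_im /= F1 /phi; field.
(* Each numerator is half of a combination of remainder values whose coefficients have absolute sum
   at most [4]; this gives the [2] of the bound. *)
rewrite A1 A2 !normrM (gtr0_norm (_ : 0 < y^-1)) ?invr_gt0//.
have iy : 0 <= y^-1 by rewrite invr_ge0 ltW.
clear A1 A2 E1 E2 E3 HD dP.
move: (phi c1') (phi c2') (phi c3') (phi (x + y)) (phi (x - y)) H1 H2 H3 Hp Hm => p1 p2 p3 p4 p5.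
rewrite !ler_norml => /andP[? ?] /andP[? ?] /andP[? ?] /andP[? ?] /andP[? ?].
split; apply: ler_wpM2r => //; rewrite -normrM ler_norml; apply/andP; split; lra.
Qed.

End Extension.

(** * Sup norm of dbar and growth of the extension *)

Section Bounds.
Variable R : realType.
Notation mu := (@lebesgue_measure R).
Notation mu2 := (@mu2 R).
Variables (f G w : R -> R).
Hypothesis cf : continuous f.
Hypothesis dG : forall x, dv x G (f x).
Hypothesis mw : measurable_fun setT w.
Hypothesis iw : forall a b, mu.-integrable `[a, b] (EFin \o w).
Hypothesis fw : forall a b, a <= b -> f b - f a = \int[mu]_(t in `[a, b]) w t.

Definition sqdiff (t : R) : \bar R := (\int[mu]_s ((w t - w s) ^+ 2 / (t - s) ^+ 2)%:E)%E.
Hypothesis energy : (\int[mu]_t sqdiff t < +oo)%E.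

Let K0 (t s : R) : (0 <= ((w t - w s) ^+ 2 / (t - s) ^+ 2)%:E)%E.
Proof. by rewrite lee_fin divr_ge0 ?sqr_ge0. Qed.

Let m2 : measurable_fun setT (fun q : R * R => ((w q.1 - w q.2) ^+ 2 / (q.1 - q.2) ^+ 2)%:E).
Proof.
apply/measurable_EFinP; meas.
- exact: (measurableT_comp mw measurable_fst).
- exact: (measurableT_comp mw measurable_snd).
Qed.

Let mK t : measurable_fun setT (fun s => ((w t - w s) ^+ 2 / (t - s) ^+ 2)%:E).
Proof. by have := measurableT_comp m2 (measurable_pair1 t). Qed.

Lemma sqdiff_ge0 t : (0 <= sqdiff t)%E.
Proof. by apply: integral_ge0 => s _; exact: K0. Qed.

Lemma measurable_sqdiff : measurable_fun setT sqdiff.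
Proof. exact: (@measurable_fun_fubini_tonelli_F _ _ _ _ _ mu _ m2). Qed.

Let mI a b : measurable (`[a, b]%classic : set (measurableTypeR R)). Proof. exact: measurable_itv. Qed.

Let ic a b (c : R) : mu.-integrable `[a, b] (EFin \o cst c).
Proof. by apply: continuous_integrable_itv => x; exact: cvg_cst. Qed.

Let eq_le (x y : R) : x = y -> x <= y. Proof. by move=> ->. Qed.

Lemma integrable_subcst a b c : mu.-integrable `[a, b] (EFin \o (fun t => w t - c)).
Proof.
have := integrableB (mI a b) (@iw a b) (ic a b c).
by apply: eq_integrable.
Qed.

Let mwc c : measurable_fun setT (fun t => `|w t - c|%:E).
Proof. by apply/measurable_EFinP; meas. Qed.

Lemma integral_itv_cst (a b c : R) : a <= b -> (\int[mu]_(s in `[a, b]) (cst c%:E s) = (c * (b - a))%:E)%E.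
Proof.
move=> ab; transitivity (c%:E * mu `[a, b]%classic)%E; first exact: (integral_cst mu (mI a b) c%:E).
rewrite lebesgue_measure_itv/= lte_fin; case: ltP => // ba.
have -> : a = b by apply/le_anti; rewrite ab ba.
by rewrite mule0 subrr mulr0.
Qed.

Lemma integralD_cst (a b c : R) (F : R -> \bar R) : a <= b -> 0 <= c -> measurable_fun setT F ->
  (forall x, 0 <= F x)%E ->
  (\int[mu]_(s in `[a, b]) (F s + c%:E) = \int[mu]_(s in `[a, b]) F s + (c * (b - a))%:E)%E.
Proof.
move=> ab c0 mF F0.
rewrite -(integral_itv_cst c ab); apply: ge0_integralD => //; exact: measurable_funTS.
Qed.

(** The remainder is the integral of [w - c] between [x] and [s]; the case [s < x] follows by
    antisymmetry. *)
Lemma remainder_le (a b c x s : R) : a <= x <= b -> a <= s <= b ->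
  (`|f s - f x - c * (s - x)|%:E <= \int[mu]_(t in `[a, b]) `|w t - c|%:E)%E.
Proof.
wlog xs : x s / x <= s.
  move=> H xI sI; have [xs|/ltW sx] := leP x s; first exact: H.
  rewrite (_ : f s - f x - c * (s - x) = - (f x - f s - c * (x - s))); last by ring.
  by rewrite normrN; exact: H.
move=> /andP[ax xb] /andP[as_ sb].
have -> : f s - f x - c * (s - x) = \int[mu]_(t in `[x, s]) (w t - c).
  rewrite RintegralB//; last exact: ic.
  rewrite -fw//; congr (_ - _).
  transitivity (c * fine (mu `[x, s]%classic)); last by apply/esym; exact: (Rintegral_cst mu (mI x s) c).
  rewrite lebesgue_measure_itv/= lte_fin; case: ltP => // sx.
  have -> : s = x by apply/le_anti; rewrite sx xs.
  by rewrite subrr !mulr0.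
have ia : mu.-integrable `[x, s] (EFin \o (fun t => `|w t - c|)).
  by have := integrable_abse (@integrable_subcst x s c); apply: eq_integrable.
apply: (@le_trans _ _ (\int[mu]_(t in `[x, s]) `|w t - c|%:E)%E).
  rewrite -[leRHS]fineK; last exact: integrable_fin_num.
  by rewrite lee_fin; apply: le_normr_Rintegral => //; exact: integrable_subcst.
apply: ge0_subset_integral => //.
- by apply: measurable_funTS; exact: mwc.
- by move=> t /=; rewrite !in_itv/= => /andP[? ?]; apply/andP; split; lra.
Qed.

(** With [e = |w s - w t|] and [d = |t - s|], [e <= (l/2) e^2/d^2 + d^2/(2 l)] by the inequality of
    arithmetic and geometric means. The parameter [l] balances energy against length: it is [y^2]
    for the sup norm and grows linearly with the distance for the growth of [f]. *)
Lemma AMGM_le (a b t l : R) : 0 < l -> a <= b -> a <= t <= b ->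
  (\int[mu]_(s in `[a, b]) `|w s - w t|%:E <= (l / 2)%:E * sqdiff t + ((b - a) ^+ 3 / (2 * l))%:E)%E.
Proof.
move=> l0 ab /andP[a_t tb].
have l2 : 0 <= l / 2 by rewrite divr_ge0// ltW.
pose C := (b - a) ^+ 2 / (2 * l).
have C0 : 0 <= C by rewrite divr_ge0 ?sqr_ge0// mulr_ge0// ltW.
have mKl (D : set R) : measurable_fun (D : set (measurableTypeR R)) (fun s => (l / 2 * ((w t - w s) ^+ 2 / (t - s) ^+ 2))%:E).
  apply: measurable_funTS; apply/measurable_EFinP; apply: mfM; first exact: measurable_cst.
  by have := mK t; move/measurable_EFinP.
have Kl0 s : (0 <= (l / 2 * ((w t - w s) ^+ 2 / (t - s) ^+ 2))%:E)%E.
  by rewrite lee_fin mulr_ge0// divr_ge0 ?sqr_ge0.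
apply: (@le_trans _ _ (\int[mu]_(s in `[a, b]) ((l / 2 * ((w t - w s) ^+ 2 / (t - s) ^+ 2))%:E + C%:E))%E).
  apply: ge0_le_integral => //.
  - by apply: measurable_funTS; exact: mwc.
  - by apply: emeasurable_funD => //; exact: mKl.
  - move=> s; rewrite /= in_itv/= => /andP[as_ sb]; rewrite -EFinD lee_fin.
    have [->|ts] := eqVneq s t; first by rewrite !subrr normr0 expr0n mul0r mulr0 add0r.
    have d0 : 0 < `|t - s| by rewrite normr_gt0 subr_eq0 eq_sym.
    have dab : `|t - s| <= b - a by rewrite ler_norml; apply/andP; split; lra.
    rewrite -(real_normK (num_real (t - s))) -(real_normK (num_real (w t - w s))) distrC /C.
    move: (`|w t - w s|) (`|t - s|) d0 dab => e d d0 dab.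
    apply: (@le_trans _ _ (l / 2 * (e ^+ 2 / d ^+ 2) + d ^+ 2 / (2 * l))).
      have : 0 <= (l * e / d - d) ^+ 2 / (2 * l) by rewrite divr_ge0 ?sqr_ge0// mulr_ge0// ltW.
      have -> : (l * e / d - d) ^+ 2 / (2 * l) = l / 2 * (e ^+ 2 / d ^+ 2) + d ^+ 2 / (2 * l) - e.
        by field; rewrite !gt_eqF.
      lra.
    rewrite lerD2l ler_wpM2r ?invr_ge0 ?mulr_ge0 ?(ltW l0)//.
    by rewrite ler_pXn2r// nnegrE; lra.
rewrite integralD_cst//; last exact: mKl.
apply: leeD; last by rewrite lee_fin /C; apply: eq_le; field; exact: lt0r_neq0.
apply: (@le_trans _ _ (\int[mu]_s (l / 2 * ((w t - w s) ^+ 2 / (t - s) ^+ 2))%:E)%E).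
  by apply: ge0_subset_integral => //; exact: mKl.
rewrite /sqdiff -ge0_integralZl//; exact: mK.
Qed.

Lemma dbar_le (x y c : R) : 0 < y ->
  (`|dbar_re f G (x, y)|%:E <= (2 / y)%:E * \int[mu]_(s in `[(x - y)%R, (x + y)%R]) `|w s - c|%:E /\
   `|dbar_im f G (x, y)|%:E <= (2 / y)%:E * \int[mu]_(s in `[(x - y)%R, (x + y)%R]) `|w s - c|%:E)%E.
Proof.
move=> y0.
have ia : mu.-integrable `[(x - y), (x + y)] (EFin \o (fun t => `|w t - c|)).
  by have := integrable_abse (@integrable_subcst (x - y) (x + y) c); apply: eq_integrable.
have fi : (\int[mu]_(s in `[(x - y)%R, (x + y)%R]) `|w s - c|%:E)%E \is a fin_num by exact: integrable_fin_num.
have [|h1 h2] := @dbar_remainder R f G dG x y c (fine (\int[mu]_(s in `[(x - y)%R, (x + y)%R]) `|w s - c|%:E)%E) y0.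
  move=> s sI; rewrite -lee_fin fineK//; apply: remainder_le => //.
  by apply/andP; split; lra.
rewrite -(fineK fi) -EFinM !lee_fin; rewrite mulrAC in h1; rewrite mulrAC in h2; split => //.
Qed.

(** Choose [c = w t] in [dbar_le], apply [AMGM_le] with [l = y^2], and average over [t] in
    [[x - y, x + y]]; the integral of [sqdiff] there is at most the full energy. The [8] is
    [(2/y) * (2 y)^3 / (2 y^2)]. *)
Lemma dbar_bounded : exists M : R, forall x y, 0 < y -> `|dbar_re f G (x, y)| <= M /\ `|dbar_im f G (x, y)| <= M.
Proof.
have J0 : (0 <= \int[mu]_t sqdiff t)%E by apply: integral_ge0 => t _; exact: sqdiff_ge0.
have Jf : (\int[mu]_t sqdiff t)%E \is a fin_num by rewrite ge0_fin_numE.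
exists (fine (\int[mu]_t sqdiff t)%E / 2 + 8) => x y y0.
have key (g : R) : (forall c, (`|g|%:E <= (2 / y)%:E * \int[mu]_(s in `[(x - y)%R, (x + y)%R]) `|w s - c|%:E)%E) ->
    `|g| <= fine (\int[mu]_t sqdiff t)%E / 2 + 8.
  move=> H.
  have y2 : 0 < y ^+ 2 by rewrite exprn_gt0.
  have H1 t : x - y <= t <= x + y -> (`|g|%:E <= y%:E * sqdiff t + 8%:E)%E.
    move=> tI; apply: le_trans (H (w t)) _.
    have := AMGM_le y2 _ tI; rewrite (_ : (x - y <= x + y) = true); last by apply/idP; lra.
    move=> /(_ isT) B.
    apply: (@le_trans _ _ ((2 / y)%:E * ((y ^+ 2 / 2)%:E * sqdiff t + ((x + y - (x - y)) ^+ 3 / (2 * y ^+ 2))%:E)))%E.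
      by apply: lee_wpmul2l => //; rewrite lee_fin divr_ge0// ltW.
    rewrite ge0_muleDr ?mule_ge0 ?sqdiff_ge0 ?lee_fin//; last 2 first.
    - by rewrite divr_ge0// ltW.
    - by rewrite divr_ge0 ?exprn_ge0 ?mulr_ge0 ?(ltW y2)//; lra.
    rewrite muleA -!EFinM; apply: leeD.
      by rewrite (_ : 2 / y * (y ^+ 2 / 2) = y)//; field; rewrite gt_eqF.
    by rewrite lee_fin; apply: eq_le; field; rewrite gt_eqF.
  have H2 : (\int[mu]_(t in `[(x - y)%R, (x + y)%R]) (cst `|g|%:E t) <=
             \int[mu]_(t in `[(x - y)%R, (x + y)%R]) (y%:E * sqdiff t + cst 8%:E t))%E.
    apply: ge0_le_integral => //.
    - by move=> t _; rewrite lee_fin.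
    - apply: emeasurable_funD => //; apply: measurable_funeM; apply: measurable_funTS; exact: measurable_sqdiff.
  have mJ : measurable_fun (`[(x - y)%R, (x + y)%R]%classic : set (measurableTypeR R)) sqdiff by apply: measurable_funTS; exact: measurable_sqdiff.
  have H3 : (\int[mu]_(t in `[(x - y)%R, (x + y)%R]) (y%:E * sqdiff t) <= y%:E * \int[mu]_t sqdiff t)%E.
    rewrite ge0_integralZl//; last 2 first.
    - by move=> t _; exact: sqdiff_ge0.
    - by rewrite lee_fin ltW.
    apply: lee_wpmul2l; first by rewrite lee_fin ltW.
    apply: ge0_subset_integral => //; [exact: measurable_sqdiff|by move=> t _; exact: sqdiff_ge0].
  have H4 : (\int[mu]_(t in `[(x - y)%R, (x + y)%R]) (cst `|g|%:E t) = (`|g| * (2 * y))%:E)%E.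
    by rewrite integral_itv_cst; [congr (_%:E); ring|lra].
  move: H2; rewrite H4 integralD_cst//; last 3 first.
  - by lra.
  - by apply: measurable_funeM; exact: measurable_sqdiff.
  - by move=> t; rewrite mule_ge0 ?sqdiff_ge0 ?lee_fin// ltW.
  move=> /le_trans /(_ (leeD2r _ H3)); rewrite -(fineK Jf) -!EFinM -EFinD lee_fin.
  move: (fine _) => E; move: (`|g|) => n Hn.
  have : n * (2 * y) <= (E / 2 + 8) * (2 * y).
    by apply: le_trans Hn _; apply: eq_le; field.
  by rewrite ler_pM2r// mulr_gt0.
by split; apply: key => c; have [] := dbar_le x c y0.
Qed.

Let eq_leE (x y : \bar R) : x = y -> (x <= y)%E. Proof. by move=> ->. Qed.

Lemma exists_sqdiff_fin : exists t, sqdiff t \is a fin_num.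
Proof.
apply: contrapT => H.
have Hoo t : sqdiff t = +oo%E.
  apply/eqP; rewrite -leye_eq leNgt; apply/negP => h.
  by apply: H; exists t; rewrite ge0_fin_numE// sqdiff_ge0.
have : (+oo <= \int[mu]_t sqdiff t)%E.
  apply: (@le_trans _ _ (\int[mu]_(t in `[0%R, 1%R]) sqdiff t)%E); last first.
    by apply: ge0_subset_integral => //; [exact: measurable_sqdiff|move=> t _; exact: sqdiff_ge0].
  have -> : (\int[mu]_(t in `[0%R, 1%R]) sqdiff t = \int[mu]_(t in `[0%R, 1%R]) (cst +oo%E t))%E.
    by apply: eq_integral => t _; exact: Hoo.
  apply: (@le_trans _ _ (+oo * mu `[0%R, 1%R]%classic)%E).
    by rewrite lebesgue_measure_itv/= lte_fin ltr01 oppr0 adde0 mule1.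
  by apply: eq_leE; apply/esym; exact: (integral_cst mu (mI 0 1) +oo%E).
by rewrite leNgt energy.
Qed.

(** One point [t0] with finite [sqdiff w t0] suffices: from the line of slope [w t0] through its
    point on the graph, [f] deviates by at most an affine function of the distance plus [e / 4]
    times its square. *)
Lemma growth_f (e : R) : 0 < e -> exists2 M : R, 0 <= M & forall s, `|f s| <= e * s ^+ 2 + M.
Proof.
move=> e0; have [t0 Jt] := exists_sqdiff_fin.
have J0 : 0 <= fine (sqdiff t0) by rewrite fine_ge0// sqdiff_ge0.
have key s : `|f s - f t0 - w t0 * (s - t0)| <= (1 + `|s - t0|) / e * fine (sqdiff t0) + e / 4 * `|s - t0| ^+ 2.
  pose a := Num.min t0 s; pose b := Num.max t0 s.
  have ba : b - a = `|s - t0|.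
    by rewrite /a /b; case: (leP t0 s) => h; [rewrite ger0_norm|rewrite ltr0_norm]; lra.
  have tI : a <= t0 <= b by rewrite /a /b ge_min le_max lexx.
  have sI : a <= s <= b by rewrite /a /b ge_min le_max lexx !orbT.
  have ab : a <= b by move: tI => /andP[]; exact: le_trans.
  have r0 : 0 <= `|s - t0| by [].
  (* This is the parameter [l] of [AMGM_le]: it makes [r^3 / (2 l)] at most [e / 4 * r^2] for
     [r = |s - t0|], and the [1 +] keeps it positive at [s = t0]. *)
  have l0 : 0 < 2 * (1 + `|s - t0|) / e by rewrite divr_gt0// mulr_gt0// ltr_pwDl.
  have := le_trans (remainder_le (w t0) tI sI) (AMGM_le l0 ab tI).
  rewrite ba -(fineK Jt) -EFinM -EFinD lee_fin => h; apply: le_trans h _.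
  move: (fine _) (`|s - t0|) r0 J0 l0 => J r r0 J0 l0.
  apply: lerD; first by apply: ler_wpM2r => //; apply: eq_le; field; exact: lt0r_neq0.
  have -> : r ^+ 3 / (2 * (2 * (1 + r) / e)) = e / 4 * (r ^+ 2 * (r / (1 + r))).
    by field; rewrite !gt_eqF// ltr_pwDl.
  apply: ler_wpM2l; first by rewrite divr_ge0// ltW.
  rewrite ler_piMr ?sqr_ge0// ler_pdivrMr ?mul1r; last by rewrite ltr_pwDl.
  by rewrite lerDr.
pose J := fine (sqdiff t0); pose A := `|f t0| + J / e; pose B := `|w t0| + J / e.
have Je : 0 <= J / e by rewrite divr_ge0// ltW.
have A0 : 0 <= A by rewrite addr_ge0.
exists (A + B ^+ 2 / e + e * t0 ^+ 2).
  apply: addr_ge0; last by rewrite mulr_ge0 ?sqr_ge0// ltW.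
  by apply: addr_ge0 => //; rewrite divr_ge0 ?sqr_ge0// ltW.
move=> s; have := key s; rewrite -/J.
have fs : `|f s| <= `|f s - f t0 - w t0 * (s - t0)| + `|f t0| + `|w t0| * `|s - t0|.
  rewrite -normrM; have -> : f s = (f s - f t0 - w t0 * (s - t0)) + f t0 + w t0 * (s - t0) by ring.
  rewrite (_ : (f s - f t0 - w t0 * (s - t0)) + f t0 + w t0 * (s - t0) - f t0 - w t0 * (s - t0) = f s - f t0 - w t0 * (s - t0)); last by ring.
  by apply: le_trans (ler_normD _ _) _; rewrite lerD2r ler_normD.
move=> h; apply: (le_trans fs).
have r2 : `|s - t0| ^+ 2 <= 2 * s ^+ 2 + 2 * t0 ^+ 2.
  rewrite real_normK ?num_real//; have : 0 <= (s + t0) ^+ 2 by rewrite sqr_ge0.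
  nra.
(* A completed square absorbs the linear term [B * |s - t0|] into [e / 4 * |s - t0|^2] and a
   constant. *)
have sq : 0 <= (e / 2 * `|s - t0| - B) ^+ 2 / e by rewrite divr_ge0 ?sqr_ge0// ltW.
have sqE : (e / 2 * `|s - t0| - B) ^+ 2 / e = e / 4 * `|s - t0| ^+ 2 - B * `|s - t0| + B ^+ 2 / e.
  by field; exact: lt0r_neq0.
rewrite sqE in sq.
have hE : (1 + `|s - t0|) / e * J + e / 4 * `|s - t0| ^+ 2 = J / e + J / e * `|s - t0| + e / 4 * `|s - t0| ^+ 2 by ring.
rewrite hE in h.
have r3 : e / 2 * `|s - t0| ^+ 2 <= e / 2 * (2 * s ^+ 2 + 2 * t0 ^+ 2) by rewrite ler_wpM2l// divr_ge0// ltW.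
have BE : B * `|s - t0| = `|w t0| * `|s - t0| + J / e * `|s - t0| by rewrite /B mulrDl.
rewrite BE in sq; rewrite /A.
move: (`|f s - _ - _|) (`|w t0| * _) (`|s - t0| ^+ 2) (`|f t0|) (J / e) (J / e * _) (B ^+ 2 / e) h sq r3 => a1 a2 a4 a5 a6 a3 a7.
move: (s ^+ 2) (t0 ^+ 2) => a8 a9.
have -> : e / 2 * (2 * a8 + 2 * a9) = e * a8 + e * a9 by field.
have -> : e / 2 * a4 = e / 4 * a4 + e / 4 * a4 by field.
move: (e / 4 * a4) (e * a8) (e * a9) => *; lra.
Qed.

Lemma growth_ext (e : R) : 0 < e -> exists M : R, forall p : R * R, 0 <= p.2 ->
  M <= Num.sqrt (p.1 ^+ 2 + p.2 ^+ 2) ->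
  Num.sqrt (ext_re f G p ^+ 2 + ext_im G p ^+ 2) <= e * (p.1 ^+ 2 + p.2 ^+ 2).
Proof.
move=> e0; have e12 : 0 < e / 12 by rewrite divr_gt0.
have [M M0 HM] := growth_f e12.
(* The [1] yields [sqrt r <= r], hence [6 * M <= e * r]. Points within [y] of [x] satisfy
   [c^2 <= 2 * r], so [e / 12] becomes [e / 6], and the modulus is at most three times
   [e / 6 * r + M]. *)
exists (1 + 6 * M / e) => -[x y] /= y0.
set r := x ^+ 2 + y ^+ 2 => Mr.
have r0 : 0 <= r by rewrite addr_ge0 ?sqr_ge0.
have Me : 0 <= 6 * M / e by rewrite divr_ge0 ?mulr_ge0// ltW.
have sr : Num.sqrt r <= r.
  rewrite -{2}(sqr_sqrtr r0) expr2 ler_peMl ?sqrtr_ge0//; lra.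
have MrE : 6 * M <= e * r.
  have : 6 * M / e <= r by lra.
  by rewrite ler_pdivrMr// (mulrC r).
have near c : x - y <= c <= x + y -> `|f c| <= e / 6 * r + M.
  move=> /andP[c1 c2]; apply: le_trans (HM c) _; rewrite lerD2r.
  have -> : e / 6 * r = e / 12 * (2 * r) by field.
  rewrite ler_pM2l// /r.
  have [c0|c0] := leP 0 c.
    have : c ^+ 2 <= (x + y) ^+ 2 by rewrite ler_pXn2r// nnegrE; lra.
    have := sqr_ge0 (x - y); nra.
  have : c ^+ 2 <= (x - y) ^+ 2.
    by rewrite -[c ^+ 2]sqrrN -[leRHS]sqrrN ler_pXn2r// ?nnegrE; lra.
  have := sqr_ge0 (x + y); nra.
have [T0 [uT vT]] : 0 <= e / 6 * r + M /\ (`|ext_re f G (x, y)| <= e / 6 * r + M /\ `|ext_im G (x, y)| <= 2 * (e / 6 * r + M)).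
  have T0 : 0 <= e / 6 * r + M by rewrite addr_ge0// mulr_ge0// divr_ge0// ltW.
  split => //; move: y0; rewrite le_eqVlt => /predU1P[y0|y0].
    rewrite /ext_re /ext_im /= -y0 ltxx normr0; split; last by rewrite mulr_ge0.
    by apply: near; rewrite -y0 subr0 addr0 lexx.
  have [a [b [c [aI bI cI -> ->]]]] := @ext_MVT R f G dG x y y0.
  split; first exact: near.
  by apply: le_trans (ler_normB _ _) _; have := near b bI; have := near c cI; lra.
apply: (@le_trans _ _ (3 * (e / 6 * r + M))); last by lra.
rewrite -[leRHS]ger0_norm ?mulr_ge0// -sqrtr_sqr ler_wsqrtr//.
move: uT vT; rewrite -(real_normK (num_real (ext_re f G (x, y)))) -(real_normK (num_real (ext_im G (x, y)))).
move: (`|ext_re f G (x, y)|) (`|ext_im G (x, y)|) (normr_ge0 (ext_re f G (x, y))) (normr_ge0 (ext_im G (x, y))) T0.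
move: (e / 6 * r + M) => T a b a0 b0 T0 aT bT.
have : a ^+ 2 <= T ^+ 2 by rewrite ler_pXn2r// nnegrE.
have : b ^+ 2 <= (2 * T) ^+ 2 by rewrite ler_pXn2r// nnegrE mulr_ge0.
rewrite !exprMn; have := sqr_ge0 T; lra.
Qed.

End Bounds.

(** * Energy of the averaging extension *)

Section Energy.
Variable R : realType.
Notation mu := (@lebesgue_measure R).
Notation mu2 := (@mu2 R).
Variables (f G w : R -> R).
Hypothesis cf : continuous f.
Hypothesis dG : forall x, dv x G (f x).
Hypothesis mw : measurable_fun setT w.
Hypothesis iw : forall a b, mu.-integrable `[a, b] (EFin \o w).
Hypothesis fw : forall a b, a <= b -> f b - f a = \int[mu]_(t in `[a, b]) w t.
Hypothesis energy : (\int[mu]_t sqdiff w t < +oo)%E.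

(** The factor [(|x - s| + y)^-3] is comparable to [y^-3] on the window [|x - s| <= y] over which
    dbar averages, and its integral over [y] is of order [|x - s|^-2]; it links the pointwise
    estimate of dbar to the energy of [w]. *)
Definition eker (p : R * R) (s : R) : R :=
  if 0 < p.2 then (w p.1 - w s) ^+ 2 / (`|p.1 - s| + p.2) ^+ 3 else 0.

Let eker_ge0 p s : 0 <= eker p s.
Proof.
rewrite /eker; case: ifPn => // p0.
by rewrite divr_ge0 ?sqr_ge0// exprn_ge0// addr_ge0// ltW.
Qed.

Let mLL d (T : measurableType d) (a b c : T -> R) : measurable_fun setT a -> measurable_fun setT b ->
  measurable_fun setT c -> measurable_fun setT (fun z => eker (a z, b z) (c z)).
Proof.
move=> ma mb mc; rewrite /eker /=; apply: mfif; first by apply: mflt.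
- by meas; [exact: (measurableT_comp mw ma)|exact: (measurableT_comp mw mc)].
- exact: measurable_cst.
Qed.

(** For [d = |x - s|], [(d + y)^3 >= d * (y^2 + d^2)] reduces the integral over [y] to the Poisson
    bound. *)
Lemma eker_inner (x s : R) :
  (\int[mu]_y (eker (x, y) s)%:E <= (pi * ((w x - w s) ^+ 2 / (x - s) ^+ 2))%:E)%E.
Proof.
have [->|xs] := eqVneq x s.
  rewrite !subrr expr0n mul0r mulr0.
  have -> : (\int[mu]_y (eker (s, y) s)%:E = \int[mu]_y (cst 0%E y))%E.
    apply: eq_integral => y _; rewrite /eker /=; case: ifP => // _.
    by rewrite !subrr expr0n mul0r.
  by rewrite integral0.
have d0 : 0 < `|x - s| by rewrite normr_gt0 subr_eq0.
have c0 : 0 <= (w x - w s) ^+ 2 / (x - s) ^+ 2 by rewrite divr_ge0 ?sqr_ge0.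
rewrite [leRHS](_ : _ = ((w x - w s) ^+ 2 / (x - s) ^+ 2 * pi)%:E); last by rewrite mulrC.
apply: le_trans (poisson_mul_le 0 d0 c0).
apply: ge0_le_integral => //.
- by move=> y _; rewrite lee_fin.
- by apply/measurable_EFinP; apply: mLL => //; exact: measurable_cst.
- by apply/measurable_EFinP; meas.
- move=> y _; rewrite lee_fin subr0 -(real_normK (num_real (x - s))).
  rewrite /eker /=; case: ifPn => y0; last by rewrite mulr_ge0 ?divr_ge0 ?addr_ge0 ?sqr_ge0.
  move: (`|x - s|) d0 (sqr_ge0 (w x - w s)) => d d0.
  move: ((w x - w s) ^+ 2) => e e0.
  have -> : e / d ^+ 2 * (d / (y ^+ 2 + d ^+ 2)) = e / (d * (y ^+ 2 + d ^+ 2)).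
    by field; rewrite !gt_eqF// addr_gt0// exprn_gt0.
  rewrite ler_wpM2l// lef_pV2 ?posrE; last 2 first.
  - by rewrite exprn_gt0// addr_gt0.
  - by rewrite mulr_gt0// addr_gt0// exprn_gt0.
  have h1 : 0 <= d * y by rewrite mulr_ge0// ltW.
  have h2 : 0 <= y * (d + y) ^+ 2 by rewrite mulr_ge0 ?sqr_ge0// ltW.
  have h3 : 0 <= d * (d * y) by rewrite mulr_ge0// ltW.
  have -> : (d + y) ^+ 3 = d * (y ^+ 2 + d ^+ 2) + 2 * (d * (d * y)) + y * (d + y) ^+ 2 by ring.
  lra.
Qed.

Lemma integral_near (x y : R) (h : R -> R) :
  (\int[mu]_s ((if y < `|x - s| then 0 else 1) * h s)%:E = \int[mu]_(s in `[(x - y)%R, (x + y)%R]) (h s)%:E)%E.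
Proof.
rewrite [RHS]integral_mkcond; apply: eq_integral => s _.
rewrite patchE mem_setE /= in_itv /= ltNge ler_norml.
have -> : (- y <= x - s <= y) = (x - y <= s <= x + y).
  by apply/andP/andP => -[? ?]; split; lra.
by case: (x - y <= s <= x + y); rewrite ?mul0r ?mul1r.
Qed.

(** Cauchy-Schwarz on the window of length [2 * y], where [(|x - s| + y)^3 <= 8 * y^3], gives
    [D^2 <= 16 y^4 Q]. Each component of dbar is at most [(2/y) D], so [128 = 2 * 4 * 16]. *)
Lemma dbar_sqr_le (p : R * R) : 0 < p.2 ->
  (((dbar_re f G p ^+ 2 + dbar_im f G p ^+ 2) / p.2 ^+ 2)%:E <= 128%:E * \int[mu]_s (eker p s)%:E)%E.
Proof.
case: p => x y /= y0.
have mLs : measurable_fun setT (fun s => eker (x, y) s).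
  by apply: mLL => //; exact: measurable_cst.
pose Q := (\int[mu]_s (eker (x, y) s)%:E)%E.
have Q0 : (0 <= Q)%E by apply: integral_ge0 => s _; rewrite lee_fin.
rewrite -/Q; have [Qf|Qoo] := boolP (Q \is a fin_num); last first.
  by move: Qoo; rewrite ge0_fin_numE// -leNgt leye_eq => /eqP ->; rewrite gt0_muley ?leey ?lte_fin.
pose D := (\int[mu]_(s in `[(x - y)%R, (x + y)%R]) `|w s - w x|%:E)%E.
have [h1 h2] := dbar_le dG mw iw fw x (w x) y0.
rewrite -/D in h1 h2.
pose a (s : R) : R := if y < `|x - s| then 0 else 1.
have a0 s : 0 <= a s by rewrite /a; case: ifP.
have ma : measurable_fun setT a.
  by apply: mfif; [apply: mflt; [exact: measurable_cst|meas]|exact: measurable_cst|exact: measurable_cst].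
have DE : D = (\int[mu]_s (a s * `|w s - w x|)%:E)%E by rewrite integral_near.
have aE : (\int[mu]_s (a s)%:E = (2 * y)%:E)%E.
  transitivity (\int[mu]_s (a s * cst 1 s)%:E)%E; first by apply: eq_integral => s _; rewrite mulr1.
  rewrite integral_near; transitivity (1 * (x + y - (x - y)))%:E.
    by rewrite -integral_itv_cst//; lra.
  by congr (_%:E); ring.
have CS := @cauchy_schwarz R _ _ mu a (fun s => 8 * y ^+ 3 * eker (x, y) s) (fun s => a s * `|w s - w x|).
have y3 : 0 <= 8 * y ^+ 3 by rewrite mulr_ge0// exprn_ge0// ltW.
have {}CS : (D * D <= (2 * y)%:E * ((8 * y ^+ 3)%:E * Q))%E.
  have -> : ((8 * y ^+ 3)%:E * Q = \int[mu]_s (8 * y ^+ 3 * eker (x, y) s)%:E)%E.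
    apply/esym; transitivity (\int[mu]_s ((8 * y ^+ 3)%:E * (eker (x, y) s)%:E))%E.
      by apply: eq_integral => s _; rewrite EFinM.
    apply: ge0_integralZl => //; first exact/measurable_EFinP.
    by move=> s _; rewrite lee_fin.
  rewrite DE -aE; apply: CS => //.
  - by apply: mfM => //; exact: measurable_cst.
  - by meas.
  - by move=> s; rewrite mulr_ge0.
  - by move=> s; rewrite mulr_ge0.
  - move=> s; rewrite exprMn real_normK ?num_real// /a; case: ltP => ys; first by rewrite expr0n !mul0r.
    rewrite expr1n !mul1r /eker /= y0 -(sqrrN (w s - w x)) opprB.
    rewrite mulrCA ler_peMr ?sqr_ge0//.
    rewrite ler_pdivlMr ?mul1r; last by rewrite exprn_gt0// ltr_wpDl.
    have -> : 8 * y ^+ 3 = (2 * y) ^+ 3 by ring.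
    by rewrite ler_pXn2r// ?nnegrE ?addr_ge0 ?mulr_ge0 ?(ltW y0)//; lra.
have Df : D \is a fin_num.
  apply: integrable_fin_num => //.
  by have := integrable_abse (integrable_subcst iw (x - y) (x + y) (w x)); apply: eq_integrable => //; exact: measurable_itv.
move: CS h1 h2; rewrite -(fineK Df) -(fineK Qf) -!EFinM !lee_fin.
move: (fine D) (fine Q) (dbar_re _ _ _) (dbar_im _ _ _) => d q g1 g2 CS h1 h2.
have d0 : 0 <= 2 / y * d by apply: le_trans h1.
have S g : `|g| <= 2 / y * d -> g ^+ 2 <= 4 / y ^+ 2 * (2 * y * (8 * y ^+ 3 * q)).
  move=> h; rewrite -(real_normK (num_real g)); apply: (@le_trans _ _ ((2 / y * d) ^+ 2)).
    by rewrite ler_pXn2r// nnegrE.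
  have -> : (2 / y * d) ^+ 2 = 4 / y ^+ 2 * (d * d) by field; exact: lt0r_neq0.
  by apply: ler_wpM2l => //; rewrite divr_ge0 ?sqr_ge0.
rewrite ler_pdivrMr ?exprn_gt0//.
apply: le_trans (lerD (S _ h1) (S _ h2)) _.
rewrite le_eqVlt; apply/orP; left; apply/eqP; field; exact: lt0r_neq0.
Qed.

(** Tonelli with the height integrated first: [eker_inner] then leaves [pi] times the energy of
    [w]. *)
Lemma dbar_energy :
  (\int[mu2]_(p in @UHP R) ((dbar_re f G p ^+ 2 + dbar_im f G p ^+ 2) / p.2 ^+ 2)%:E < +oo)%E.
Proof.
have mL3 : measurable_fun setT (fun z : (R * R) * R => (eker z.1 z.2)%:E).
  apply/measurable_EFinP.
  have := @mLL _ _ (fun z : (R * R) * R => z.1.1) (fun z => z.1.2) snd ltac:(meas) ltac:(meas) ltac:(meas).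
  by apply: eq_measurable_fun => -[[a b] c] _.
have L30 (z : (R * R) * R) : (0 <= (eker z.1 z.2)%:E)%E by rewrite lee_fin.
have mQ : measurable_fun setT (fun p : R * R => \int[mu]_s (eker p s)%:E)%E.
  exact: (@measurable_fun_fubini_tonelli_F _ _ _ _ _ mu _ mL3).
have Q0 p : (0 <= \int[mu]_s (eker p s)%:E)%E by apply: integral_ge0 => s _; rewrite lee_fin.
have [mg1 mg2] := measurable_dbar cf dG.
have mm : measurable_fun (@UHP R) (fun p : R * R => 128%:E * \int[mu]_s (eker p s)%:E)%E.
  by apply: measurable_funeM; exact: measurable_funTS.
apply: (@le_lt_trans _ _ (\int[mu2]_(p in @UHP R) (128%:E * \int[mu]_s (eker p s)%:E))%E).
  apply: ge0_le_integral => //.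
  - exact: measurable_UHP.
  - by move=> p _; rewrite lee_fin divr_ge0 ?addr_ge0 ?sqr_ge0.
  - apply/measurable_EFinP; apply: mfM; first by apply: mfD; apply: mfX.
    by apply: mfV; apply: mfX; apply: measurable_funTS; exact: measurable_snd.
  - by move=> p; exact: dbar_sqr_le.
apply: (@le_lt_trans _ _ (\int[mu2]_p (128%:E * \int[mu]_s (eker p s)%:E))%E).
  apply: ge0_subset_integral; [exact: measurable_UHP|exact: measurableT|exact: measurable_funeM| |exact: subsetT].
  by move=> p _; apply: mule_ge0; [rewrite lee_fin|exact: Q0].
rewrite ge0_integralZl//.
apply: lte_mul_pinfty => //.
rewrite (mu2_tonelli1 mQ Q0).
apply: (@le_lt_trans _ _ (\int[mu]_x (pi%:E * sqdiff w x))%E); last first.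
  rewrite ge0_integralZl//; last 3 first.
  - exact: measurable_sqdiff.
  - by move=> x _; exact: sqdiff_ge0.
  - by rewrite lee_fin pi_ge0.
  by apply: lte_mul_pinfty => //; rewrite lee_fin pi_ge0.
have mxs (x : R) : measurable_fun setT (fun z : R * R => (eker (x, z.1) z.2)%:E).
  apply/measurable_EFinP; apply: mLL; [exact: measurable_cst|meas|meas].
apply: ge0_le_integral => //.
- by move=> x _; apply: integral_ge0 => y _; exact: Q0.
- exact: (@measurable_fun_fubini_tonelli_F _ _ _ _ _ mu _ mQ).
- by apply: measurable_funeM; exact: measurable_sqdiff.
move=> x _.
have T := @tonelli_in _ _ _ _ R mu mu setT measurableT (fun z : R * R => (eker (x, z.1) z.2)%:E) (mxs x) (fun z => L30 ((x, z.1), z.2)).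
have mK : measurable_fun setT (fun s => ((w x - w s) ^+ 2 / (x - s) ^+ 2)%:E).
  by apply/measurable_EFinP; meas; exact: measurableT_comp mw measurable_id.
have -> : (pi%:E * sqdiff w x = \int[mu]_s (pi%:E * ((w x - w s) ^+ 2 / (x - s) ^+ 2)%:E))%E.
  apply/esym; apply: ge0_integralZl; [exact: measurableT|exact: mK| |].
  - by move=> s _; rewrite lee_fin divr_ge0 ?sqr_ge0.
  - by rewrite lee_fin pi_ge0.
rewrite T.
apply: ge0_le_integral => //.
- by move=> s _; apply: integral_ge0 => y _; rewrite lee_fin.
- have := @measurable_fun_fubini_tonelli_G _ _ _ _ _ mu _ (mxs x); apply => z; exact: (L30 ((x, z.1), z.2)).
- exact: measurable_funeM.
- by move=> s _; rewrite -EFinM; exact: eker_inner.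
Qed.

End Energy.

(** * The distributional dbar derivative *)

Section Dbar.
Variable R : realType.
Notation mu := (@lebesgue_measure R).
Notation mu2 := (@mu2 R).
Notation I F := (Rintegral mu2 setT F).

Lemma integral_deriv_supp (F F' : R -> R) (N : R) : 0 < N -> (forall x, dv x F (F' x)) -> continuous F' ->
  (forall x, N < `|x| -> F x = 0 /\ F' x = 0) -> (\int[mu]_x (F' x)%:E = 0)%E.
Proof.
move=> N0 dF cF' Z.
have -> : (\int[mu]_x (F' x)%:E = \int[mu]_(x in `[(- (N + 1))%R, (N + 1)%R]) (F' x)%:E)%E.
  rewrite [RHS]integral_mkcond; apply: eq_integral => x _; rewrite patchE mem_setE /= in_itv /= -ler_norml.
  case: leP => // Nx; have [|_ ->//] := Z x.
  by apply: lt_trans Nx; rewrite ltrDl.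
rewrite (dv_FTC _ dF cF'); last by lra.
have [|-> _] := Z (N + 1); first by rewrite ger0_norm; lra.
have [|-> _] := Z (- (N + 1)); first by rewrite normrN ger0_norm; lra.
by rewrite subrr.
Qed.

Lemma I_iter_zero (F : R * R -> R) : mu2.-integrable setT (EFin \o F) ->
  (forall y, (\int[mu]_x (F (x, y))%:E = 0)%E) \/ (forall x, (\int[mu]_y (F (x, y))%:E = 0)%E) -> I F = 0.
Proof.
move=> iF H; rewrite /Rintegral -[X in fine X](_ : 0%E = _)//.
case: H => H.
  have E := @integral21_prod_meas1 _ _ _ _ R mu mu (EFin \o F) iF.
  rewrite -[RHS]E; apply/esym; transitivity (\int[mu]_x (cst 0%E x))%E; last by rewrite integral0.
  by apply: eq_integral => y _; exact: H.
have E := @integral12_prod_meas1 _ _ _ _ R mu mu (EFin \o F) iF.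
rewrite -[RHS]E; apply/esym; transitivity (\int[mu]_x (cst 0%E x))%E; last by rewrite integral0.
by apply: eq_integral => y _; exact: H.
Qed.

Lemma dx_dv (phi : R * R -> R) (p : R * R) : derivable phi p (1, 0) -> dv p.1 (fun x => phi (x, p.2)) (dx phi p).
Proof.
rewrite /dx /derivable /derive /dv.
have -> : (fun h : R => h^-1 *: ((phi \o shift p) (h *: ((1, 0) : R * R)) - phi p)) =
  (fun h : R => h^-1 *: (((fun x : R => phi (x, p.2)) \o shift p.1) (h *: 1) - (fun x : R => phi (x, p.2)) p.1)).
  apply/funext => h /=; case: p => p1 p2 /=.
  congr (h^-1 *: (phi _ - _)).
  by rewrite [LHS]surjective_pairing /=; congr pair; rewrite scaler0 add0r.
by move=> d; split.
Qed.

Lemma dy_dv (phi : R * R -> R) (p : R * R) : derivable phi p (0, 1) -> dv p.2 (fun y => phi (p.1, y)) (dy phi p).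
Proof.
rewrite /dy /derivable /derive /dv.
have -> : (fun h : R => h^-1 *: ((phi \o shift p) (h *: ((0, 1) : R * R)) - phi p)) =
  (fun h : R => h^-1 *: (((fun x : R => phi (p.1, x)) \o shift p.2) (h *: 1) - (fun x : R => phi (p.1, x)) p.2)).
  apply/funext => h /=; case: p => p1 p2 /=.
  congr (h^-1 *: (phi _ - _)).
  by rewrite [LHS]surjective_pairing /=; congr pair; rewrite scaler0 add0r.
by move=> d; split.
Qed.

(** Strict inequalities make this set open, so a function vanishing on it has vanishing directional
    derivatives there too. *)
Definition outN (N c : R) (p : R * R) := N < `|p.1| \/ p.2 < c \/ N < `|p.2|.

Lemma outN_near N c p : outN N c p -> \forall q \near p, outN N c q.
Proof.
have cn1 : continuous_at p (fun q : R * R => `|q.1|) by cont.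
have cn2 : continuous_at p (fun q : R * R => `|q.2|) by cont.
move=> [h|[h|h]].
- have n : \forall q \near p, N < `|q.1| by have := cn1 _ (near_gtr h).
  by apply: filterS n => q hq; left.
- have n : \forall q \near p, q.2 < c by have := @ctsnd R p _ (near_ltr h).
  by apply: filterS n => q hq; right; left.
- have n : \forall q \near p, N < `|q.2| by have := cn2 _ (near_gtr h).
  by apply: filterS n => q hq; right; right.
Qed.

Lemma test_fun_supp (phi : R * R -> R) : test_fun_UHP phi ->
  exists N c : R, [/\ 0 < N, 0 < c & forall p, outN N c p -> phi p = 0 /\ forall v, 'D_v phi p = 0].
Proof.
move=> [_ [_ [a [b [c [d [c0 H]]]]]]].
exists (`|a| + `|b| + `|d| + 1), c.
have N0 : 0 < `|a| + `|b| + `|d| + 1 by rewrite ltr_wpDl// !addr_ge0.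
split => //.
have Z p : outN (`|a| + `|b| + `|d| + 1) c p -> phi p = 0.
  move=> o; apply: H => -[/andP[h1 h2] /andP[h3 h4]].
  have := normr_ge0 a; have := normr_ge0 b; have := normr_ge0 d.
  have := ler_norm b; have := ler_norm d; have := ler_norm (- a); rewrite normrN => *.
  case: o => [|[]]; last 1 first.
  - by rewrite (@ger0_norm _ p.2); [move=> ?; lra|lra].
  - by rewrite ltNge => /negP; apply; rewrite ler_norml; apply/andP; split; lra.
  - by move=> ?; lra.
move=> p o; split; first exact: Z.
move=> v; rewrite -(derive_cst (0 : R) p v); apply: near_eq_derive.
  by apply: filterS (outN_near o) => q /Z.
Qed.

Section IBP.
Variables (k : R * R -> R) (phi : R * R -> R).
Hypothesis kc : forall p : R * R, 0 < p.2 -> continuous_at p k.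
Hypothesis T : test_fun_UHP phi.

(** Near and below the axis the product is locally [0], which makes up for the missing control on
    [g] where its formula divides by the height. *)
Lemma cont_mul_supp (g psi : R * R -> R) (c : R) : 0 < c -> (forall p : R * R, 0 < p.2 -> continuous_at p g) ->
  continuous psi -> (forall p : R * R, p.2 < c -> psi p = 0) -> continuous (fun p => g p * psi p).
Proof.
move=> c0 cg cpsi Z p; have [p0|p0] := ltP 0 p.2.
  by apply: ctM; [exact: cg|exact: cpsi].
apply: (@ct_near R _ (fun=> 0)); last by cont.
have n : \forall q \near p, q.2 < c by have := @ctsnd R p _ (near_ltr (le_lt_trans p0 c0)).
by apply: filterS n => q /Z ->; rewrite mulr0.
Qed.

Lemma phi_cont : continuous phi. Proof. by case: T => c _; exact: (c [::]). Qed.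
Lemma dphi_cont v : continuous (fun p => 'D_v phi p). Proof. by case: T => c _; exact: (c [:: v]). Qed.

Lemma prod_supp (g : R * R -> R) : (forall p : R * R, 0 < p.2 -> continuous_at p g) ->
  (continuous (fun p => g p * phi p) /\ mu2.-integrable setT (EFin \o (fun p => g p * phi p))) /\
  forall v, continuous (fun p => g p * 'D_v phi p) /\ mu2.-integrable setT (EFin \o (fun p => g p * 'D_v phi p)).
Proof.
move=> cg; have [N [c [N0 c0 Z]]] := test_fun_supp T.
have zz psi : continuous psi -> (forall p, outN N c p -> psi p = 0) ->
    continuous (fun p => g p * psi p) /\ mu2.-integrable setT (EFin \o (fun p => g p * psi p)).
  move=> cpsi zpsi; have cc : continuous (fun p => g p * psi p).
    by apply: (cont_mul_supp c0) => // p pc; apply: zpsi; right; left.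
  split => //; apply: (continuous_bx_integrable cc (N := N)) => p o.
  by rewrite zpsi ?mulr0//; case: o => o; [left|right; right].
split; first by apply: zz; [exact: phi_cont|move=> p /Z[]].
move=> v; apply: zz; first exact: dphi_cont.
by move=> p /Z[_]; apply.
Qed.

(** On each horizontal line [k * phi] has compact support, so its derivative integrates to [0];
    Fubini's theorem does the rest. Lines below the support are treated apart, since [k] is only
    known to be differentiable above the axis. *)
Lemma ibp_x (kx : R * R -> R) : (forall p : R * R, 0 < p.2 -> continuous_at p kx) ->
  (forall p : R * R, 0 < p.2 -> dv p.1 (fun x => k (x, p.2)) (kx p)) ->
  I (fun p => kx p * phi p) = - I (fun p => k p * dx phi p).
Proof.
move=> kxc dk; have [N [c [N0 c0 Z]]] := test_fun_supp T.
have [[c1 i1] _] := prod_supp kxc.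
have [_ /(_ (1, 0)) [c2 i2]] := prod_supp kc.
apply/eqP; rewrite -addr_eq0 -RintegralD//; apply/eqP.
apply: I_iter_zero; first by have := integrableD measurableT i1 i2; apply: eq_integrable.
left => y; have [y0|y0] := ltP y c.
  have -> : (\int[mu]_x (kx (x, y) * phi (x, y) + k (x, y) * 'D_((1, 0) : R * R) phi (x, y))%:E = \int[mu]_x (cst 0%E x))%E.
    apply: eq_integral => x _; have [|-> ->] := Z (x, y); first by right; left.
    by rewrite !mulr0 addr0.
  by rewrite integral0.
apply: (integral_deriv_supp (F := fun x => k (x, y) * phi (x, y)) N0).
- move=> x; eapply dv_eq.
    apply: dvM; first by apply: (dk (x, y)); exact: lt_le_trans y0.
    by apply: (@dx_dv phi (x, y)); case: T => _ [d _]; exact: (d [::]).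
  by rewrite /dx /=; ring.
- move=> x.
  have cy : continuous_at x (fun x : R => (x, y)) by exact: (cvg_pair cvg_id (cvg_cst y)).
  have c12 : continuous (fun p => kx p * phi p + k p * dx phi p) by move=> p; apply: ctD; [exact: c1|exact: c2].
  exact: (@cvg_comp _ _ _ (fun x => (x, y)) (fun p => kx p * phi p + k p * dx phi p) _ _ _ cy (c12 (x, y))).
- move=> x Nx; rewrite /dx; have [|-> ->] := Z (x, y); first by left.
  by rewrite !mulr0 addr0.
Qed.

Lemma ibp_y (ky : R * R -> R) : (forall p : R * R, 0 < p.2 -> continuous_at p ky) ->
  (forall p : R * R, 0 < p.2 -> dv p.2 (fun y => k (p.1, y)) (ky p)) ->
  I (fun p => ky p * phi p) = - I (fun p => k p * dy phi p).
Proof.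
move=> kyc dk; have [N [c [N0 c0 Z]]] := test_fun_supp T.
have [[c1 i1] _] := prod_supp kyc.
have [_ /(_ (0, 1)) [c2 i2]] := prod_supp kc.
apply/eqP; rewrite -addr_eq0 -RintegralD//; apply/eqP.
apply: I_iter_zero; first by have := integrableD measurableT i1 i2; apply: eq_integrable.
right => x.
apply: (integral_deriv_supp (F := fun y => k (x, y) * phi (x, y)) N0).
- move=> y; have [y0|y0] := ltP 0 y.
    eapply dv_eq.
      apply: dvM; first exact: (dk (x, y)).
      by apply: (@dy_dv phi (x, y)); case: T => _ [d _]; exact: (d [::]).
    by rewrite /dy /=; ring.
  have [|p0 d0] := Z (x, y); first by right; left; exact: le_lt_trans c0.
  rewrite p0 /dy d0 !mulr0 addr0.
  have nE : \forall z \near y, (fun=> 0) z = k (x, z) * phi (x, z).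
    have yc : y < c by exact: le_lt_trans c0.
    near=> z; have [|-> _] := Z (x, z); last by rewrite mulr0.
    by right; left => /=; near: z; exact: near_ltr.
  by apply: near_eq_is_derive nE (dv_cst y 0); exact: oner_neq0.
- move=> y.
  have cy : continuous_at y (fun y : R => (x, y)) by exact: (cvg_pair (cvg_cst x) cvg_id).
  have c12 : continuous (fun p => ky p * phi p + k p * dy phi p) by move=> p; apply: ctD; [exact: c1|exact: c2].
  exact: (@cvg_comp _ _ _ (fun y => (x, y)) (fun p => ky p * phi p + k p * dy phi p) _ _ _ cy (c12 (x, y))).
- move=> y Ny; rewrite /dy; have [|-> ->] := Z (x, y); first by right; right.
  by rewrite !mulr0 addr0.
Unshelve. all: by end_near. Qed.

End IBP.

Lemma dv_comp (F g : R -> R) (x dF dg : R) : dv (g x) F dF -> dv x g dg -> dv x (fun y => F (g y)) (dF * dg).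
Proof. by move=> h1 h2; have H := @is_derive1_comp _ F g x _ _ h1 h2; exact: (dv_eq H). Qed.

Section Ext.
Variables f G : R -> R.
Hypothesis cf : continuous f.
Hypothesis dG : forall x, dv x G (f x).

Definition qux (p : R * R) := (f (p.1 + p.2) - f (p.1 - p.2)) / (2 * p.2).
Definition quy (p : R * R) := (f (p.1 + p.2) + f (p.1 - p.2)) / (2 * p.2) - qu G p / p.2.
Definition qvx (p : R * R) := (f (p.1 + p.2) + f (p.1 - p.2) - 2 * f p.1) / p.2.
Definition qvy (p : R * R) := (f (p.1 + p.2) - f (p.1 - p.2)) / p.2 - qv G p / p.2.

Let c1 (p : R * R) : continuous_at p (fun p : R * R => f (p.1 + p.2)).
Proof. by apply: (@ctcomp R (R * R)%type f (fun p => p.1 + p.2) p cf); cont. Qed.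
Let c2 (p : R * R) : continuous_at p (fun p : R * R => f (p.1 - p.2)).
Proof. by apply: (@ctcomp R (R * R)%type f (fun p => p.1 - p.2) p cf); cont. Qed.
Let c3 (p : R * R) : continuous_at p (fun p : R * R => f p.1).
Proof. by apply: (@ctcomp R (R * R)%type f fst p cf); exact: ctfst. Qed.

Let pn (p : R * R) : 0 < p.2 -> p.2 != 0. Proof. by move=> p0; rewrite gt_eqF. Qed.

Lemma quv_cont (p : R * R) : 0 < p.2 ->
  [/\ continuous_at p qux, continuous_at p quy, continuous_at p qvx & continuous_at p qvy].
Proof.
move=> p0; have := pn p0 => n.
split; [rewrite /qux|rewrite /quy|rewrite /qvx|rewrite /qvy]; cont;
  first [exact: c1|exact: c2|exact: c3|exact: n|exact: (qu_cont dG p0)|exact: (qv_cont dG p0)|by rewrite mulf_neq0].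
Qed.

Let dGc (g : R -> R) (x dg d : R) : dv x g dg -> f (g x) * dg = d -> dv x (fun x => G (g x)) d.
Proof. by move=> dg1 <-; exact: dv_comp. Qed.

Lemma qu_dv (p : R * R) : 0 < p.2 -> dv p.1 (fun x => qu G (x, p.2)) (qux p) /\ dv p.2 (fun y => qu G (p.1, y)) (quy p).
Proof.
case: p => x y /= y0; have n := @pn (x, y) y0; rewrite /= in n.
have n2 : 2 * y != 0 by rewrite mulf_neq0.
rewrite /qu /qux /quy /qu /=; split.
- have d1 : dv x (fun x => G (x + y)) (f (x + y)) by apply: dGc; [deriv|ring].
  have d2 : dv x (fun x => G (x - y)) (f (x - y)) by apply: dGc; [deriv|ring].
  by eapply dv_eq; [deriv|]; cbv beta; field.
- have d1 : dv y (fun y => G (x + y)) (f (x + y)).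
    by apply: (@dGc (fun y => x + y) y (0 + 1)); [apply: dvD; [exact: dv_cst|exact: dv_id]|rewrite add0r mulr1].
  have d2 : dv y (fun y => G (x - y)) (- f (x - y)).
    by apply: (@dGc (fun y => x - y) y (0 - 1)); [apply: dvB; [exact: dv_cst|exact: dv_id]|rewrite sub0r mulrN1].
  by eapply dv_eq; [deriv|]; [done|]; cbv beta; field.
Qed.

Lemma qv_dv (p : R * R) : 0 < p.2 -> dv p.1 (fun x => qv G (x, p.2)) (qvx p) /\ dv p.2 (fun y => qv G (p.1, y)) (qvy p).
Proof.
case: p => x y /= y0; have n := @pn (x, y) y0; rewrite /= in n.
rewrite /qv /qvx /qvy /qv /=; split.
- have d1 : dv x (fun x => G (x + y)) (f (x + y)) by apply: dGc; [deriv|ring].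
  have d2 : dv x (fun x => G (x - y)) (f (x - y)) by apply: dGc; [deriv|ring].
  have d3 := dG x.
  by eapply dv_eq; [deriv|]; cbv beta; field.
- have d1 : dv y (fun y => G (x + y)) (f (x + y)).
    by apply: (@dGc (fun y => x + y) y (0 + 1)); [apply: dvD; [exact: dv_cst|exact: dv_id]|rewrite add0r mulr1].
  have d2 : dv y (fun y => G (x - y)) (- f (x - y)).
    by apply: (@dGc (fun y => x - y) y (0 - 1)); [apply: dvB; [exact: dv_cst|exact: dv_id]|rewrite sub0r mulrN1].
  by eapply dv_eq; [deriv|]; [done|]; cbv beta; field.
Qed.

Lemma dbar_qE (p : R * R) : 0 < p.2 -> dbar_re f G p = (qux p - qvy p) / 2 /\ dbar_im f G p = (qvx p + quy p) / 2.
Proof.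
move=> /pn n; rewrite /dbar_re /dbar_im /qux /qvy /qvx /quy /qu /qv.
by split; field.
Qed.

Lemma int_EFin (A : R * R -> R) : mu2.-integrable setT (EFin \o A) ->
  (\int[mu2]_p (A p)%:E = (I A)%:E)%E.
Proof. by move=> iA; rewrite /Rintegral fineK//; exact: integrable_fin_num. Qed.

Lemma I_half (A B : R * R -> R) : mu2.-integrable setT (EFin \o A) -> mu2.-integrable setT (EFin \o B) ->
  (\int[mu2]_p ((A p + B p) / 2)%:E = ((I A + I B) / 2)%:E)%E.
Proof.
move=> iA iB.
have iAB : mu2.-integrable setT (EFin \o (fun p => A p + B p)).
  by have := integrableD measurableT iA iB; apply: eq_integrable.
have i2 : mu2.-integrable setT (EFin \o (fun p => (A p + B p) / 2)).
  by have := integrableZl measurableT 2^-1 iAB; apply: eq_integrable => // p _ /=; rewrite -EFinM mulrC.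
rewrite (int_EFin i2) -RintegralD// mulrC -RintegralZl//.
by congr (_%:E); apply: eq_Rintegral => p _; rewrite mulrC.
Qed.

(** Above the axis the extension has continuous partial derivatives, and test functions stay away
    from the axis, so the weak dbar derivative is the classical one: four integrations by parts,
    combined pairwise. *)
Lemma extension_dbar : is_dbar_UHP (ext_re f G) (ext_im G) (dbar_re f G) (dbar_im f G).
Proof.
move=> phi T.
have [cux cuy cvx cvy] : [/\ forall p : R * R, 0 < p.2 -> continuous_at p qux,
    forall p : R * R, 0 < p.2 -> continuous_at p quy, forall p : R * R, 0 < p.2 -> continuous_at p qvx &
    forall p : R * R, 0 < p.2 -> continuous_at p qvy].
  by split=> p p0; have [] := quv_cont p0.
have cu := @qu_cont R f G dG; have cv := @qv_cont R f G dG.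
have Eux := ibp_x cu T cux (fun p p0 => (qu_dv p0).1).
have Euy := ibp_y cu T cuy (fun p p0 => (qu_dv p0).2).
have Evx := ibp_x cv T cvx (fun p p0 => (qv_dv p0).1).
have Evy := ibp_y cv T cvy (fun p p0 => (qv_dv p0).2).
have iN A : mu2.-integrable setT (EFin \o A) -> mu2.-integrable setT (EFin \o (fun p => - A p)) /\ I (fun p => - A p) = - I A.
  move=> iA; split; last by rewrite /Rintegral (_ : (\int[mu2]_p (- A p)%:E = - \int[mu2]_p (A p)%:E)%E) ?fineN// -integralN//; exact: integrable_add_def.
  by have := integrableN iA; apply: eq_integrable.
have [[_ iux] _] := prod_supp T cux; have [[_ iuy] _] := prod_supp T cuy.
have [[_ ivx] _] := prod_supp T cvx; have [[_ ivy] _] := prod_supp T cvy.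
have [_ iu] := prod_supp T cu; have [_ iv] := prod_supp T cv.
have iux' : mu2.-integrable setT (EFin \o (fun p => qu G p * dx phi p)) := (iu (1, 0)).2.
have iuy' : mu2.-integrable setT (EFin \o (fun p => qu G p * dy phi p)) := (iu (0, 1)).2.
have ivx' : mu2.-integrable setT (EFin \o (fun p => qv G p * dx phi p)) := (iv (1, 0)).2.
have ivy' : mu2.-integrable setT (EFin \o (fun p => qv G p * dy phi p)) := (iv (0, 1)).2.
have [ivyN EvyN] := iN _ ivy; have [ivyN' EvyN'] := iN _ ivy'.
have zz (p v : R * R) : ~~ (0 < p.2) -> phi p = 0 /\ 'D_v phi p = 0.
  by rewrite -leNgt; exact: test_zero.
split.
- rewrite !int_UHP.
  transitivity (\int[mu2]_p ((qux p * phi p + - (qvy p * phi p)) / 2)%:E)%E.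
    apply: eq_integral => p _; congr (_%:E); rewrite /cutU; case: ifPn => p0.
      by rewrite (dbar_qE p0).1; ring.
    by have [-> _] := zz p (0, 0) p0; rewrite !mulr0 subrr mul0r.
  rewrite (I_half iux ivyN) EvyN Eux Evy.
  rewrite [X in (- X)%E](_ : _ = \int[mu2]_p ((qu G p * dx phi p + - (qv G p * dy phi p)) / 2)%:E)%E; last first.
    apply: eq_integral => p _; congr (_%:E); rewrite /cutU; case: ifPn => p0.
      by rewrite ext_re_pos// ext_im_pos.
    by rewrite /dx /dy; have [_ ->] := zz p (1, 0) p0; have [_ ->] := zz p (0, 1) p0; rewrite !mulr0 subrr mul0r.
  rewrite (I_half iux' ivyN') EvyN' -EFinN; congr (_%:E).
  by move: (I _) (I _) => a b; rewrite -mulNr opprD.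
- rewrite !int_UHP.
  transitivity (\int[mu2]_p ((qvx p * phi p + quy p * phi p) / 2)%:E)%E.
    apply: eq_integral => p _; congr (_%:E); rewrite /cutU; case: ifPn => p0.
      by rewrite (dbar_qE p0).2; ring.
    by have [-> _] := zz p (0, 0) p0; rewrite !mulr0 addr0 mul0r.
  rewrite (I_half ivx iuy) Evx Euy.
  rewrite [X in (- X)%E](_ : _ = \int[mu2]_p ((qv G p * dx phi p + qu G p * dy phi p) / 2)%:E)%E; last first.
    apply: eq_integral => p _; congr (_%:E); rewrite /cutU; case: ifPn => p0.
      by rewrite ext_re_pos// ext_im_pos.
    by rewrite /dx /dy; have [_ ->] := zz p (1, 0) p0; have [_ ->] := zz p (0, 1) p0; rewrite !mulr0 addr0 mul0r.
  rewrite (I_half ivx' iuy') -EFinN; congr (_%:E).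
  by move: (I _) (I _) => a b; rewrite -mulNr opprD.
Qed.

End Ext.
End Dbar.

Lemma extension_Linfty (R : realType) (f G w : R -> R) : continuous f -> (forall x, dv x G (f x)) ->
  measurable_fun setT w -> (forall a b, lebesgue_measure.-integrable `[a, b] (EFin \o w)) ->
  (forall a b, a <= b -> f b - f a = \int[lebesgue_measure]_(t in `[a, b]) w t) ->
  (\int[lebesgue_measure]_t sqdiff w t < +oo)%E -> Linfty_UHP (dbar_re f G) (dbar_im f G).
Proof.
move=> cf dG mw iw fw E; have [m1 m2] := measurable_dbar cf dG.
have [M HM] := dbar_bounded dG mw iw fw E.
(* Both components are at most [M] in absolute value, so the modulus never exceeds [2 * M] and the
   exceptional set is empty. *)
do 2 (split => //); exists (2 * M).
rewrite (_ : _ `&` _ = set0) ?measure0//; apply/seteqP; split=> // -[x y] [/= y0].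
have [h1 h2] := HM x y y0.
have M0 : 0 <= M by exact: le_trans h1.
rewrite ltNge => /negP; apply.
rewrite -[leRHS]ger0_norm ?mulr_ge0// -sqrtr_sqr ler_wsqrtr//.
have sq g : `|g| <= M -> g ^+ 2 <= M ^+ 2.
  by move=> h; rewrite -(real_normK (num_real g)) ler_pXn2r// nnegrE.
have := sq _ h1; have := sq _ h2; rewrite exprMn; have := sqr_ge0 M; lra.
Qed.

Theorem theorem8p2 (R : realType) (f : R -> R) (hf : continuous f) :
  H32 f <->
  exists (u v g1 g2 : R * R -> R),
    (* extension: continuous on U \cup R and equal to f on R *)
    {within @cUHP R, continuous u} /\ {within @cUHP R, continuous v} /\
    (forall x : R, u (x, 0) = f x /\ v (x, 0) = 0) /\
    (* quasiconformal deformation on U with dbar F = g1 + i g2 *)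
    qc_deformation_UHP u v g1 g2 /\
    (* F(z) = o(z^2) as z -> oo in U \cup R *)
    (forall eps : R, 0 < eps -> exists M : R, forall p : R * R, 0 <= p.2 ->
        M <= Num.sqrt (p.1 ^+ 2 + p.2 ^+ 2) ->
        Num.sqrt (u p ^+ 2 + v p ^+ 2) <= eps * (p.1 ^+ 2 + p.2 ^+ 2)) /\
    (* finite weighted Dirichlet-type energy *)
    (\int[@mu2 R]_(p in @UHP R) ((g1 p ^+ 2 + g2 p ^+ 2) / p.2 ^+ 2)%:E < +oo)%E.
Proof.
split; last first.
  by move=> [u [v [g1 [g2 [cu [cv [bd [qc [gr en]]]]]]]]]; exact: (H32_of_extension hf cu cv bd qc gr en).
move=> [lac [li en]].
have [G dG] := antiderivative_exists hf.
have mw : measurable_fun setT (derive1 f) by exact: measurable_derive1.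
have iw a b : lebesgue_measure.-integrable `[a, b] (EFin \o derive1 f) := locally_integrable_itv a b li.
have fw a b := @loc_abs_cont_FTC R f lac li a b.
have E : (\int[lebesgue_measure]_t sqdiff (derive1 f) t < +oo)%E.
  (* The factor [1 / (4 * pi^2)] is positive, so an infinite double integral would stay infinite. *)
  rewrite ltNge leye_eq; apply/negP => /eqP Eoo.
  move: en; rewrite [X in (_ * X)%E](_ : _ = +oo%E); last exact: Eoo.
  by rewrite gt0_muley ?ltxx// lte_fin divr_gt0// mulr_gt0// exprn_gt0// pi_gt0.
have [cu cv] := extension_continuous hf dG.
exists (ext_re f G), (ext_im G), (dbar_re f G), (dbar_im f G).
split; first exact: cu.
split; first exact: cv.
split; first exact: extension_boundary.
split; last split.
- split; first exact: extension_dbar.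
  exact: (extension_Linfty hf dG mw iw fw E).
- by move=> e e0; exact: (growth_ext dG mw iw fw E e0).
- exact: (dbar_energy hf dG mw iw fw E).
Qed.
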